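(* Assume that for every $g\in G$ the map $\alpha_g:a\mapsto U_gaU_g^*$ is a $*$-automorphism of both $\mathcal A$ and $\mathcal Z$, and that the action $\alpha$ is amenable. Let $\pi=\bigoplus_{\omega\in\Omega}\pi_\omega$ be the local trajectories representation, assumed well defined on $\mathcal B_0$. Then for any non-empty open $V\subset M$, any finite $G_0\subset G$, any $a_s\in\mathcal A$ ($s\in G_0$), and all $z_V\in\mathcal Z(V)$, $$\Big\|\pi(z_V)\,\pi\Big(a_e+\sum_{e\ne s\in G_0}a_sU_s\Big)\Big\|\ \ge\ \|\pi(z_V)\,\pi(a_e)\| .$$ In particular, for every non-empty open $V\subset M$, every finite $G_0\subset G$ and all $a_s\in\mathcal A$ there is $z_V\in\mathcal Z(V)$ with $\|\pi(z_V)\pi(a_e)\|\le\|\pi(z_V)\sum_{s\in G_0}\pi(a_s)\pi(U_s)\|$. If moreover $\mathcal A$ is $M$-localizable, then $$\mathrm{id}\rtimes\pi(U):\pi(\mathcal A)\rtimes_{\alpha'}G\to\pi(\mathcal B)$$ is an isomorphism.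
   Context: Setting. $H$ is a Hilbert space, $\mathcal A\subset B(H)$ is a unital $C^*$-subalgebra with $1_{\mathcal A}=I$, $G$ is a discrete group with identity $e$, $U:G\to B(H)$, $g\mapsto U_g$, is a unitary representation, and $\mathcal Z$ is a central $C^*$-subalgebra of $\mathcal A$ with $1_{\mathcal A}\in\mathcal Z$. $\alpha:G\to\mathrm{Aut}(\mathcal A)$ is the action $\alpha_g(a)=U_gaU_g^*$. $\mathcal B_0$ is the $*$-algebra of finite sums $\sum_{g\in G_0}a_gU_g$, $a_g\in\mathcal A$, and $\mathcal B\subset B(H)$ is its closure. $M$ is the compact Hausdorff maximal ideal (character) space of $\mathcal Z$, and $\mathcal Z$ is identified with $C(M)$ by the Gelfand transform. For $g\in G$, $\beta_g:M\to M$ is the homeomorphism with $z(\beta_g(m))=(\alpha_g(z))(m)$ for $z\in\mathcal Z$, $m\in M$. For a non-empty open $V\subset M$, $\mathcal Z(V)=\{z\in C(M):0\le z\le1,\ \|z\|=1,\ \mathrm{supp}\,z\subset V\}$. Convention: $a_e:=0$ if $e\notin G_0$. $M$-localizable: let $\mathcal P_{\mathcal A}$ be the set of pure states of $\mathcal A$ with the weak-$*$ topology and $\psi:\mathcal P_{\mathcal A}\to M$, $\mu\mapsto\mu|_{\mathcal Z}$ (restriction, a character of $\mathcal Z$). $\mathcal A$ is $M$-localizable if $\psi(W)$ is open in $M$ for every open $W\subset\mathcal P_{\mathcal A}$. Amenable action: for finitely supported $f:G\to\mathcal A$ put $\|f\|_2=\|\sum_gf(g)f(g)^*\|^{1/2}$.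 The action $\alpha$ is amenable if there are finitely supported functions $x_i:G\to\mathcal A$, $i\in\mathbb N$, with values in the center of $\mathcal A$, such that $x_i(g)\ge0$ for all $i,g$; $\sum_gx_i(g)^2=1_{\mathcal A}$ for all $i$; and $\|\delta_s*x_i-x_i\|_2\to0$ for all $s\in G$, where $(\delta_s*x_i)(g)=\alpha_s(x_i(s^{-1}g))$. Local trajectories representations: $\Omega$ is the set of orbits $\{\beta_g(m):g\in G\}$, $m\in M$. For $m\in M$, $J_m$ is the closed two-sided ideal of $\mathcal A$ generated by the maximal ideal $m$ of $\mathcal Z$. For each $\omega\in\Omega$ fix $m_\omega\in\omega$ and a faithful (unital) representation $\phi_\omega:\mathcal A/J_{m_\omega}\to B(H_\omega)$, and let $\pi'_\omega=\phi_\omega\circ\rho_{m_\omega}$, with $\rho_{m_\omega}:\mathcal A\to\mathcal A/J_{m_\omega}$ the quotient map. $\pi_\omega$ acts on $\ell^2(G,H_\omega)$ by $[\pi_\omega(a)\xi](t)=\pi'_\omega(\alpha_t^{-1}(a))\xi(t)$ for $a\in\mathcal A$ and $[\pi_\omega(U_g)\xi](t)=\xi(g^{-1}t)$. ''Well defined on $\mathcal B_0$'' means that $\pi_\omega(\sum a_gU_g):=\sum\pi_\omega(a_g)\pi_\omega(U_g)$ does not depend on the chosen expression (this holds e.g. when elements of $\mathcal B_0$ uniquely determine their coefficients $a_g$). It is known that $\pi$ is injective on $\mathcal A$. $\alpha'_g(\pi(a))=\pi(\alpha_g(a))=\pi(U_g)\pi(a)\pi(U_g)^*$. $\pi(\mathcal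 B)$ denotes the $C^*$-algebra generated by $\pi(\mathcal A)$ and $\{\pi(U_g):g\in G\}$. $\pi(\mathcal A)\rtimes_{\alpha'}G$ is the full crossed product, and $\mathrm{id}\rtimes\pi(U)$ is the canonical $*$-homomorphism determined by $f\mapsto\sum_gf(g)\pi(U_g)$ for finitely supported $f:G\to\pi(\mathcal A)$. *)

(* Defs.v *)
From HB Require Import structures.
From mathcomp Require Import all_boot all_order all_algebra finmap.
From mathcomp Require Import all_classical reals ereal topology normedtype.
From mathcomp Require Import sequences numfun esum.
From mathcomp Require Import complex ring lra.

Set Implicit Arguments.
Unset Strict Implicit.
Unset Printing Implicit Defensive.

Import Order.TTheory GRing.Theory Num.Theory.
Import numFieldNormedType.Exports.

Local Open Scope classical_set_scope.
Local Open Scope ring_scope.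
Local Open Scope complex_scope.

Definition form_norm (R : realType) (V : lmodType R[i]) (f : V -> V -> R[i])
  (x : V) : R := Num.sqrt (complex.Re (f x x)).

(* [inner] is linear in its first argument. *)
HB.mixin Record Lmodule_isHilbert (R : realType) V of GRing.Lmodule R[i] V := {
  inner : {dot V for @Num.conj R[i]} ;
  hilbert_complete : forall u : nat -> V,
    (forall e : R, 0 < e -> exists N : nat, forall m n : nat,
       (N <= m)%N -> (N <= n)%N -> form_norm inner (u m - u n) < e) ->
    exists l : V, forall e : R, 0 < e -> exists N : nat, forall n : nat,
       (N <= n)%N -> form_norm inner (u n - l) < e
}.

#[short(type="hilbertType")]
HB.structure Definition Hilbert (R : realType) :=
  {V of GRing.Lmodule R[i] V & Lmodule_isHilbert R V}.

Definition hnorm (R : realType) (H : hilbertType R) (x : H) : R :=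
  form_norm (@inner R H) x.

Section HilbertTheory.
Variables (R : realType) (H : hilbertType R).
Implicit Types x y : H.

Lemma hnorm_ge0 x : 0 <= hnorm x.
Proof. exact: sqrtr_ge0. Qed.

Lemma inner_ge0 x : 0 <= inner x x.
Proof. exact: dnorm_ge0. Qed.

Lemma hnorm_sqr x : hnorm x ^+ 2 = complex.Re (inner x x).
Proof.
rewrite sqr_sqrtr //; have := inner_ge0 x.
by rewrite lecE => /andP[].
Qed.

Lemma innerE x : inner x x = (hnorm x ^+ 2)%:C.
Proof.
rewrite hnorm_sqr; have := inner_ge0 x; rewrite lecE => /andP[/eqP + _] /=.
by case: (inner x x) => a b /= ->.
Qed.

Lemma hnormZ_sqr (c : R[i]) x :
  hnorm (c *: x) ^+ 2 = complex.Re (`|c| ^+ 2) * hnorm x ^+ 2.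
Proof.
rewrite hnorm_sqr dnormZ innerE sqr_normc.
case: c => a b /=; rewrite !mulr0 !subr0; ring.
Qed.

Lemma hnormD_sqr x y :
  hnorm (x + y) ^+ 2 = hnorm x ^+ 2 + hnorm y ^+ 2 +
     complex.Re (inner x y) *+ 2.
Proof.
rewrite !hnorm_sqr dnormD.
case: (inner x x) (inner y y) (inner x y) => [a b] [a' b'] [c d] /=.
by rewrite mulr2n.
Qed.

Lemma hnormN_sqr x : hnorm (- x) ^+ 2 = hnorm x ^+ 2.
Proof. by rewrite !hnorm_sqr hnormN. Qed.

Lemma hnormD_sqr_le x y :
  hnorm (x + y) ^+ 2 <= (hnorm x ^+ 2 + hnorm y ^+ 2) *+ 2.
Proof.
have := sqr_ge0 (hnorm (x - y)).
rewrite !hnormD_sqr hnormN_sqr linearNr raddfN /=.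
lra.
Qed.

Lemma innerPl (a : R[i]) x y z :
  inner (a *: x + y) z = a * inner x z + inner y z.
Proof. exact: linearPl. Qed.

Lemma innerC x y : inner x y = (inner y x)^*.
Proof. by rewrite (hermC (@inner R H)) expr0 mul1r. Qed.

Lemma hnorm_eq0 x : hnorm x = 0 -> x = 0.
Proof.
move=> x0; apply/eqP; rewrite -(dnorm_eq0 (@inner R H)) innerE x0 expr0n.
by [].
Qed.

Lemma Re_inner_le x y :
  `|complex.Re (inner x y)| <= hnorm x ^+ 2 + hnorm y ^+ 2.
Proof.
have := sqr_ge0 (hnorm (x - y)); have := sqr_ge0 (hnorm (x + y)).
rewrite !hnormD_sqr hnormN_sqr linearNr raddfN /= => h1 h2.
by rewrite ler_norml; apply/andP; split; have := sqr_ge0 (hnorm x);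
  have := sqr_ge0 (hnorm y); lra.
Qed.

Lemma Im_inner_le x y :
  `|complex.Im (inner x y)| <= hnorm x ^+ 2 + hnorm y ^+ 2.
Proof.
have -> : complex.Im (inner x y) = complex.Re (inner ((- 'i) *: x) y).
  by rewrite linearZl_LR /=; case: (inner x y) => a b /=; ring.
apply: le_trans (Re_inner_le _ _) _.
rewrite hnormZ_sqr sqr_normc /=; lra.
Qed.

End HilbertTheory.

Definition bounded_linear (R : realType) (H K : hilbertType R) (T : H -> K) :=
  (forall (c : R[i]) x y, T (c *: x + y) = c *: T x + T y) /\
  exists M : R, forall x, hnorm (T x) <= M * hnorm x.

Record bop (R : realType) (H : hilbertType R) := BOp {
  bop_fun :> H -> H ;
  bopP : bounded_linear bop_fun
}.

Section BopAlgebra.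
Variables (R : realType) (H : hilbertType R).
Implicit Types S T : bop H.

HB.instance Definition _ := gen_eqMixin (bop H).
HB.instance Definition _ := gen_choiceMixin (bop H).

Lemma bop_eqP S T : (forall x, S x = T x) -> S = T.
Proof.
case: S T => [S hS] [T hT] /= ST.
have E : S = T by apply: funext.
by subst T; congr BOp; exact: Prop_irrelevance.
Qed.

Lemma bop_bound T : exists2 M : R, 0 <= M & forall x, hnorm (T x) <= M * hnorm x.
Proof.
have [_ [M hM]] := bopP T; exists (Num.max M 0); first by rewrite le_max lexx orbT.
by move=> x; apply: le_trans (hM x) _; rewrite ler_wpM2r ?hnorm_ge0// le_max lexx.
Qed.

Lemma bounded_of_sqr (T : H -> H) (M : R) :
  (forall x, hnorm (T x) ^+ 2 <= M * hnorm x ^+ 2) ->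
  exists M : R, forall x, hnorm (T x) <= M * hnorm x.
Proof.
move=> hM; exists (Num.sqrt (Num.max M 0)) => x.
have M0 : 0 <= Num.max M 0 by rewrite le_max lexx orbT.
rewrite -(@ler_pXn2r _ 2) // ?nnegrE ?mulr_ge0 ?hnorm_ge0 ?sqrtr_ge0 //.
rewrite [leRHS]exprMn (sqr_sqrtr M0); apply: (le_trans (hM x)).
by rewrite ler_wpM2r ?sqr_ge0 // le_max lexx.
Qed.

Lemma bop0_subproof : bounded_linear (fun _ : H => 0 : H).
Proof.
split=> [c x y|]; first by rewrite scaler0 addr0.
by exists 0 => x; rewrite mul0r /hnorm /form_norm linear0l sqrtr0.
Qed.

Lemma bop1_subproof : bounded_linear (fun x : H => x).
Proof. by split=> //; exists 1 => x; rewrite mul1r. Qed.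

Lemma bopD_subproof S T : bounded_linear (fun x => S x + T x).
Proof.
split=> [c x y|].
  by rewrite (bopP S).1 (bopP T).1 scalerDr addrACA.
have [M M0 hM] := bop_bound S; have [N N0 hN] := bop_bound T.
apply: (@bounded_of_sqr _ ((M ^+ 2 + N ^+ 2) *+ 2)) => x.
apply: le_trans (hnormD_sqr_le _ _) _; rewrite mulrnAl lerMn2r /= mulrDl.
by rewrite -!exprMn lerD// ler_pXn2r ?nnegrE ?mulr_ge0 ?hnorm_ge0.
Qed.

Lemma bopZ_subproof (a : R[i]) T : bounded_linear (fun x => a *: T x).
Proof.
split=> [c x y|]; first by rewrite (bopP T).1 scalerDr !scalerA mulrC.
have [M M0 hM] := bop_bound T.
apply: (@bounded_of_sqr _ (complex.Re (`|a| ^+ 2) * M ^+ 2)) => x.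
rewrite hnormZ_sqr -mulrA -exprMn ler_wpM2l//.
  by have := exprn_ge0 2 (normr_ge0 a); rewrite lecE => /andP[].
by rewrite ler_pXn2r ?nnegrE ?mulr_ge0 ?hnorm_ge0.
Qed.

Lemma bopM_subproof S T : bounded_linear (fun x => S (T x)).
Proof.
split=> [c x y|]; first by rewrite (bopP T).1 (bopP S).1.
have [M M0 hM] := bop_bound S; have [N N0 hN] := bop_bound T.
exists (M * N) => x; apply: le_trans (hM _) _.
by rewrite -mulrA ler_wpM2l.
Qed.

Definition bop_zero := BOp bop0_subproof.
Definition bop_one := BOp bop1_subproof.
Definition bop_add S T := BOp (bopD_subproof S T).
Definition bop_scale a T := BOp (bopZ_subproof a T).
Definition bop_mul S T := BOp (bopM_subproof S T).

Fact bop_addA : associative bop_add.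
Proof. by move=> S T V; apply: bop_eqP => x /=; rewrite addrA. Qed.
Fact bop_addC : commutative bop_add.
Proof. by move=> S T; apply: bop_eqP => x /=; rewrite addrC. Qed.
Fact bop_add0 : left_id bop_zero bop_add.
Proof. by move=> S; apply: bop_eqP => x /=; rewrite add0r. Qed.
Fact bop_addN : left_inverse bop_zero (bop_scale (-1)) bop_add.
Proof. by move=> S; apply: bop_eqP => x /=; rewrite scaleN1r addNr. Qed.

HB.instance Definition _ :=
  GRing.isZmodule.Build (bop H) bop_addA bop_addC bop_add0 bop_addN.

Fact bop_mulA : associative bop_mul.
Proof. by move=> S T V; apply: bop_eqP. Qed.
Fact bop_mul1 : left_id bop_one bop_mul.
Proof. by move=> S; apply: bop_eqP. Qed.
Fact bop_mulr1 : right_id bop_one bop_mul.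
Proof. by move=> S; apply: bop_eqP. Qed.
Fact bop_mulDl : left_distributive bop_mul bop_add.
Proof. by move=> S T V; apply: bop_eqP. Qed.
Fact bop_mulDr : right_distributive bop_mul bop_add.
Proof.
move=> S T V; apply: bop_eqP => x /=.
by rewrite -[T x]scale1r (bopP S).1 !scale1r.
Qed.

HB.instance Definition _ := GRing.Zmodule_isPzRing.Build (bop H)
  bop_mulA bop_mul1 bop_mulr1 bop_mulDl bop_mulDr.

Fact bop_scaleA a b T : bop_scale a (bop_scale b T) = bop_scale (a * b) T.
Proof. by apply: bop_eqP => x /=; rewrite scalerA. Qed.
Fact bop_scale1 : left_id 1 bop_scale.
Proof. by move=> T; apply: bop_eqP => x /=; rewrite scale1r. Qed.
Fact bop_scaleDr : right_distributive bop_scale +%R.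
Proof. by move=> a S T; apply: bop_eqP => x /=; rewrite scalerDr. Qed.
Fact bop_scaleDl T : {morph bop_scale^~ T : a b / a + b}.
Proof. by move=> a b; apply: bop_eqP => x /=; rewrite scalerDl. Qed.

HB.instance Definition _ := GRing.Zmodule_isLmodule.Build R[i] (bop H)
  bop_scaleA bop_scale1 bop_scaleDr bop_scaleDl.

End BopAlgebra.

Section RealSum.
Variables (R : realType) (I : choiceType).
Implicit Types f g : I -> R.

Definition asummable f := summable [set: I] (fun i => (f i)%:E).

Definition nsum f : R := fine (\esum_(i in [set: I]) (f i)%:E).

(* Only meaningful when [asummable f]. *)
Definition rsum f : R := nsum f^\+ - nsum f^\-.

Lemma asummable_le f g :
  (forall i, `|f i| <= g i) -> asummable g -> asummable f.
Proof.
move=> fg; apply: le_lt_trans; apply: le_esum => i _ /=.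
by rewrite lee_fin (le_trans (fg i)) // ler_norm.
Qed.

Lemma asummableD f g :
  asummable f -> asummable g -> asummable (fun i => f i + g i).
Proof. exact: summableD. Qed.

Lemma esum_scale_le (c : R) f : 0 <= c -> (forall i, 0 <= f i) ->
  (\esum_(i in [set: I]) (c * f i)%:E <= c%:E * \esum_(i in [set: I]) (f i)%:E)%E.
Proof.
move=> c0 f0; apply: ge_ereal_sup => _ [X Xfin <-].
under eq_fsbigr do rewrite EFinM.
rewrite -ge0_mule_fsumr; last by move=> i; rewrite lee_fin.
apply: lee_wpmul2l; first by rewrite lee_fin.
by apply: esum_ge; exists X.
Qed.

Lemma esum_scale (c : R) f : 0 <= c -> (forall i, 0 <= f i) ->
  (\esum_(i in [set: I]) (c * f i)%:E = c%:E * \esum_(i in [set: I]) (f i)%:E)%E.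
Proof.
move=> c0 f0; apply/eqP; rewrite eq_le esum_scale_le //=.
have [c_eq0|c_neq0] := eqVneq c 0.
  by rewrite c_eq0 mul0e; apply: esum_ge0 => i _; rewrite mul0r.
have {c_neq0}{}c0 : 0 < c by rewrite lt_def c_neq0.
have cf0 i : 0 <= c * f i by rewrite mulr_ge0 // ltW.
have := @esum_scale_le c^-1 (fun i => c * f i) _ cf0.
rewrite invr_ge0 (ltW c0) => /(_ isT).
under eq_esum do rewrite mulrA mulVf ?gt_eqF // mul1r.
move=> h; apply: le_trans (lee_wpmul2l (_ : (0 <= c%:E)%E) h) _.
  by rewrite lee_fin ltW.
by rewrite muleA -EFinM divff ?gt_eqF // mul1e.
Qed.

Lemma asummableE f : (forall i, 0 <= f i) ->
  asummable f <-> (\esum_(i in [set: I]) (f i)%:E)%E \is a fin_num.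
Proof.
move=> f0; rewrite /asummable summableE.
rewrite (_ : \esum_(i in [set: I]) `|(f i)%:E|%E =
             \esum_(i in [set: I]) (f i)%:E) //.
by apply: eq_esum => i _ /=; rewrite ger0_norm.
Qed.

Lemma asummable_norm f : asummable f <-> asummable (fun i => `|f i|).
Proof.
rewrite /asummable /summable.
rewrite (_ : \esum_(x in [set: I]) `|(`|f x|)%:E|%E =
             \esum_(x in [set: I]) `|(f x)%:E|%E) //.
by apply: eq_esum => i _ /=; rewrite normr_id.
Qed.

Lemma asummableZ (c : R) f : asummable f -> asummable (fun i => c * f i).
Proof.
move=> /asummable_norm sf; apply/asummable_norm.
rewrite (_ : (fun i => _) = (fun i => `|c| * `|f i|)); last first.
  by apply/funext => i; rewrite normrM.
apply/asummableE; first by move=> i; rewrite mulr_ge0.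
rewrite esum_scale // fin_numM //.
by apply/asummableE.
Qed.

Lemma nsum_ge0 f : (forall i, 0 <= f i) -> 0 <= nsum f.
Proof. by move=> f0; apply: fine_ge0; apply: esum_ge0 => i _; rewrite lee_fin. Qed.

Lemma nsumD f g : (forall i, 0 <= f i) -> (forall i, 0 <= g i) ->
  asummable f -> asummable g ->
  nsum (fun i => f i + g i) = nsum f + nsum g.
Proof.
move=> f0 g0 /(asummableE f0) sf /(asummableE g0) sg.
by rewrite /nsum -fineD // -esumD // => i _; rewrite lee_fin.
Qed.

Lemma nsumZ (c : R) f : 0 <= c -> (forall i, 0 <= f i) -> asummable f ->
  nsum (fun i => c * f i) = c * nsum f.
Proof.
move=> c0 f0 /(asummableE f0) sf.
by rewrite /nsum esum_scale // fineM.
Qed.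

Lemma asummable_pos f : asummable f -> asummable f^\+.
Proof.
move/asummable_norm; apply: asummable_le => i.
by rewrite ger0_norm // /funrpos ge_max ler_norm normr_ge0.
Qed.

Lemma asummable_neg f : asummable f -> asummable f^\-.
Proof.
move/asummable_norm; apply: asummable_le => i.
by rewrite ger0_norm // /funrneg ge_max ler_normr lexx orbT normr_ge0.
Qed.

Lemma posnegE f i : f i = f^\+ i - f^\- i.
Proof. by rewrite -[in LHS](funrposBneg f). Qed.

Lemma rsumB f g : (forall i, 0 <= f i) -> (forall i, 0 <= g i) ->
  asummable f -> asummable g ->
  rsum (fun i => f i - g i) = nsum f - nsum g.
Proof.
move=> f0 g0 sf sg; rewrite /rsum; set h := fun i => _.
have sh : asummable h.
  rewrite /h (_ : (fun i => _) = (fun i => f i + -1 * g i)).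
    exact/asummableD/asummableZ.
  by apply/funext => i; rewrite mulN1r.
suff : nsum h^\+ + nsum g = nsum h^\- + nsum f by lra.
rewrite -!nsumD //; try by [exact: asummable_pos|exact: asummable_neg].
congr nsum; apply/funext => i.
by have := posnegE h i; rewrite {1}/h; lra.
Qed.

Lemma rsum_ge0 f : (forall i, 0 <= f i) -> asummable f -> rsum f = nsum f.
Proof.
move=> f0 sf; have z0 (i : I) : 0 <= (0 : R) by [].
have sz : asummable (fun i => 0 * f i) by apply: asummableZ.
have := rsumB f0 (fun i => mulr_ge0 (lexx 0) (f0 i)) sf sz.
rewrite nsumZ // mul0r subr0 => <-.
by congr rsum; apply/funext => i; rewrite mul0r subr0.
Qed.

Lemma rsumD f g : asummable f -> asummable g ->
  rsum (fun i => f i + g i) = rsum f + rsum g.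
Proof.
move=> sf sg.
have [sfp sfn] := (asummable_pos sf, asummable_neg sf).
have [sgp sgn] := (asummable_pos sg, asummable_neg sg).
rewrite (_ : (fun i => f i + g i) =
   fun i => (f^\+ i + g^\+ i) - (f^\- i + g^\- i)); last first.
  by apply/funext => i; rewrite {1}(posnegE f) {1}(posnegE g) opprD addrACA.
rewrite rsumB; try by [exact: asummableD|move=> i; rewrite addr_ge0].
by rewrite !nsumD // /rsum opprD addrACA.
Qed.

Lemma rsumN f : rsum (fun i => - f i) = - rsum f.
Proof.
rewrite /rsum opprB (_ : (fun i => - f i)^\+ = f^\-) //.
by rewrite (_ : (fun i => - f i)^\- = f^\+) // (funrnegN f).
Qed.

Lemma rsumZ (c : R) f : asummable f -> rsum (fun i => c * f i) = c * rsum f.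
Proof.
wlog c0 : c / 0 <= c => [hw sf|sf].
  have [/hw ->//|c0] := leP 0 c.
  rewrite (_ : (fun i => c * f i) = (fun i => - (- c * f i))); last first.
    by apply/funext => i; rewrite mulNr opprK.
  by rewrite rsumN hw ?oppr_ge0 ?(ltW c0)// mulNr opprK.
have [sfp sfn] := (asummable_pos sf, asummable_neg sf).
rewrite (_ : (fun i => c * f i) = fun i => c * f^\+ i - c * f^\- i); last first.
  by apply/funext => i; rewrite {1}(posnegE f) mulrBr.
rewrite rsumB; try by [exact: asummableZ|move=> i; rewrite mulr_ge0].
by rewrite !nsumZ // /rsum mulrBr.
Qed.

Lemma nsum_ge (s : {fset I}) f : (forall i, 0 <= f i) -> asummable f ->
  \sum_(i <- s) f i <= nsum f.
Proof.
move=> f0 /(asummableE f0) sf; rewrite -lee_fin fineK //.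
apply: esum_ge; exists [set` s]; first by split => //; exact: finite_fset.
by rewrite fsbig_finite //= set_fsetK sumEFin.
Qed.

Lemma asummable_bound f (M : R) : (forall i, 0 <= f i) ->
  (forall s : {fset I}, \sum_(i <- s) f i <= M) ->
  asummable f /\ nsum f <= M.
Proof.
move=> f0 hM.
have le : (\esum_(i in [set: I]) (f i)%:E <= M%:E)%E.
  apply: ge_ereal_sup => _ [X [finX _] <-].
  by rewrite fsbig_finite //= sumEFin lee_fin.
have fin : (\esum_(i in [set: I]) (f i)%:E)%E \is a fin_num.
  rewrite ge0_fin_numE; first exact: le_lt_trans le (ltry _).
  by apply: esum_ge0 => i _; rewrite lee_fin.
by split; [exact/(asummableE f0)|rewrite -lee_fin fineK].
Qed.

End RealSum.

Section DirectSum.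
Variables (R : realType) (I : choiceType) (E : I -> hilbertType R).

Definition sq_summable (x : forall i, E i) :=
  asummable (fun i => hnorm (x i) ^+ 2).

Record dsum := DSum { dsum_fun :> forall i, E i ; dsumP : sq_summable dsum_fun }.

Implicit Types x y z : dsum.

HB.instance Definition _ := gen_eqMixin dsum.
HB.instance Definition _ := gen_choiceMixin dsum.

Lemma dsum_eqP x y : (forall i, x i = y i) -> x = y.
Proof.
case: x y => [x hx] [y hy] /= xy.
have E0 : x = y by apply: functional_extensionality_dep.
by subst y; congr DSum; exact: Prop_irrelevance.
Qed.

Fact dsum0_subproof : sq_summable (fun i => 0 : E i).
Proof.
apply: (@asummable_bound _ _ _ 0 _ _).1 => [i|s]; first exact: sqr_ge0.
by rewrite big1 // => i _; rewrite hnorm_sqr linear0l.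
Qed.

Fact dsumD_subproof x y : sq_summable (fun i => x i + y i).
Proof.
apply: (@asummable_le _ _ _
  (fun i => 2 * (hnorm (x i) ^+ 2 + hnorm (y i) ^+ 2))).
  move=> i; rewrite ger0_norm ?sqr_ge0 // mulr_natl; exact: hnormD_sqr_le.
by apply: asummableZ; apply: asummableD; exact: dsumP.
Qed.

Fact dsumZ_subproof (c : R[i]) x : sq_summable (fun i => c *: x i).
Proof.
rewrite /sq_summable (_ : (fun i => _) =
  fun i => complex.Re (`|c| ^+ 2) * hnorm (x i) ^+ 2); last first.
  by apply/funext => i; rewrite hnormZ_sqr.
by apply: asummableZ; exact: dsumP.
Qed.

Definition dsum_zero := DSum dsum0_subproof.
Definition dsum_add x y := DSum (dsumD_subproof x y).
Definition dsum_scale c x := DSum (dsumZ_subproof c x).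

Fact dsum_addA : associative dsum_add.
Proof. by move=> x y z; apply: dsum_eqP => i /=; rewrite addrA. Qed.
Fact dsum_addC : commutative dsum_add.
Proof. by move=> x y; apply: dsum_eqP => i /=; rewrite addrC. Qed.
Fact dsum_add0 : left_id dsum_zero dsum_add.
Proof. by move=> x; apply: dsum_eqP => i /=; rewrite add0r. Qed.
Fact dsum_addN : left_inverse dsum_zero (dsum_scale (-1)) dsum_add.
Proof. by move=> x; apply: dsum_eqP => i /=; rewrite scaleN1r addNr. Qed.

HB.instance Definition _ :=
  GRing.isZmodule.Build dsum dsum_addA dsum_addC dsum_add0 dsum_addN.

Fact dsum_scaleA a b x : dsum_scale a (dsum_scale b x) = dsum_scale (a * b) x.
Proof. by apply: dsum_eqP => i /=; rewrite scalerA. Qed.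
Fact dsum_scale1 : left_id 1 dsum_scale.
Proof. by move=> x; apply: dsum_eqP => i /=; rewrite scale1r. Qed.
Fact dsum_scaleDr : right_distributive dsum_scale +%R.
Proof. by move=> a x y; apply: dsum_eqP => i /=; rewrite scalerDr. Qed.
Fact dsum_scaleDl x : {morph dsum_scale^~ x : a b / a + b}.
Proof. by move=> a b; apply: dsum_eqP => i /=; rewrite scalerDl. Qed.

HB.instance Definition _ := GRing.Zmodule_isLmodule.Build R[i] dsum
  dsum_scaleA dsum_scale1 dsum_scaleDr dsum_scaleDl.

Definition dsum_inner x y : R[i] :=
  rsum (fun i => complex.Re (inner (x i) (y i))) +i*
  rsum (fun i => complex.Im (inner (x i) (y i))).

Lemma asummable_Re x y : asummable (fun i => complex.Re (inner (x i) (y i))).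
Proof.
apply: (asummable_le (g := fun i => hnorm (x i) ^+ 2 + hnorm (y i) ^+ 2)).
  by move=> i; exact: Re_inner_le.
by apply: asummableD; exact: dsumP.
Qed.

Lemma asummable_Im x y : asummable (fun i => complex.Im (inner (x i) (y i))).
Proof.
apply: (asummable_le (g := fun i => hnorm (x i) ^+ 2 + hnorm (y i) ^+ 2)).
  by move=> i; exact: Im_inner_le.
by apply: asummableD; exact: dsumP.
Qed.

Lemma dsum_innerC x y : dsum_inner x y = (dsum_inner y x)^*.
Proof.
rewrite /dsum_inner -[RHS]/(_ -i* _) -rsumN.
by congr (_ +i* _); congr rsum; apply/funext => i; rewrite innerC; case: (inner _ _).
Qed.

Lemma dsum_innerl z (a : R[i]) x y :
  dsum_inner (a *: x + y) z = a * dsum_inner x z + dsum_inner y z.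
Proof.
case: a => a b; rewrite /dsum_inner.
have sr := asummable_Re x z; have si := asummable_Im x z.
have sr' := asummable_Re y z; have si' := asummable_Im y z.
rewrite [X in rsum X +i* _ = _](_ : _ = fun i =>
  (a * complex.Re (inner (x i) (z i)) + - b * complex.Im (inner (x i) (z i)))
  + complex.Re (inner (y i) (z i))); last first.
  apply/funext => i; rewrite innerPl.
  case: (inner (x i) (z i)) (inner (y i) (z i)) => [p q] [r s] /=; ring.
rewrite [X in _ +i* rsum X = _](_ : _ = fun i =>
  (a * complex.Im (inner (x i) (z i)) + b * complex.Re (inner (x i) (z i)))
  + complex.Im (inner (y i) (z i))); last first.
  apply/funext => i; rewrite innerPl.
  by case: (inner (x i) (z i)) (inner (y i) (z i)) => [p q] [r s] /=; ring.
have lin (c d : R) (f g h : I -> R) : asummable f -> asummable g -> asummable h ->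
    rsum (fun i => (c * f i + d * g i) + h i) = c * rsum f + d * rsum g + rsum h.
  move=> sf sg sh; rewrite (rsumD (f := fun i => c * f i + d * g i)) //.
    by rewrite (rsumD (f := fun i => c * f i)) ?(rsumZ c) ?(rsumZ d) //;
      exact: asummableZ.
  by apply: asummableD; exact: asummableZ.
rewrite !lin //.
by apply/eqP; rewrite eq_complex /=; apply/andP; split; apply/eqP; ring.
Qed.

Fact dsum_bilinear : bilinear_for
  (GRing.Scale.Law.clone _ _ *%R _)
  (GRing.Scale.Law.clone _ _ (@Num.conj R[i] \; *%R) _) dsum_inner.
Proof.
split=> [z a x y|z a x y] /=; first exact: dsum_innerl.
rewrite (dsum_innerC _ x) (dsum_innerC _ y) dsum_innerC dsum_innerl.
by rewrite rmorphD rmorphM.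
Qed.

HB.instance Definition _ := bilinear_isBilinear.Build R[i] dsum dsum R[i]
  (GRing.Scale.Law.clone _ _ *%R _)
  (GRing.Scale.Law.clone _ _ (@Num.conj R[i] \; *%R) _) dsum_inner dsum_bilinear.

Fact dsum_hermitian x y :
  dsum_inner x y = (-1) ^+ false * Num.conj (dsum_inner y x).
Proof. by rewrite expr0 mul1r; exact: dsum_innerC. Qed.

HB.instance Definition _ := isHermitianSesquilinear.Build R[i] dsum false
  (@Num.conj R[i]) dsum_inner dsum_hermitian.

Lemma dsum_inner_diag x :
  dsum_inner x x = (nsum (fun i => hnorm (x i) ^+ 2))%:C.
Proof.
rewrite /dsum_inner; congr (_ +i* _).
  rewrite -rsum_ge0; [|by move=> i; exact: sqr_ge0|exact: dsumP].
  by congr rsum; apply/funext => i; rewrite hnorm_sqr.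
rewrite (_ : (fun i => _) = fun i => 0 * hnorm (x i) ^+ 2); last first.
  by apply/funext => i; rewrite innerE mul0r.
by rewrite rsumZ ?mul0r //; exact: dsumP.
Qed.

Lemma dsum_coord_le x i : hnorm (x i) ^+ 2 <= nsum (fun i => hnorm (x i) ^+ 2).
Proof.
have := @nsum_ge _ _ [fset i]%fset _ (fun i => sqr_ge0 (hnorm (x i))) (dsumP x).
by rewrite big_seq_fset1.
Qed.

Fact dsum_pos x : x != 0 -> 0 < dsum_inner x x.
Proof.
move=> x0; rewrite dsum_inner_diag ltcR lt_def nsum_ge0 ?andbT; last first.
  by move=> i; exact: sqr_ge0.
apply: contra_neq x0 => n0; apply: dsum_eqP => i.
apply: hnorm_eq0; apply/eqP; rewrite -sqrf_eq0 eq_le sqr_ge0 andbT -n0.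
exact: dsum_coord_le.
Qed.

HB.instance Definition _ := isDotProduct.Build R[i] dsum dsum_inner dsum_pos.

Lemma dsum_norm_sqr x :
  form_norm dsum_inner x ^+ 2 = nsum (fun i => hnorm (x i) ^+ 2).
Proof.
rewrite /form_norm dsum_inner_diag sqr_sqrtr //.
by apply: nsum_ge0 => i; exact: sqr_ge0.
Qed.

Lemma dsum_coord_norm x i : hnorm (x i) <= form_norm dsum_inner x.
Proof.
rewrite -(@ler_pXn2r _ 2) ?nnegrE ?sqrtr_ge0 // dsum_norm_sqr.
exact: dsum_coord_le.
Qed.

Lemma dsum_coordB x y i : (x - y) i = x i - y i.
Proof. by rewrite -scaleN1r -[in RHS]scaleN1r. Qed.

Fact dsum_complete (u : nat -> dsum) :
  (forall e : R, 0 < e -> exists N : nat, forall m n : nat,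
     (N <= m)%N -> (N <= n)%N -> form_norm dsum_inner (u m - u n) < e) ->
  exists l : dsum, forall e : R, 0 < e -> exists N : nat, forall n : nat,
     (N <= n)%N -> form_norm dsum_inner (u n - l) < e.
Proof.
move=> cu.
have lim i : exists l : E i, forall e : R, 0 < e -> exists N : nat, forall n : nat,
    (N <= n)%N -> hnorm (u n i - l) < e.
  apply: hilbert_complete => e /cu [N hN]; exists N => m n Nm Nn.
  rewrite -dsum_coordB; apply: le_lt_trans (dsum_coord_norm _ _) _.
  exact: hN.
pose l i := projT1 (cid (lim i)).
have hl i : forall e : R, 0 < e -> exists N : nat, forall n : nat,
    (N <= n)%N -> hnorm (u n i - l i) < e := projT2 (cid (lim i)).
have limF (s : seq I) (e : R) : 0 < e -> exists N : nat, forall n : nat,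
    (N <= n)%N -> \sum_(i <- s) hnorm (u n i - l i) ^+ 2 < e.
  elim: s e => [|i s IHs] e e0; first by exists 0 => n _; rewrite big_nil.
  have e2 : 0 < e / 2 by rewrite divr_gt0.
  have [N hN] := IHs _ e2.
  have se2 : 0 < Num.sqrt (e / 2) by rewrite sqrtr_gt0.
  have [M hM] := hl i _ se2.
  exists (maxn M N) => n; rewrite geq_max => /andP[Mn Nn].
  rewrite big_cons [ltRHS](splitr e) ltrD ?hN // -(sqr_sqrtr (ltW e2)).
  by rewrite ltr_pXn2r ?nnegrE ?hnorm_ge0 ?(ltW se2) ?hM.
have key (e : R) N : 0 < e ->
    (forall m n, (N <= m)%N -> (N <= n)%N ->
       form_norm dsum_inner (u m - u n) < e) ->
    forall n, (N <= n)%N ->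
      asummable (fun i => hnorm (u n i - l i) ^+ 2) /\
      nsum (fun i => hnorm (u n i - l i) ^+ 2) <= 4 * e ^+ 2.
  move=> e0 hN n Nn; apply: asummable_bound => [i|s]; first exact: sqr_ge0.
  have [M hM] := limF s _ (exprn_gt0 2 e0).
  pose m := maxn M N.
  have h1 : \sum_(i <- s) hnorm (u m i - l i) ^+ 2 < e ^+ 2.
    by apply: hM; exact: leq_maxl.
  have h2 : \sum_(i <- s) hnorm (u n i - u m i) ^+ 2 <= e ^+ 2.
    apply: (@le_trans _ _ (form_norm dsum_inner (u n - u m) ^+ 2)).
      rewrite dsum_norm_sqr.
      rewrite (eq_bigr (fun i => hnorm ((u n - u m) i) ^+ 2)); last first.
        by move=> i _; rewrite dsum_coordB.
      by apply: nsum_ge => [i|]; [exact: sqr_ge0|exact: dsumP].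
    rewrite ler_pXn2r ?nnegrE ?sqrtr_ge0 ?(ltW e0) //.
    by apply/ltW/hN => //; exact: leq_maxr.
  apply: (@le_trans _ _ (\sum_(i <- s)
    (2 * hnorm (u n i - u m i) ^+ 2 + 2 * hnorm (u m i - l i) ^+ 2))).
    apply: ler_sum => i _.
    have -> : u n i - l i = (u n i - u m i) + (u m i - l i).
      by rewrite addrA subrK.
    by apply: le_trans (hnormD_sqr_le _ _) _; rewrite mulr2n; lra.
  by rewrite big_split /= -!mulr_sumr; lra.
have [N1 hN1] := cu _ ltr01.
have ls : sq_summable l.
  have [sl _] := key _ _ ltr01 hN1 _ (leqnn N1).
  rewrite (_ : l = fun i => dsum_add (u N1) (dsum_scale (-1) (DSum sl)) i).
    exact: dsumP.
  apply: functional_extensionality_dep => i /=.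
  by rewrite scaleN1r opprB addrC subrK.
exists (DSum ls) => e e0.
have e3 : 0 < e / 3 by rewrite divr_gt0.
have [N hN] := cu _ e3; exists N => n Nn.
have [_ le] := key _ _ e3 hN _ Nn.
rewrite -(@ltr_pXn2r _ 2) ?nnegrE ?sqrtr_ge0 ?(ltW e0) // dsum_norm_sqr.
rewrite (_ : (fun i => _) = fun i => hnorm (u n i - l i) ^+ 2); last first.
  by apply/funext => i; rewrite dsum_coordB.
by apply: le_lt_trans le _; have := exprn_gt0 2 e0; rewrite exprMn; lra.
Qed.

HB.instance Definition _ := Lmodule_isHilbert.Build R dsum dsum_complete.

End DirectSum.

Section Operators.
Variables (R : realType) (H : hilbertType R).
Implicit Types (S T : bop H) (A B I : set (bop H)).

Definition is_adjoint S T := forall x y : H, inner (S x) y = inner x (T y).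

(* Exists and is unique by the Riesz representation theorem. *)
Definition adj T : bop H := xget 0 [set S | is_adjoint T S].

Definition opnorm T : R := sup [set hnorm (T x) | x in [set x : H | hnorm x <= 1]].

Definition norm_closed A :=
  forall T, (forall e : R, 0 < e -> exists2 S, A S & opnorm (T - S) < e) -> A T.

Definition op_ge0 T := forall x : H, 0 <= inner (T x) x.

Definition cstar_subalgebra A :=
  A 0 /\
  (forall S T, A S -> A T -> A (S + T)) /\
  (forall (c : R[i]) T, A T -> A (c *: T)) /\
  (forall S T, A S -> A T -> A (S * T)) /\
  (forall T, A T -> A (adj T)) /\
  norm_closed A.

Definition cstar_generated (X : set (bop H)) : set (bop H) :=
  smallest cstar_subalgebra X.

Definition center A : set (bop H) :=
  [set z | A z /\ forall a, A a -> z * a = a * z].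

Definition closed_ideal A I :=
  I `<=` A /\ I 0 /\
  (forall S T, I S -> I T -> I (S + T)) /\
  (forall (c : R[i]) T, I T -> I (c *: T)) /\
  (forall a T, A a -> I T -> I (a * T) /\ I (T * a)) /\
  norm_closed I.

Definition ideal_coset I (a : bop H) : set (bop H) := [set b | I (b - a)].

(* Functionals and maps on a subalgebra [A] are functions on [bop H]: the values
   outside [A] are irrelevant for maps, and are fixed to be [0] for functionals,
   so that two functionals on [A] are equal iff they agree on [A]. *)

Definition functional_on A (f : bop H -> R[i]) :=
  (forall (c : R[i]) a b, A a -> A b -> f (c *: a + b) = c * f a + f b) /\
  (forall a, ~ A a -> f a = 0).

Definition restrict_to A (f : bop H -> R[i]) : bop H -> R[i] :=
  patch (fun=> 0) A f.

Definition character_space A : set (bop H -> R[i]) :=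
  [set m | functional_on A m /\
    (forall a b, A a -> A b -> m (a * b) = m a * m b) /\
    exists2 a, A a & m a != 0].

Definition state A (f : bop H -> R[i]) :=
  functional_on A f /\ (forall a, A a -> 0 <= f (adj a * a)) /\ f 1 = 1.

Definition pure_states A : set (bop H -> R[i]) :=
  [set f | state A f /\
    forall (t : R) f1 f2, state A f1 -> state A f2 -> 0 < t < 1 ->
      (forall a, f a = t%:C * f1 a + (1 - t)%:C * f2 a) ->
      f1 = f /\ f2 = f].

(* Sets of functionals carry the topology of pointwise convergence, i.e. the
   weak-* topology. *)
Definition weak_open (X W : set (bop H -> R[i])) :=
  exists2 O : set {ptws bop H -> R[i]^o}, open O & W = X `&` O.

Definition weak_closure (X W : set (bop H -> R[i])) : set (bop H -> R[i]) :=
  X `&` closure (W : set {ptws bop H -> R[i]^o}).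

End Operators.

Section Representations.
Variables (R : realType).

Definition star_hom (H K : hilbertType R) (A : set (bop H)) (f : bop H -> bop K) :=
  (forall (c : R[i]) a b, A a -> A b -> f (c *: a + b) = c *: f a + f b) /\
  (forall a b, A a -> A b -> f (a * b) = f a * f b) /\
  (forall a, A a -> f (adj a) = adj (f a)).

Definition star_iso (H K : hilbertType R) (A : set (bop H)) (B : set (bop K))
  (f : bop H -> bop K) := star_hom A f /\ set_bij A B f.

(* A faithful unital representation of the quotient of [A] by [I]; since the
   operations of the quotient are those of representatives, [phi] is a
   *-homomorphism iff its composition with the quotient map is. *)
Definition faithful_quotient_rep (H K : hilbertType R) (A I : set (bop H))
  (phi : set (bop H) -> bop K) :=
  star_hom A (fun a => phi (ideal_coset I a)) /\ phi (ideal_coset I 1) = 1 /\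
  forall a b, A a -> A b -> phi (ideal_coset I a) = phi (ideal_coset I b) ->
    ideal_coset I a = ideal_coset I b.

Variable G : groupType.

Definition unitary_rep (H : hilbertType R) (U : G -> bop H) :=
  (forall g h : G, U (g * h)%g = U g * U h) /\
  (forall g : G, adj (U g) * U g = 1 /\ U g * adj (U g) = 1).

Definition conj_action (H : hilbertType R) (U : G -> bop H) (g : G) (a : bop H)
  : bop H := U g * a * adj (U g).

Definition fin_supp (H : hilbertType R) (A : set (bop H)) : set (G -> bop H) :=
  [set f | (forall g, A (f g)) /\ finite_set [set g | f g != 0]].

Definition norm2 (H : hilbertType R) (f : G -> bop H) : R :=
  Num.sqrt (opnorm (\sum_(g \in [set: G]) f g * adj (f g))).

Definition amenable_action (H : hilbertType R) (A : set (bop H))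
  (alpha : G -> bop H -> bop H) :=
  exists x : nat -> G -> bop H,
    (forall i, fin_supp (center A) (x i)) /\
    (forall i g, op_ge0 (x i g)) /\
    (forall i, \sum_(g \in [set: G]) x i g ^+ 2 = 1) /\
    (forall s : G,
      (fun i => norm2 (fun g => alpha s (x i (s^-1 * g)%g) - x i g)) @ \oo
        --> (0 : R)).

Definition convolution (H : hilbertType R) (alpha : G -> bop H -> bop H)
  (f h : G -> bop H) : G -> bop H :=
  fun g => \sum_(s \in [set: G]) f s * alpha s (h (s^-1 * g)%g).

Definition convolution_star (H : hilbertType R) (alpha : G -> bop H -> bop H)
  (f : G -> bop H) : G -> bop H := fun g => alpha g (adj (f (g^-1)%g)).

Definition covariant_rep (H K : hilbertType R) (A : set (bop H))
  (alpha : G -> bop H -> bop H) (rho : bop H -> bop K) (W : G -> bop K) :=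
  star_hom A rho /\ rho 1 = 1 /\ unitary_rep W /\
  forall g a, A a -> rho (alpha g a) = W g * rho a * adj (W g).

Definition integrated_form (H K : hilbertType R) (rho : bop H -> bop K)
  (W : G -> bop K) (f : G -> bop H) : bop K :=
  \sum_(g \in [set: G]) rho (f g) * W g.

(* The set contains the value given by the zero space and is bounded by the sum
   of the norms of the [f g], so that [sup] is the supremum. *)
Definition universal_norm (H : hilbertType R) (A : set (bop H))
  (alpha : G -> bop H -> bop H) (f : G -> bop H) : R :=
  sup [set r | exists (K : hilbertType R) (rho : bop H -> bop K) (W : G -> bop K),
    covariant_rep A alpha rho W /\ r = opnorm (integrated_form rho W f)].

(* [C] with the canonical map [iota] is the completion, for the universal norm,
   of the convolution *-algebra of finitely supported functions from [G] to the
   unital algebra [A]; this determines [C] up to a unique isomorphism compatible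
   with [iota]. As every C*-algebra, the completion can be realized as a norm
   closed *-subalgebra of the bounded operators of some Hilbert space [L]. *)
Definition full_crossed_product (H : hilbertType R) (A : set (bop H))
  (alpha : G -> bop H -> bop H) (L : hilbertType R) (C : set (bop L))
  (iota : (G -> bop H) -> bop L) :=
  cstar_subalgebra C /\
  (forall f, fin_supp A f -> C (iota f)) /\
  (forall (c : R[i]) f h, fin_supp A f -> fin_supp A h ->
    iota (fun g => c *: f g + h g) = c *: iota f + iota h) /\
  (forall f h, fin_supp A f -> fin_supp A h ->
    iota (convolution alpha f h) = iota f * iota h) /\
  (forall f, fin_supp A f -> iota (convolution_star alpha f) = adj (iota f)) /\
  (forall f, fin_supp A f -> opnorm (iota f) = universal_norm A alpha f) /\
  (forall T, C T -> forall e : R, 0 < e ->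
    exists2 f, fin_supp A f & opnorm (T - iota f) < e).

End Representations.

(* The operators below are bounded because *-homomorphisms of C*-algebras are
   contractive, so that the [xget] is not the default value for them. *)
Definition family_op (R : realType) (I : choiceType) (E : I -> hilbertType R)
  (F : (forall i, E i) -> forall i, E i) : bop (dsum E) :=
  xget 0 [set T : bop (dsum E) | forall (x : dsum E) i, T x i = F x i].

Definition dsum_op (R : realType) (I : choiceType) (E : I -> hilbertType R)
  (T : forall i, bop (E i)) : bop (dsum E) :=
  family_op (fun x i => T i (x i)).

Definition ell2 (R : realType) (G : choiceType) (K : hilbertType R) :
  hilbertType R := dsum (fun _ : G => K).

Section LocalTrajectories.
Variables (R : realType) (H : hilbertType R) (A Z : set (bop H)).
Variables (G : groupType) (U : G -> bop H).

Definition beta_map (g : G) (m : bop H -> R[i]) : bop H -> R[i] :=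
  fun z => m (conj_action U g z).

Definition beta_orbit (m : bop H -> R[i]) : set (bop H -> R[i]) :=
  [set beta_map g m | g in [set: G]].

Definition beta_orbits : set (set (bop H -> R[i])) :=
  [set beta_orbit m | m in character_space Z].

(* [Z] is identified with the continuous functions on its character space by
   the Gelfand transform [z |-> (m |-> m z)], which is isometric: [opnorm z] is
   the sup norm of the transform. *)
Definition bump_in (V : set (bop H -> R[i])) : set (bop H) :=
  [set z | Z z /\
    (forall m, character_space Z m -> 0 <= m z <= 1) /\
    opnorm z = 1 /\
    weak_closure (character_space Z)
      [set m | character_space Z m /\ m z != 0] `<=` V].

Definition localizable :=
  forall W, weak_open (pure_states A) W ->
    weak_open (character_space Z) [set restrict_to Z mu | mu in W].

(* The point [m] of the spectrum of [Z] stands for the maximal ideal [ker m]. *)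
Definition ideal_at (m : bop H -> R[i]) : set (bop H) :=
  smallest (closed_ideal A) [set z | Z z /\ m z = 0].

Section Orbit.
Variables (K : hilbertType R) (pi' : bop H -> bop K).

Definition traj_alg (a : bop H) : bop (ell2 G K) :=
  family_op (E := fun _ : G => K)
    (fun xi t => pi' (conj_action U (t^-1)%g a) (xi t)).

Definition traj_shift (g : G) : bop (ell2 G K) :=
  family_op (E := fun _ : G => K) (fun xi t => xi (g^-1 * t)%g).

Definition traj_sum (c : G -> bop H) : bop (ell2 G K) :=
  \sum_(g \in [set: G]) traj_alg (c g) * traj_shift g.

Definition B0_sum (c : G -> bop H) : bop H :=
  \sum_(g \in [set: G]) c g * U g.

Definition traj_well_defined :=
  forall c d, fin_supp A c -> fin_supp A d -> B0_sum c = B0_sum d ->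
    traj_sum c = traj_sum d.

Definition traj_rep (b : bop H) : bop (ell2 G K) :=
  xget 0 [set T | exists2 c, fin_supp A c & b = B0_sum c /\ T = traj_sum c].

End Orbit.

Section Total.
Variables (m_ : beta_orbits -> bop H -> R[i]) (K : beta_orbits -> hilbertType R).
Variables (phi : forall w : beta_orbits, set (bop H) -> bop (K w)).

Definition pi_prime (w : beta_orbits) : bop H -> bop (K w) :=
  fun a => phi w (ideal_coset (ideal_at (m_ w)) a).

Definition local_traj_space : hilbertType R :=
  dsum (fun w : beta_orbits => ell2 G (K w)).

Definition local_traj_rep (b : bop H) : bop local_traj_space :=
  dsum_op (fun w => traj_rep (pi_prime w) b).

End Total.
End LocalTrajectories.

(* Main.v *)
Require Import Defs.
From HB Require Import structures.
From mathcomp Require Import all_boot all_order all_algebra finmap.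
From mathcomp Require Import all_classical reals topology normedtype complex.
From mathcomp Require Import numfun esum ereal ring lra.
Set Implicit Arguments.
Unset Strict Implicit.
Unset Printing Implicit Defensive.
Import Order.TTheory GRing.Theory Num.Theory.
Import numFieldNormedType.Exports.
Import Defs.
Local Open Scope classical_set_scope.
Local Open Scope ring_scope.
Local Open Scope complex_scope.

(** Along an orbit [w] the representation is a regular one: on the coordinate
    [t] of [ell2 G (K w)] an element [a] of [A] acts by [pi' (alpha_t^-1 a)] and
    [U s] translates coordinates.  So the image of the sum of the [c s * U s] is
    an operator matrix whose entry at the place [(t, s^-1 t)] is
    [pi' (alpha_t^-1 (c s))].

    The coefficient [a_e] is the diagonal of that matrix, and the elements of [Z]
    are diagonal.  Compressing to single coordinates removes every other
    coefficient and does not increase the norm; this is the first inequality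
    ([total_rep_diagonal]).  The second one is the first for some bump [z_V].
    Such bumps exist ([bump_exists]): a neighbourhood of a character contains one
    of the form [m y < e^2], for a positive [y] of [Z], and the positive part of
    [e^2 / 2 - y], which only needs a square root, is supported in it.

    For the isomorphism, let [(rho, W)] be a covariant representation of the image
    of [A].  Composed with [pi] it is one of [A], whose kernel contains that of
    [pi].  Coefficients [c s] in [A] have to satisfy
    [|sum_s rho (c s) W_s| <= |sum_s pi (c s) pi (U_s)|]
    ([amenable_covariant_norm]).  Let [x] be one of the functions given by
    amenability and [F] its support.  For a vector [xi], the vectors
    [eta_q = W_q^* rho (x q) xi], with [q] in [F], form a vector [eta] of the same
    norm as [xi].  Let [N] be the matrix with
    entries [alpha_s^-1 (c (s q^-1))], for [s] and [q] in [F].  The operators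
    [rho (x s) W_s] form a contractive row, which maps [rho(N) eta] to
    [sum_s rho (c s) rho (R_s) W_s xi], where
    [R_s = sum_t x t * alpha_s (x (s^-1 t))].  Amenability says that the [R_s]
    tend to [1] ([overlap_norm]).  It remains to bound the norm of [rho(N)] by that
    of [sum_s pi (c s) pi (U_s)].  It is at most the norm of [pi(N)], as star
    homomorphisms of matrix algebras are contractive ([matrix_contractive_ker]),
    and [pi(N)] is a direct sum of compressions of [sum_s pi (c s) pi (U_s)] to
    finite sets of coordinates ([total_rep_matrix]).

    Hence the universal norm is the norm of the integrated form
    ([universal_normE]), and the isomorphism is the isometric extension of the
    integrated form to the completions ([isometric_extension]).

    Square roots ([cstar_sqrt]) replace the continuous functional calculus
    throughout: they give the contractivity of star homomorphisms as well as the
    bumps. *)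

(** * Geometry of Hilbert spaces *)

Section HilbertGeometry.
Variables (R : realType) (H : hilbertType R).
Implicit Types x y z : H.

(** Real-valued, unlike the norm of [R[i]]. *)
Definition cmod (c : R[i]) : R := complex.Re `|c|.

Lemma innerDl x y z : inner (x + y) z = inner x z + inner y z.
Proof. by rewrite linearDl. Qed.
Lemma innerDr x y z : inner z (x + y) = inner z x + inner z y.
Proof. by rewrite linearDr. Qed.
Lemma innerZl (c : R[i]) x y : inner (c *: x) y = c * inner x y.
Proof. by rewrite linearZl_LR. Qed.
Lemma innerZr (c : R[i]) x y : inner x (c *: y) = Num.conj c * inner x y.
Proof. by rewrite linearZr_LR. Qed.
Lemma innerNl x y : inner (- x) y = - inner x y.
Proof. by rewrite linearNl. Qed.
Lemma innerNr x y : inner x (- y) = - inner x y.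
Proof. by rewrite raddfN. Qed.
Lemma innerBl x y z : inner (x - y) z = inner x z - inner y z.
Proof. by rewrite innerDl innerNl. Qed.
Lemma innerBr x y z : inner z (x - y) = inner z x - inner z y.
Proof. by rewrite innerDr innerNr. Qed.
Lemma inner0l x : inner (0 : H) x = 0. Proof. by rewrite linear0l. Qed.
Lemma inner0r x : inner x (0 : H) = 0. Proof. by rewrite raddf0. Qed.

Lemma Re_innerC x y : complex.Re (inner x y) = complex.Re (inner y x).
Proof. by rewrite innerC; case: (inner y x). Qed.

Lemma ReD (a b : R[i]) : complex.Re (a + b) = complex.Re a + complex.Re b.
Proof. by case: a b => ? ? [? ?]. Qed.
Lemma ReN (a : R[i]) : complex.Re (- a) = - complex.Re a.
Proof. by case: a => ? ?. Qed.
Lemma ReB (a b : R[i]) : complex.Re (a - b) = complex.Re a - complex.Re b.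
Proof. by rewrite ReD ReN. Qed.
Lemma ReZ (a : R) (b : R[i]) : complex.Re (a%:C * b) = a * complex.Re b.
Proof. by case: b => ? ? /=; rewrite mul0r subr0. Qed.

Lemma conj_realC (a : R) : Num.conj (a%:C : R[i]) = a%:C.
Proof. by apply/eqP; rewrite eq_complex /= oppr0 !eqxx. Qed.

Lemma cmodE (c : R[i]) : cmod c ^+ 2 = complex.Re (`|c| ^+ 2).
Proof. by rewrite /cmod; case: c => a b; rewrite normc_def /= mulr0 subr0. Qed.
Lemma cmod_ge0 (c : R[i]) : 0 <= cmod c.
Proof. by rewrite /cmod; case: c => a b; rewrite normc_def /= sqrtr_ge0. Qed.
Lemma cmodr (a : R) : cmod a%:C = `|a|.
Proof. by rewrite /cmod normc_def /= expr0n addr0 sqrtr_sqr. Qed.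
Lemma normc_cmod (c : R[i]) : `|c| = (cmod c)%:C.
Proof. by rewrite /cmod normc_def. Qed.
Lemma cmod_sqr (c : R[i]) : cmod c ^+ 2 = complex.Re c ^+ 2 + complex.Im c ^+ 2.
Proof. by rewrite cmodE; case: c => a b; rewrite sqr_normc /=; ring. Qed.

Lemma hnorm_zero : hnorm (0 : H) = 0.
Proof. by rewrite /hnorm /form_norm inner0l sqrtr0. Qed.

Lemma hnorm_scale (c : R[i]) x : hnorm (c *: x) = cmod c * hnorm x.
Proof.
apply/eqP; rewrite -(@eqrXn2 _ 2) ?hnorm_ge0 ?mulr_ge0 ?cmod_ge0 ?hnorm_ge0 //.
by rewrite exprMn hnormZ_sqr cmodE.
Qed.

Lemma hnorm_opp x : hnorm (- x) = hnorm x.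
Proof.
by apply/eqP; rewrite -(@eqrXn2 _ 2) ?hnorm_ge0 ?hnormN_sqr.
Qed.

Lemma hnormBC x y : hnorm (x - y) = hnorm (y - x).
Proof. by rewrite -hnorm_opp opprB. Qed.

Lemma Re_inner_CS x y : complex.Re (inner x y) <= hnorm x * hnorm y.
Proof.
have [/hnorm_eq0 ->|x0] := eqVneq (hnorm x) 0.
  by rewrite inner0l hnorm_zero mul0r.
have {}x0 : 0 < hnorm x by rewrite lt_def x0 hnorm_ge0.
have := sqr_ge0 (hnorm (((hnorm y)%:C *: x) - (hnorm x)%:C *: y)).
rewrite hnormD_sqr hnormN_sqr !hnorm_scale !cmodr innerNr innerZl innerZr.
rewrite conj_realC ReN !ReZ !ger0_norm ?hnorm_ge0 //.
have [/hnorm_eq0 -> _|y0] := eqVneq (hnorm y) 0.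
  by rewrite inner0r hnorm_zero mulr0.
have {}y0 : 0 < hnorm y by rewrite lt_def y0 hnorm_ge0.
move=> h; rewrite -(ler_pM2l (mulr_gt0 x0 y0)); nra.
Qed.

Lemma hnorm_leD x y : hnorm (x + y) <= hnorm x + hnorm y.
Proof.
rewrite -(@ler_pXn2r _ 2) ?nnegrE ?addr_ge0 ?hnorm_ge0 //.
rewrite hnormD_sqr sqrrD; have := Re_inner_CS x y; lra.
Qed.

Lemma hnorm_triangle z x y : hnorm (x - y) <= hnorm (x - z) + hnorm (z - y).
Proof. by apply: le_trans _ (hnorm_leD _ _); rewrite addrA subrK. Qed.

Lemma hnorm_le x y : hnorm x <= hnorm y + hnorm (x - y).
Proof. by apply: le_trans _ (hnorm_leD _ _); rewrite addrC subrK. Qed.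

Lemma hnorm_sum (I : Type) (s : seq I) (P : pred I) (F : I -> H) :
  hnorm (\sum_(i <- s | P i) F i) <= \sum_(i <- s | P i) hnorm (F i).
Proof.
elim/big_rec2: _ => [|i y x _ h]; first by rewrite hnorm_zero.
by apply: le_trans (hnorm_leD _ _) _; rewrite lerD2l.
Qed.

Lemma inner_suml (I : Type) (s : seq I) (P : pred I) (F : I -> H) y :
  inner (\sum_(i <- s | P i) F i) y = \sum_(i <- s | P i) inner (F i) y.
Proof.
elim/big_rec2: _ => [|i a b _ <-]; first by rewrite inner0l.
by rewrite innerDl.
Qed.

Lemma parallelogram x y :
  hnorm (x + y) ^+ 2 + hnorm (x - y) ^+ 2 = (hnorm x ^+ 2 + hnorm y ^+ 2) *+ 2.
Proof. by rewrite !hnormD_sqr hnormN_sqr innerNr ReN; ring. Qed.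

End HilbertGeometry.

(** * The Riesz representation theorem *)

Section Cauchy.
Variables (R : realType) (H : hilbertType R).
Implicit Types x y z : H.

Lemma exists_inv_succ_lt (e : R) : 0 < e ->
  exists N : nat, forall n, (N <= n)%N -> n.+1%:R^-1 < e.
Proof.
move=> e0; exists (Num.truncn e^-1) => n Nn.
have h : e^-1 < n.+1%:R.
  apply: lt_le_trans (truncnS_gt _) _; rewrite ler_nat ltnS //.
by rewrite -[e]invrK ltf_pV2 // posrE ?invr_gt0 // ltr0Sn.
Qed.

(** By the parallelogram identity a sequence minimising [|x|^2 / 2 - g x] is Cauchy;
    that the first variation vanishes at its limit says that the limit represents
    [g]. *)
Lemma riesz_real (g : H -> R) (M : R) :
  (forall x y, g (x + y) = g x + g y) ->
  (forall (t : R) x, g (t%:C *: x) = t * g x) ->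
  (forall x, g x <= M * hnorm x) ->
  exists y, forall x, g x = complex.Re (inner x y).
Proof.
move=> gD gZ gM.
pose P x := hnorm x ^+ 2 / 2 - g x.
pose D := [set P x | x in [set: H]].
have lbD : lbound D (- (M ^+ 2)).
  move=> _ [x _ <-]; have := gM x; have := hnorm_ge0 x.
  have := sqr_ge0 (hnorm x - M); have := sqr_ge0 M; rewrite /P sqrrB; nra.
have D0 : D !=set0 by exists (P 0), 0.
have infD : has_inf D by split=> //; exists (- (M ^+ 2)).
pose d := inf D.
have dP x : d <= P x by apply: ge_inf; [exists (- (M ^+ 2))|exists x].
have ex n : exists x, P x < d + n.+1%:R^-1.
  have n0 : 0 < n.+1%:R^-1 :> R by rewrite invr_gt0 ltr0Sn.
  have [_ [x _ <-] h] := inf_adherent n0 infD.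
  by exists x.
have [u hu] := choice ex.
have cauchy : forall e : R, 0 < e -> exists N : nat, forall m n : nat,
    (N <= m)%N -> (N <= n)%N -> hnorm (u m - u n) < e.
  move=> e e0; have e8 : 0 < e ^+ 2 / 8 by rewrite divr_gt0 // exprn_gt0.
  have [N hN] := exists_inv_succ_lt e8; exists N => m n Nm Nn.
  rewrite -(@ltr_pXn2r _ 2) ?nnegrE ?hnorm_ge0 ?(ltW e0) //.
  have := dP ((2^-1)%:C *: (u m + u n)); rewrite /P hnorm_scale cmodr gZ gD.
  rewrite ger0_norm ?invr_ge0 // exprMn.
  have := hu m; have := hu n; have := hN m Nm; have := hN n Nn.
  have := parallelogram (u m) (u n); rewrite /P.
  move: (hnorm (u m + u n)) (hnorm (u m - u n)) (hnorm (u m)) (hnorm (u n)) => a b c a'.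
  move: (g (u m)) (g (u n)) (m.+1%:R^-1) (n.+1%:R^-1) => p q r s.
  rewrite [2^-1 ^+ 2]expr2; lra.
have [y hy] := hilbert_complete u cauchy.
exists y.
have var z : 0 <= hnorm z ^+ 2 / 2 + complex.Re (inner z y) - g z.
  rewrite leNgt; apply/negP => neg.
  set k := hnorm z ^+ 2 / 2 + complex.Re (inner z y) - g z in neg *.
  have [z0|z0] := eqVneq (hnorm z) 0.
    have gz : g z = 0 by rewrite (hnorm_eq0 z0) -[0 : H](scale0r 0) (gZ 0) mul0r.
    move: neg; rewrite /k z0 gz (hnorm_eq0 z0) inner0l expr0n /= mul0r.
    by rewrite !addr0 oppr0 !addr0 ltxx.
  have {}z0 : 0 < hnorm z by rewrite lt_def z0 hnorm_ge0.
  have k2 : 0 < - k / 2 by rewrite divr_gt0 // oppr_gt0.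
  have [N1 h1] := exists_inv_succ_lt k2.
  have [N2 h2] := hy (- k / 2 / hnorm z) (divr_gt0 k2 z0).
  pose n := maxn N1 N2.
  have {}h1 := h1 n (leq_maxl _ _); have {}h2 := h2 n (leq_maxr _ _).
  have h3 := dP (u n + z); have h4 := hu n.
  have h5 := Re_inner_CS z (u n - y); rewrite innerBr ReB in h5.
  have h6 : hnorm z * hnorm (u n - y) < - k / 2.
    by rewrite mulrC -ltr_pdivlMr.
  move: h3 h4; rewrite /P hnormD_sqr gD Re_innerC => h3 h4.
  move: h3 h4 h5 h6 h1 k2; rewrite /k mulr2n.
  move: (hnorm z * _) (hnorm z ^+ 2) (hnorm (u n) ^+ 2) (n.+1%:R^-1) => p q r s.
  move: (g z) (g (u n)) (complex.Re _) (complex.Re _) => a b c' e'.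
  lra.
move=> x; apply/eqP; rewrite eq_le; apply/andP; split.
  rewrite -subr_ge0 leNgt; apply/negP.
  set k := complex.Re _ - _ => k0.
  have X0 : 0 <= hnorm x ^+ 2 by rewrite sqr_ge0.
  pose t := - k / (hnorm x ^+ 2 + 1).
  have t0 : 0 < t by rewrite divr_gt0 ?oppr_gt0 // ltr_pwDr.
  have tE : t * (hnorm x ^+ 2 + 1) = - k by rewrite /t divfK // gt_eqF // ltr_pwDr.
  have := var (t%:C *: x); rewrite hnorm_scale cmodr gZ innerZl ReZ exprMn gtr0_norm //.
  rewrite -addrA -mulrBr -/k.
  have : t * (t * (hnorm x ^+ 2 + 1)) = t * - k by rewrite tE.
  move: k0 t0 X0; generalize (hnorm x ^+ 2) => X; nra.
rewrite -subr_ge0 leNgt; apply/negP.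
set k := _ - complex.Re _ => k0.
have X0 : 0 <= hnorm x ^+ 2 by rewrite sqr_ge0.
pose t := k / (hnorm x ^+ 2 + 1).
have t0 : t < 0 by rewrite pmulr_llt0 // invr_gt0 ltr_pwDr.
have tE : t * (hnorm x ^+ 2 + 1) = k by rewrite /t divfK // gt_eqF // ltr_pwDr.
have := var (t%:C *: x); rewrite hnorm_scale cmodr gZ innerZl ReZ exprMn ltr0_norm //.
rewrite -addrA -mulrBr -opprB -/k.
have : t * (t * (hnorm x ^+ 2 + 1)) = t * k by rewrite tE.
move: k0 t0 X0; generalize (hnorm x ^+ 2) => X; nra.
Qed.

Lemma inner_Re_inj x y :
  (forall z, complex.Re (inner z x) = complex.Re (inner z y)) -> x = y.
Proof.
move=> h; apply/eqP; rewrite -subr_eq0; apply/eqP; apply: hnorm_eq0.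
by rewrite /hnorm /form_norm innerBr ReB h subrr sqrtr0.
Qed.

Lemma Im_inner x y : complex.Im (inner x y) = complex.Re (inner ((- 'i : R[i]) *: x) y).
Proof. by rewrite innerZl; case: (inner x y) => a b /=; ring. Qed.

End Cauchy.

(** * Bounded operators: norm, completeness, adjoints *)

Section BopNorm.
Variables (R : realType) (H : hilbertType R).
Implicit Types (x y z : H) (S T : bop H).

Fact bop_linear T : linear (T : H -> H).
Proof. by move=> c x y; exact: (bopP T).1. Qed.

HB.instance Definition _ T :=
  GRing.isLinear.Build R[i] H H _ (bop_fun T) (bop_linear T).

Lemma bopDE S T x : (S + T) x = S x + T x. Proof. by []. Qed.
Lemma bopME S T x : (S * T) x = S (T x). Proof. by []. Qed.
Lemma bop1E x : (1 : bop H) x = x. Proof. by []. Qed.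
Lemma bop0E x : (0 : bop H) x = 0. Proof. by []. Qed.
Lemma bopZE (c : R[i]) T x : (c *: T) x = c *: T x. Proof. by []. Qed.
Lemma bopNE T x : (- T) x = - T x. Proof. by rewrite -[RHS]scaleN1r. Qed.
Lemma bopBE S T x : (S - T) x = S x - T x. Proof. by rewrite bopDE bopNE. Qed.
Lemma bop_sumE (I : Type) (s : seq I) (P : pred I) (F : I -> bop H) x :
  (\sum_(i <- s | P i) F i) x = \sum_(i <- s | P i) F i x.
Proof. by elim/big_rec2: _ => [|i a b _ <-]. Qed.

Lemma bop_appD T x y : T (x + y) = T x + T y. Proof. exact: linearD. Qed.
Lemma bop_appZ T (c : R[i]) x : T (c *: x) = c *: T x.
Proof. by rewrite linearZ. Qed.
Lemma bop_app0 T : T 0 = 0. Proof. exact: linear0. Qed.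
Lemma bop_app_sum T (I : Type) (s : seq I) (P : pred I) (F : I -> H) :
  T (\sum_(i <- s | P i) F i) = \sum_(i <- s | P i) T (F i).
Proof. exact: linear_sum. Qed.

Lemma bopZl (c : R[i]) S T : (c *: S) * T = c *: (S * T).
Proof. exact: bop_eqP. Qed.
Lemma bopZr (c : R[i]) S T : S * (c *: T) = c *: (S * T).
Proof. by apply: bop_eqP => x; rewrite bopME bopZE linearZ. Qed.

Lemma opnorm_has_sup T :
  has_sup [set hnorm (T x) | x in [set x : H | hnorm x <= 1]].
Proof.
split; first by exists (hnorm (T 0)), 0 => //=; rewrite hnorm_zero ler01.
have [M M0 hM] := bop_bound T; exists M => _ [x /= x1 <-].
by apply: le_trans (hM x) _; rewrite ler_piMr.
Qed.

Lemma opnorm_ge0 T : 0 <= opnorm T.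
Proof.
apply: ub_le_sup; first exact: (opnorm_has_sup T).2.
by exists 0 => /=; rewrite ?linear0 hnorm_zero ?ler01.
Qed.

Lemma opnormP T x : hnorm (T x) <= opnorm T * hnorm x.
Proof.
have [x0|x0] := eqVneq (hnorm x) 0.
  by rewrite (hnorm_eq0 x0) linear0 hnorm_zero mulr0.
have {}x0 : 0 < hnorm x by rewrite lt_def x0 hnorm_ge0.
rewrite -ler_pdivrMr //.
apply: ub_le_sup; first exact: (opnorm_has_sup T).2.
exists (((hnorm x)^-1)%:C *: x) => /=.
  by rewrite hnorm_scale cmodr ger0_norm ?invr_ge0 ?hnorm_ge0 // mulVf // gt_eqF.
by rewrite linearZ /= hnorm_scale cmodr ger0_norm ?invr_ge0 ?hnorm_ge0 // mulrC.
Qed.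

Lemma opnorm_le T (M : R) : 0 <= M -> (forall x, hnorm (T x) <= M * hnorm x) ->
  opnorm T <= M.
Proof.
move=> M0 h; apply: ge_sup; first exact: (opnorm_has_sup T).1.
by move=> _ [x /= x1 <-]; apply: le_trans (h x) _; rewrite ler_piMr.
Qed.

Lemma opnorm_bound T (M : R) x : opnorm T <= M -> hnorm (T x) <= M * hnorm x.
Proof.
by move=> h; apply: le_trans (opnormP T x) _; rewrite ler_wpM2r ?hnorm_ge0.
Qed.

Lemma opnorm0 : opnorm (0 : bop H) = 0.
Proof.
apply/eqP; rewrite eq_le opnorm_ge0 andbT; apply: opnorm_le => // x.
by rewrite bop0E hnorm_zero mul0r.
Qed.

Lemma opnorm1 : opnorm (1 : bop H) <= 1.
Proof. by apply: opnorm_le => // x; rewrite mul1r. Qed.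

Lemma opnorm_eq0 T : opnorm T = 0 -> T = 0.
Proof.
move=> T0; apply: bop_eqP => x; apply: hnorm_eq0; apply/eqP.
by rewrite eq_le hnorm_ge0 andbT (le_trans (opnormP T x)) // T0 mul0r.
Qed.

Lemma opnormD S T : opnorm (S + T) <= opnorm S + opnorm T.
Proof.
apply: opnorm_le => [|x]; first by rewrite addr_ge0 ?opnorm_ge0.
by rewrite bopDE mulrDl; apply: le_trans (hnorm_leD _ _) _; rewrite lerD ?opnormP.
Qed.

Lemma opnormZ (c : R[i]) T : opnorm (c *: T) <= cmod c * opnorm T.
Proof.
apply: opnorm_le => [|x]; first by rewrite mulr_ge0 ?opnorm_ge0 ?cmod_ge0.
by rewrite hnorm_scale -mulrA ler_wpM2l ?cmod_ge0 ?opnormP.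
Qed.

Lemma opnormZ_pos (t : R) T : 0 < t -> opnorm (t%:C *: T) = t * opnorm T.
Proof.
move=> t0; apply/eqP; rewrite eq_le; apply/andP; split.
  by apply: le_trans (opnormZ _ _) _; rewrite cmodr gtr0_norm.
rewrite -ler_pdivlMl //.
have {1}-> : T = (t^-1)%:C *: (t%:C *: T).
  rewrite scalerA (_ : _ * _ = 1) ?scale1r //.
  by apply/eqP; rewrite eq_complex /= !mulr0 mul0r subr0 addr0 mulVf ?eqxx ?gt_eqF.
by apply: le_trans (opnormZ _ _) _; rewrite cmodr gtr0_norm // invr_gt0.
Qed.

Lemma opnormN T : opnorm (- T) = opnorm T.
Proof. 
have h S : opnorm (- S) <= opnorm S.
  apply: opnorm_le => [|x]; rewrite ?opnorm_ge0 // bopNE hnorm_opp; exact: opnormP.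
by apply/eqP; rewrite eq_le h -{1}[T]opprK h.
Qed.

Lemma opnormBC S T : opnorm (S - T) = opnorm (T - S).
Proof. by rewrite -opnormN opprB. Qed.

Lemma opnormM S T : opnorm (S * T) <= opnorm S * opnorm T.
Proof.
apply: opnorm_le => [|x]; first by rewrite mulr_ge0 ?opnorm_ge0.
rewrite bopME; apply: le_trans (opnormP _ _) _.
by rewrite -mulrA ler_wpM2l ?opnorm_ge0 ?opnormP.
Qed.

Lemma opnorm_triangle V S T : opnorm (S - T) <= opnorm (S - V) + opnorm (V - T).
Proof. by have := opnormD (S - V) (V - T); rewrite addrA subrK. Qed.

Lemma opnorm_le_add S T : opnorm S <= opnorm T + opnorm (S - T).
Proof. by have := opnormD T (S - T); rewrite addrC subrK. Qed.

Lemma opnorm_sum (I : Type) (s : seq I) (P : pred I) (F : I -> bop H) :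
  opnorm (\sum_(i <- s | P i) F i) <= \sum_(i <- s | P i) opnorm (F i).
Proof.
elim/big_rec2: _ => [|i y x _ h]; first by rewrite opnorm0.
by apply: le_trans (opnormD _ _) _; rewrite lerD2l.
Qed.

Lemma opnorm_small T : (forall e : R, 0 < e -> opnorm T <= e) -> T = 0.
Proof.
move=> h; apply: opnorm_eq0; apply/eqP; rewrite eq_le opnorm_ge0 andbT.
by apply/ler_addgt0Pl => e e0; rewrite addr0 h.
Qed.

(** The limit is taken pointwise; the Cauchy estimates are uniform on the unit ball
    and pass to it. *)
Lemma bop_complete (u : nat -> bop H) :
  (forall e : R, 0 < e -> exists N : nat, forall m n : nat,
     (N <= m)%N -> (N <= n)%N -> opnorm (u m - u n) < e) ->
  exists T : bop H, forall e : R, 0 < e -> exists N : nat, forall n : nat,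
     (N <= n)%N -> opnorm (u n - T) < e.
Proof.
move=> cu.
have lim x : exists l : H, forall e : R, 0 < e -> exists N : nat, forall n : nat,
    (N <= n)%N -> hnorm (u n x - l) < e.
  apply: hilbert_complete => e e0.
  have x1 : 0 < hnorm x + 1 by rewrite ltr_wpDl ?hnorm_ge0.
  have [N hN] := cu _ (divr_gt0 e0 x1); exists N => m n Nm Nn.
  have := ltW (hN _ _ Nm Nn); rewrite -[form_norm _ _]/(hnorm _) -bopBE.
  move=> /opnorm_bound-/(_ x)/le_lt_trans; apply.
  rewrite mulrAC ltr_pdivrMr // ltr_pM2l // ltrDl //.
have [T hT] := choice lim.
have T_lin (c : R[i]) x y : T (c *: x + y) = c *: T x + T y.
  apply/eqP; rewrite -subr_eq0; apply/eqP; apply: hnorm_eq0; apply/eqP.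
  rewrite eq_le hnorm_ge0 andbT; apply/ler_addgt0Pl => e e0; rewrite addr0.
  have c1 : 0 < cmod c + 2 by rewrite ltr_wpDl ?cmod_ge0.
  have e3 := divr_gt0 e0 c1.
  have [N1 h1] := hT (c *: x + y) _ e3.
  have [N2 h2] := hT x _ e3.
  have [N3 h3] := hT y _ e3.
  pose n := maxn N1 (maxn N2 N3).
  have {}h1 := h1 n (leq_maxl _ _).
  have {}h2 := h2 n (leq_trans (leq_maxl _ _) (leq_maxr _ _)).
  have {}h3 := h3 n (leq_trans (leq_maxr _ _) (leq_maxr _ _)).
  apply: le_trans (hnorm_triangle (u n (c *: x + y)) _ _) _.
  rewrite hnormBC; apply: le_trans (lerD (ltW h1) (lexx _)) _.
  rewrite (bopP (u n)).1 opprD addrACA -scalerBr.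
  apply: le_trans (lerD (lexx _) (hnorm_leD _ _)) _.
  rewrite hnorm_scale -[leRHS](@divfK _ (cmod c + 2)) ?gt_eqF //.
  have h2' : cmod c * hnorm (u n x - T x) <= cmod c * (e / (cmod c + 2)).
    by apply: ler_wpM2l; [exact: cmod_ge0 | exact: ltW].
  have h3' : hnorm (u n y - T y) <= e / (cmod c + 2) by exact: ltW.
  by rewrite mulrDr [leRHS]addrC; move: h2' h3'; lra.
have [N hN] := cu 1 ltr01.
have T_bd x : hnorm (T x) <= (opnorm (u N) + 2) * hnorm x.
  have [x0|x0] := eqVneq (hnorm x) 0.
    rewrite (hnorm_eq0 x0) (_ : T 0 = 0) ?hnorm_zero ?mulr0 //.
    by have := T_lin (-1) 0 0; rewrite scaler0 addr0 scaleN1r addNr.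
  have {}x0 : 0 < hnorm x by rewrite lt_def x0 hnorm_ge0.
  have [M hM] := hT x _ x0.
  have {}hM := hM _ (leq_maxl M N).
  have {}hN := ltW (hN N _ (leqnn N) (leq_maxr M N)).
  have h := opnorm_bound x hN; rewrite bopBE in h.
  apply: le_trans (hnorm_le _ (u (maxn M N) x)) _.
  have h' := hnorm_le (u (maxn M N) x) (u N x).
  have := opnormP (u N) x; rewrite hnormBC in hM; rewrite hnormBC in h; lra.
pose T' := BOp (conj T_lin (ex_intro _ _ T_bd)).
exists T' => e e0; have e2 : 0 < e / 2 by rewrite divr_gt0.
have [N' hN'] := cu _ e2; exists N' => n Nn.
apply: le_lt_trans (_ : e / 2 < e); last by rewrite ltr_pdivrMr // ltr_pMr // ltr1n.
apply: opnorm_le => [|x]; first exact: ltW.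
apply/ler_addgt0Pl => d d0.
have [M hM] := hT x _ d0.
have {}hM := hM _ (leq_maxl M N').
have {}hN' := ltW (hN' n _ Nn (leq_maxr M N')).
have h := opnorm_bound x hN'.
rewrite bopBE; apply: le_trans (hnorm_triangle (u (maxn M N') x) _ _) _.
by rewrite -bopBE addrC lerD // ltW.
Qed.

(** Riesz gives the real parts; replacing [x] by [- i x] gives the imaginary parts. *)
Lemma adj_exists T : exists S : bop H, is_adjoint T S.
Proof.
have [M M0 hM] := bop_bound T.
have ex y : exists z, forall x, complex.Re (inner (T x) y) = complex.Re (inner x z).
  apply: (@riesz_real R H (fun x => complex.Re (inner (T x) y)) (M * hnorm y)).
  - by move=> a b; rewrite linearD innerDl ReD.
  - by move=> t a; rewrite linearZ innerZl ReZ.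
  move=> x; apply: le_trans (Re_inner_CS _ _) _.
  by rewrite mulrAC ler_wpM2r ?hnorm_ge0.
have [S hS] := choice ex.
have hSc x y : inner (T x) y = inner x (S y).
  apply/eqP; rewrite eq_complex hS eqxx /=.
  by rewrite !Im_inner -linearZ hS eqxx.
have S_lin (c : R[i]) x y : S (c *: x + y) = c *: S x + S y.
  apply: inner_Re_inj => z; rewrite -hSc innerDr innerZr !hSc.
  by rewrite innerDr innerZr.
have S_bd x : hnorm (S x) <= M * hnorm x.
  have [x0|x0] := eqVneq (hnorm (S x)) 0.
    by rewrite x0 mulr_ge0 ?hnorm_ge0.
  have {}x0 : 0 < hnorm (S x) by rewrite lt_def x0 hnorm_ge0.
  rewrite -(ler_pM2l x0) -expr2 hnorm_sqr -hSc.
  apply: le_trans (Re_inner_CS _ _) _.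
  by rewrite mulrA [_ * M]mulrC ler_wpM2r ?hnorm_ge0.
by exists (BOp (conj S_lin (ex_intro _ _ S_bd))).
Qed.

Lemma adjP T : is_adjoint T (adj T).
Proof. by have [S hS] := adj_exists T; exact: (xgetI _ hS). Qed.

Lemma inner_adjr T x y : inner x (adj T y) = inner (T x) y.
Proof. by rewrite adjP. Qed.

Lemma inner_adjl T x y : inner (adj T x) y = inner x (T y).
Proof. by rewrite innerC inner_adjr -innerC. Qed.

Lemma adj_unique T S : is_adjoint T S -> adj T = S.
Proof.
by move=> h; apply: bop_eqP => y; apply: inner_Re_inj => z; rewrite inner_adjr h.
Qed.

Lemma adjK T : adj (adj T) = T.
Proof. by apply: adj_unique => x y; rewrite inner_adjl. Qed.
Lemma adjM S T : adj (S * T) = adj T * adj S.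
Proof. by apply: adj_unique => x y; rewrite !bopME !inner_adjr. Qed.
Lemma adjD S T : adj (S + T) = adj S + adj T.
Proof. by apply: adj_unique => x y; rewrite !bopDE innerDl innerDr !inner_adjr. Qed.
Lemma adj_scale (c : R[i]) T : adj (c *: T) = Num.conj c *: adj T.
Proof.
by apply: adj_unique => x y; rewrite !bopZE innerZl innerZr conjCK inner_adjr.
Qed.
Lemma adj_one : adj (1 : bop H) = 1.
Proof. by apply: adj_unique. Qed.
Lemma adj0 : adj (0 : bop H) = 0.
Proof. by apply: adj_unique => x y; rewrite !bop0E inner0l inner0r. Qed.
Lemma adjN T : adj (- T) = - adj T.
Proof. by apply: adj_unique => x y; rewrite !bopNE innerNl innerNr inner_adjr. Qed.
Lemma adjB S T : adj (S - T) = adj S - adj T.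
Proof. by rewrite adjD adjN. Qed.
Lemma adj_sum (I : Type) (s : seq I) (P : pred I) (F : I -> bop H) :
  adj (\sum_(i <- s | P i) F i) = \sum_(i <- s | P i) adj (F i).
Proof. by elim/big_rec2: _ => [|i a b _ <-]; rewrite ?adj0 ?adjD. Qed.

Lemma opnorm_adj T : opnorm (adj T) = opnorm T.
Proof.
have h S : opnorm (adj S) <= opnorm S.
  apply: opnorm_le => [|x]; first exact: opnorm_ge0.
  have [x0|x0] := eqVneq (hnorm (adj S x)) 0.
    by rewrite x0 mulr_ge0 ?hnorm_ge0 ?opnorm_ge0.
  have {}x0 : 0 < hnorm (adj S x) by rewrite lt_def x0 hnorm_ge0.
  rewrite -(ler_pM2l x0) -expr2 hnorm_sqr inner_adjr.
  apply: le_trans (Re_inner_CS _ _) _.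
  by rewrite mulrCA mulrA ler_wpM2r ?hnorm_ge0 ?opnormP.
by apply/eqP; rewrite eq_le h -{1}[T]adjK h.
Qed.

Lemma hnorm_sqr_adj T x : hnorm (T x) ^+ 2 = complex.Re (inner ((adj T * T) x) x).
Proof. by rewrite hnorm_sqr bopME inner_adjl. Qed.

End BopNorm.

(** * Limits in norm and square roots in C*-algebras *)

Section NormLimits.
Variables (R : realType) (H : hilbertType R).
Implicit Types (S T : bop H) (u v : nat -> bop H).

Definition opcvg u T := forall e : R, 0 < e ->
  exists N : nat, forall n, (N <= n)%N -> opnorm (u n - T) < e.

Lemma opcvg_unique u S T : opcvg u S -> opcvg u T -> S = T.
Proof.
move=> uS uT; apply/eqP; rewrite -subr_eq0; apply/eqP/opnorm_small => e e0.
have e2 : 0 < e / 2 by rewrite divr_gt0.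
have [N hN] := uS _ e2; have [M hM] := uT _ e2.
have {}hN := hN _ (leq_maxl N M); have {}hM := hM _ (leq_maxr N M).
apply: le_trans (opnorm_triangle (u (maxn N M)) _ _) _.
by rewrite opnormBC [leRHS]splitr lerD // ltW.
Qed.

Lemma opcvg_le u T (M : R) : opcvg u T -> (forall n, opnorm (u n) <= M) ->
  opnorm T <= M.
Proof.
move=> uT uM; apply/ler_addgt0Pl => e e0; have [N hN] := uT _ e0.
apply: le_trans (opnorm_le_add T (u N)) _.
by rewrite addrC lerD ?uM // opnormBC ltW ?hN.
Qed.

Lemma opcvg_cst T : opcvg (fun=> T) T.
Proof. by move=> e e0; exists 0 => n _; rewrite subrr opnorm0. Qed.

Lemma opcvg_shift u T : opcvg u T -> opcvg (fun n => u n.+1) T.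
Proof.
by move=> uT e /uT[N hN]; exists N => n Nn; apply: hN; exact: leqW.
Qed.

Lemma opcvgD u v S T : opcvg u S -> opcvg v T ->
  opcvg (fun n => u n + v n) (S + T).
Proof.
move=> uS vT e e0; have e2 : 0 < e / 2 by rewrite divr_gt0.
have [N hN] := uS _ e2; have [M hM] := vT _ e2.
exists (maxn N M) => n; rewrite geq_max => /andP[Nn Mn].
rewrite opprD addrACA; apply: le_lt_trans (opnormD _ _) _.
by rewrite [ltRHS]splitr ltrD ?hN ?hM.
Qed.

Lemma opcvgZ (c : R[i]) u T : opcvg u T -> opcvg (fun n => c *: u n) (c *: T).
Proof.
move=> uT e e0; have c1 : 0 < cmod c + 1 by rewrite ltr_wpDl ?cmod_ge0.
have [N hN] := uT _ (divr_gt0 e0 c1); exists N => n /hN h.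
rewrite -scalerBr; apply: le_lt_trans (opnormZ _ _) _.
rewrite ltr_pdivlMr // mulrC in h; apply: le_lt_trans h.
by rewrite ler_wpM2r ?opnorm_ge0 // lerDl.
Qed.

Lemma opcvgM u v S T : opcvg u S -> opcvg v T ->
  opcvg (fun n => u n * v n) (S * T).
Proof.
move=> uS vT e e0.
have c1 : 0 < opnorm S + 1 by rewrite ltr_wpDl ?opnorm_ge0.
have c2 : 0 < opnorm T + 1 by rewrite ltr_wpDl ?opnorm_ge0.
have e2 : 0 < e / 2 by rewrite divr_gt0.
have [N1 h1] := uS _ ltr01.
have [N2 h2] := uS _ (divr_gt0 e2 c2).
have [N3 h3] := vT _ (divr_gt0 e2 c1).
exists (maxn N1 (maxn N2 N3)) => n; rewrite !geq_max.
move=> /andP[/h1 {}h1 /andP[/h2 {}h2 /h3 {}h3]].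
have -> : u n * v n - S * T = u n * (v n - T) + (u n - S) * T.
  by rewrite mulrBr mulrBl addrA subrK.
apply: le_lt_trans (opnormD _ _) _; rewrite [ltRHS]splitr ltrD //.
  apply: le_lt_trans (opnormM _ _) _.
  rewrite ltr_pdivlMr // mulrC in h3; apply: le_lt_trans h3.
  rewrite ler_wpM2r ?opnorm_ge0 //; apply: le_trans (opnorm_le_add _ S) _.
  by rewrite lerD2l ltW.
apply: le_lt_trans (opnormM _ _) _.
rewrite ltr_pdivlMr // in h2; apply: le_lt_trans h2.
by rewrite ler_wpM2l ?opnorm_ge0 // lerDl.
Qed.

Lemma opcvg_adj u T : opcvg u T -> opcvg (fun n => adj (u n)) (adj T).
Proof.
by move=> uT e /uT[N hN]; exists N => n /hN; rewrite -adjB opnorm_adj.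
Qed.

Lemma opcvg_closed (A : set (bop H)) u T :
  norm_closed A -> (forall n, A (u n)) -> opcvg u T -> A T.
Proof.
move=> cA Au uT; apply: cA => e /uT[N hN]; exists (u N) => //.
by rewrite opnormBC hN.
Qed.

(** A criterion for iterations: it is enough to follow the same iteration on real
    majorants. *)
Lemma opcvg_majorized u (b : nat -> R) (M : R) :
  (forall n, opnorm (u n.+1 - u n) <= b n.+1 - b n) -> (forall n, b n <= M) ->
  exists T, opcvg u T.
Proof.
move=> ub bM; apply: bop_complete => e e0.
have mono n k : opnorm (u (n + k)%N - u n) <= b (n + k)%N - b n.
  elim: k => [|k IH]; first by rewrite addn0 !subrr opnorm0.
  rewrite addnS; apply: le_trans (opnorm_triangle (u (n + k)%N) _ _) _.
  by apply: le_trans (lerD (ub _) IH) _; rewrite addrA subrK.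
have bmono n k : b n <= b (n + k)%N.
  by rewrite -subr_ge0; apply: le_trans (mono n k); exact: opnorm_ge0.
pose D := [set b n | n in [set: nat]].
have supD : has_sup D by split; [exists (b 0%N), 0%N|exists M => _ [n _ <-]].
have [_ [N _ <-] hN] := sup_adherent e0 supD.
have close k : opnorm (u (N + k)%N - u N) <= b (N + k)%N - b N by exact: mono.
have top n : b n <= sup D by apply: ub_le_sup; [exact: supD.2|exists n].
have main n k : (N <= n)%N -> opnorm (u (n + k)%N - u n) < e.
  move=> Nn; apply: le_lt_trans (mono _ _) _.
  have := top (n + k)%N; have := bmono N (n - N)%N; rewrite subnKC //; lra.
exists N => m n Nm Nn; case/orP: (leq_total n m) => le.
  by have := main n (m - n)%N Nn; rewrite subnKC.
by have := main m (n - m)%N Nm; rewrite subnKC // opnormBC.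
Qed.

End NormLimits.

Section CstarAlgebra.
Variables (R : realType) (H : hilbertType R) (A : set (bop H)).
Hypothesis hA : cstar_subalgebra A.
Implicit Types (S T : bop H).

Lemma cstar0 : A 0. Proof. exact: hA.1. Qed.
Lemma cstarD S T : A S -> A T -> A (S + T). Proof. exact: hA.2.1. Qed.
Lemma cstarZ (c : R[i]) T : A T -> A (c *: T). Proof. exact: hA.2.2.1. Qed.
Lemma cstarM S T : A S -> A T -> A (S * T). Proof. exact: hA.2.2.2.1. Qed.
Lemma cstar_adj T : A T -> A (adj T). Proof. exact: hA.2.2.2.2.1. Qed.
Lemma cstar_closed : norm_closed A. Proof. exact: hA.2.2.2.2.2. Qed.
Lemma cstarN T : A T -> A (- T).
Proof. by rewrite -scaleN1r; exact: cstarZ. Qed.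
Lemma cstarB S T : A S -> A T -> A (S - T).
Proof. by move=> AS AT; apply: cstarD => //; exact: cstarN. Qed.
Lemma cstar_sum (I : eqType) (s : seq I) (F : I -> bop H) :
  (forall i, i \in s -> A (F i)) -> A (\sum_(i <- s) F i).
Proof.
elim: s => [|i s IH] h; first by rewrite big_nil; exact: cstar0.
rewrite big_cons; apply: cstarD; first by apply: h; rewrite mem_head.
by apply: IH => j js; apply: h; rewrite in_cons js orbT.
Qed.

Hypothesis hA1 : A 1.

Lemma half_add_half : (2^-1 : R)%:C + (2^-1 : R)%:C = 1 :> R[i].
Proof. by rewrite -rmorphD /= -[2^-1]mul1r -splitr. Qed.

(** [1 - b] is a square root of [1 - c].  The equation amounts to
    [b = (c + b^2) / 2], and [b] is the limit of this iteration from [0].  The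
    iteration is majorised by the same one on scalars with [c = 1], which increases
    and stays below [1]; so it converges even if [1 - c] is not invertible. *)
Lemma cstar_sqrt (c : bop H) : A c -> opnorm c <= 1 ->
  exists b, [/\ A b, opnorm b <= 1, (1 - b) * (1 - b) = 1 - c,
    forall d, d * c = c * d -> d * b = b * d & adj c = c -> adj b = b].
Proof.
move=> Ac c1; pose h : R[i] := (2^-1 : R)%:C.
have cmodh : cmod h = 2^-1 by rewrite cmodr ger0_norm // invr_ge0.
pose u := fix u n := if n is n'.+1 then h *: (c + u n' * u n') else 0.
pose b := fix b n : R := if n is n'.+1 then 2^-1 * (1 + b n' ^+ 2) else 0.
have b01 n : 0 <= b n <= 1.
  elim: n => [|n /andP[b0 b1]] /=; first by rewrite lexx ler01.
  have : b n ^+ 2 <= 1 by rewrite expr_le1.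
  by have := sqr_ge0 (b n); move=> ? ?; apply/andP; split; lra.
have ub n : opnorm (u n) <= b n.
  elim: n => [|n IH] /=; first by rewrite opnorm0.
  apply: le_trans (opnormZ _ _) _; rewrite cmodh ler_wpM2l ?invr_ge0 //.
  apply: le_trans (opnormD _ _) _; rewrite lerD // expr2.
  by apply: le_trans (opnormM _ _) _; rewrite ler_pM ?opnorm_ge0.
have step n : opnorm (u n.+1 - u n) <= b n.+1 - b n.
  elim: n => [|n IH].
    by rewrite subr0 -[b 0%N]/0 subr0; exact: ub 1%N.
  rewrite -[u n.+2]/(h *: (c + u n.+1 * u n.+1)).
  rewrite -[X in _ - X]/(h *: (c + u n * u n)).
  rewrite -scalerBr opprD addrACA subrr add0r.
  have -> : u n.+1 * u n.+1 - u n * u n =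
      u n.+1 * (u n.+1 - u n) + (u n.+1 - u n) * u n.
    by rewrite mulrBr mulrBl addrA subrK.
  rewrite -[b n.+2]/(2^-1 * (1 + b n.+1 ^+ 2)).
  rewrite -[X in _ <= _ - X]/(2^-1 * (1 + b n ^+ 2)).
  apply: le_trans (opnormZ _ _) _; rewrite cmodh -mulrBr ler_wpM2l ?invr_ge0 //.
  apply: le_trans (opnormD _ _) _.
  have -> : 1 + b n.+1 ^+ 2 - (1 + b n ^+ 2) =
     b n.+1 * (b n.+1 - b n) + (b n.+1 - b n) * b n by ring.
  by rewrite lerD //; apply: le_trans (opnormM _ _) _;
     rewrite ler_pM ?opnorm_ge0 ?ub.
have [T uT] := opcvg_majorized step (fun n => proj2 (andP (b01 n))).
have Au n : A (u n).
  elim: n => [|n IH] /=; first exact: cstar0.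
  by apply: cstarZ; apply: cstarD => //; exact: cstarM.
have fixT : h *: (c + T * T) = T.
  apply: (@opcvg_unique _ _ (fun n => u n.+1)); last exact: opcvg_shift.
  by apply: opcvgZ; apply: opcvgD; [exact: opcvg_cst|exact: opcvgM].
have dbl : T + T = c + T * T.
  by rewrite -{1 2}fixT -scalerDl half_add_half scale1r.
exists T; split.
- exact: opcvg_closed cstar_closed Au uT.
- by apply: opcvg_le uT _ => n; apply: le_trans (ub n) _; case/andP: (b01 n).
- rewrite mulrBr !mulrBl !mulr1 !mul1r -addrA -opprD; congr (1 - _).
  by rewrite addrA dbl addrK.
- move=> d dc.
  have du n : d * u n = u n * d.
    elim: n => [|n IH] /=; first by rewrite mulr0 mul0r.
    rewrite bopZr bopZl; congr (_ *: _).
    by rewrite mulrDr mulrDl dc mulrA IH -!mulrA IH.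
  apply: (@opcvg_unique _ _ (fun n => d * u n)).
    by apply: opcvgM => //; exact: opcvg_cst.
  under eq_fun do rewrite du.
  by apply: opcvgM => //; exact: opcvg_cst.
- move=> sc; have su n : adj (u n) = u n.
    elim: n => [|n IH] /=; first by rewrite adj0.
    by rewrite adj_scale conj_realC adjD adjM IH sc.
  apply: (opcvg_unique _ uT); rewrite (_ : u = fun n => adj (u n)).
    exact: opcvg_adj.
  by apply/funext => n; rewrite su.
Qed.

End CstarAlgebra.

(** * Positive operators and star homomorphisms *)

Section Positivity.
Variables (R : realType) (H : hilbertType R).
Implicit Types (P Q S T : bop H).

(** The quadratic form is real; polarise it at [x + y] and at [x + i y]. *)
Lemma op_ge0_selfadjoint T : op_ge0 T -> adj T = T.
Proof.
move=> T0; have im0 x : complex.Im (inner (T x) x) = 0.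
  by have := T0 x; rewrite lecE => /andP[/eqP].
apply: adj_unique => x y.
have e1 : complex.Im (inner (T x) y) + complex.Im (inner (T y) x) = 0.
  have := im0 (x + y); rewrite bop_appD innerDl !innerDr !raddfD /= !im0; lra.
have e2 : complex.Re (inner (T y) x) - complex.Re (inner (T x) y) = 0.
  have := im0 (x + 'i *: y); rewrite bop_appD bop_appZ innerDl !innerDr.
  rewrite !innerZl !innerZr !raddfD /= im0.
  have := im0 y; case: (inner (T y) y) => a b /= ->.
  case: (inner (T y) x) => c d; case: (inner (T x) y) => c' d' /=; lra.
rewrite [RHS]innerC; move: e1 e2; case: (inner (T y) x) => c d.
case: (inner (T x) y) => c' d' /= e1 e2.
by apply/eqP; rewrite eq_complex /=; apply/andP; split; apply/eqP; lra.
Qed.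

Lemma selfadjoint_sqr_eq0 T : adj T = T -> T * T = 0 -> T = 0.
Proof.
move=> sT T2; apply: bop_eqP => x; apply: hnorm_eq0; apply/eqP.
by rewrite -sqrf_eq0 hnorm_sqr_adj sT T2 bop0E inner0l.
Qed.

(** Put [P = S * S] and [D = P - Q].  The operators [D P D] and [D Q D] are positive
    and, as [P] and [Q] commute, their sum [(P^2 - Q^2) D] is zero.  So [S D = 0],
    hence [P^2 = P Q] and [D^2 = 0].  As [P] is a square, [S D = 0]
    can be read off the form of [D P D]. *)
Lemma positive_sqrt_unique S Q : adj S = S -> adj Q = Q ->
  (forall x, 0 <= complex.Re (inner (Q x) x)) ->
  (S * S) * Q = Q * (S * S) -> (S * S) * (S * S) = Q * Q -> S * S = Q.
Proof.
move=> sS sQ Q0 PQ PPQQ; set P := S * S in PQ PPQQ *.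
have sP : adj P = P by rewrite adjM sS.
pose D := P - Q; have sD : adj D = D by rewrite adjB sP sQ.
have D1 : D * P * D + D * Q * D = 0.
  rewrite -mulrDl -mulrDr (_ : D * (P + Q) = 0) ?mul0r //.
  by rewrite mulrDr !mulrBl PPQQ PQ addrA subrK subrr.
have SD : S * D = 0.
  apply: bop_eqP => x; apply: hnorm_eq0; apply/eqP.
  rewrite -sqrf_eq0 eq_le sqr_ge0 andbT.
  rewrite hnorm_sqr_adj adjM sS sD.
  have : complex.Re (inner (D (P (D x)) + D (Q (D x))) x) = 0.
    by rewrite -[_ + _]/((D * P * D + D * Q * D) x) D1 bop0E inner0l.
  have : 0 <= complex.Re (inner (D (Q (D x))) x) by rewrite -{1}sD inner_adjl.
  rewrite (_ : D * S * (S * D) = D * P * D); last by rewrite /P !mulrA.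
  rewrite innerDl ReD -[(D * P * D) x]/(D (P (D x))); lra.
have PD : P * D = 0 by rewrite /P -mulrA SD mulr0.
have PQ' : P * Q = Q * Q.
  by apply/esym/eqP; rewrite -PPQQ -subr_eq0 -mulrBr PD.
have D2 : D * D = 0.
  by rewrite {1}/D mulrBl PD sub0r /D mulrBr -PQ PQ' subrr oppr0.
by apply/eqP; rewrite -subr_eq0; apply/eqP/selfadjoint_sqr_eq0.
Qed.

(** [|x - T^2 x|^2 = |x|^2 - 2 |T x|^2 + |T^2 x|^2], and the last term is at most
    [|T x|^2]. *)
Lemma opnorm_1_sub_sqr T : adj T = T -> opnorm T <= 1 -> opnorm (1 - T * T) <= 1.
Proof.
move=> sT T1; apply: opnorm_le => // x; rewrite mul1r.
rewrite -(@ler_pXn2r _ 2) ?nnegrE ?hnorm_ge0 // bopBE bop1E hnormD_sqr hnormN_sqr.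
rewrite innerNr ReN bopME -inner_adjl sT -hnorm_sqr.
have : hnorm (T (T x)) ^+ 2 <= hnorm (T x) ^+ 2.
  rewrite ler_pXn2r ?nnegrE ?hnorm_ge0 //.
  by have := opnorm_bound (T x) T1; rewrite mul1r.
have := sqr_ge0 (hnorm (T x)); lra.
Qed.

End Positivity.

Section StarHom.
Variables (R : realType) (H K : hilbertType R) (A : set (bop H)).
Hypothesis hA : cstar_subalgebra A.
Variable (f : bop H -> bop K).
Hypothesis hf : star_hom A f.

Lemma star_homP (c : R[i]) a b : A a -> A b -> f (c *: a + b) = c *: f a + f b.
Proof. exact: hf.1. Qed.
Lemma star_homM a b : A a -> A b -> f (a * b) = f a * f b.
Proof. exact: hf.2.1. Qed.
Lemma star_hom_adj a : A a -> f (adj a) = adj (f a).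
Proof. exact: hf.2.2. Qed.
Lemma star_hom0 : f 0 = 0.
Proof.
have := star_homP (-1) (cstar0 hA) (cstar0 hA).
by rewrite !scaleN1r oppr0 addr0 addNr.
Qed.
Lemma star_homD a b : A a -> A b -> f (a + b) = f a + f b.
Proof. by move=> Aa Ab; have := star_homP 1 Aa Ab; rewrite !scale1r. Qed.
Lemma star_homZ (c : R[i]) a : A a -> f (c *: a) = c *: f a.
Proof.
by move=> Aa; have := star_homP c Aa (cstar0 hA); rewrite star_hom0 !addr0.
Qed.
Lemma star_homB a b : A a -> A b -> f (a - b) = f a - f b.
Proof.
move=> Aa Ab; rewrite star_homD //; last exact: cstarN.
by rewrite -scaleN1r star_homZ // scaleN1r.
Qed.
Lemma star_hom_sum (I : eqType) (s : seq I) (F : I -> bop H) :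
  (forall i, i \in s -> A (F i)) ->
  f (\sum_(i <- s) F i) = \sum_(i <- s) f (F i).
Proof.
elim: s => [|i s IH] h; first by rewrite !big_nil star_hom0.
have Ai : A (F i) by apply: h; rewrite mem_head.
have As j : j \in s -> A (F j) by move=> js; apply: h; rewrite in_cons js orbT.
by rewrite !big_cons star_homD ?IH //; exact: cstar_sum.
Qed.
End StarHom.

Section Contractive.
Variables (R : realType) (H K L : hilbertType R) (A : set (bop H)).
Hypothesis hA : cstar_subalgebra A.
Hypothesis hA1 : A 1.
Variables (f : bop H -> bop K) (g : bop H -> bop L).
Hypothesis hf : star_hom A f.
Hypothesis hg : star_hom A g.
Hypotheses (f1 : f 1 = 1) (g1 : g 1 = 1).
Hypothesis ker : forall a, A a -> f a = 0 -> g a = 0.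

(** Let [r = |f a|].  The element [w = r^2 - a^* a] need not be positive, but [f w] is.
    Let [v] be the absolute value of [w], built from two square roots in [A].  Then
    [f v] and [f w] are positive square roots of [f (w^2)], so they are equal; hence
    [g v = g w], and [g w] is positive as [v] is a square, that is [|g a| <= r].

    This says that [g] induces a contraction on the image of [f], and does not
    presuppose that this image is closed. *)
Lemma star_hom_contractive_ker a : A a -> opnorm (g a) <= opnorm (f a).
Proof.
move=> Aa; set r := opnorm (f a).
pose w0 : bop H := (r ^+ 2)%:C *: (1 : bop H) - adj a * a.
have Aw0 : A w0.
  by apply: (cstarB hA); [exact: cstarZ|apply: (cstarM hA) => //; exact: cstar_adj].
(* The square root needs a contraction. *)
pose l := (opnorm w0 + 1)^-1.
have l0 : 0 < l by rewrite invr_gt0 ltr_wpDl ?opnorm_ge0.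
pose w : bop H := l%:C *: w0.
have Aw : A w by exact: cstarZ.
have sw : adj w = w.
  by rewrite adj_scale adjB adj_scale adjM adjK adj_one !conj_realC.
have w1 : opnorm w <= 1.
  apply: le_trans (opnormZ _ _) _; rewrite cmodr gtr0_norm // mulrC.
  by rewrite ler_pdivrMr ?mul1r ?lerDl ?ltr_wpDl ?opnorm_ge0.
(* Positivity of [h w] is the inequality [|h a x| <= r |x|]. *)
have form (M : hilbertType R) (h : bop H -> bop M) : star_hom A h -> h 1 = 1 ->
    forall x, complex.Re (inner (h w x) x) =
      l * (r ^+ 2 * hnorm x ^+ 2 - hnorm (h a x) ^+ 2).
  move=> hh h1 x; rewrite (star_homZ hA hh) // (star_homB hA hh) //; last 2 first.
  - exact: cstarZ.
  - by apply: (cstarM hA) => //; exact: cstar_adj.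
  rewrite (star_homZ hA hh) // h1 (star_homM hh) //; last exact: cstar_adj.
  rewrite (star_hom_adj hh) // bopZE innerZl ReZ bopBE innerBl ReB.
  by rewrite bopZE bop1E innerZl ReZ -hnorm_sqr hnorm_sqr_adj.
have Aww : A (1 - w * w) by apply: cstarB => //; exact: cstarM.
have [b1 [Ab1 nb1 sq1 com1 sa1]] := cstar_sqrt hA Aww (opnorm_1_sub_sqr sw w1).
have {}sa1 : adj b1 = b1 by apply: sa1; rewrite adjB adjM adj_one sw.
have {}sq1 : (1 - b1) * (1 - b1) = w * w by rewrite sq1 opprB addrC subrK.
have {}com1 : w * b1 = b1 * w.
  by apply: com1; rewrite mulrBr mulrBl mulr1 mul1r mulrA.
have [b2 [Ab2 _ sq2 _ sa2]] := cstar_sqrt hA Ab1 nb1.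
have {}sa2 : adj b2 = b2 := sa2 sa1.
pose s : bop H := 1 - b2.
have As : A s by exact: cstarB.
have ss : adj s = s by rewrite adjB adj_one sa2.
have {}sq1 : (s * s) * (s * s) = w * w by rewrite /s sq2.
have {}com1 : (s * s) * w = w * (s * s).
  by rewrite /s sq2 mulrBl mulrBr mul1r mulr1 com1.
have Ass : A (s * s) by exact: cstarM.
have fsw : f (s * s) = f w.
  rewrite (star_homM hf) //; apply: positive_sqrt_unique.
  - by rewrite -(star_hom_adj hf) // ss.
  - by rewrite -(star_hom_adj hf) // sw.
  - move=> x; rewrite (form _ f) // mulr_ge0 ?(ltW l0) // subr_ge0 -exprMn.
    by rewrite ler_pXn2r ?nnegrE ?mulr_ge0 ?hnorm_ge0 ?opnorm_ge0 ?opnormP.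
  - by rewrite -!(star_homM hf) // com1.
  - by rewrite -!(star_homM hf) // sq1.
have gsw : g (s * s) = g w.
  apply/eqP; rewrite -subr_eq0 -(star_homB hA hg) //; apply/eqP/ker.
    exact: cstarB.
  by rewrite (star_homB hA hf) // fsw subrr.
apply: opnorm_le => [|x]; first exact: opnorm_ge0.
rewrite -(@ler_pXn2r _ 2) ?nnegrE ?mulr_ge0 ?hnorm_ge0 ?opnorm_ge0 // exprMn.
rewrite -subr_ge0 -(pmulr_rge0 _ l0) -(form _ g) // -gsw (star_homM hg) //.
rewrite -[X in X * g s](_ : adj (g s) = _); last by rewrite -(star_hom_adj hg) // ss.
by rewrite -hnorm_sqr_adj sqr_ge0.
Qed.

End Contractive.

Lemma star_hom_contractive (R : realType) (H K : hilbertType R) (A : set (bop H))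
  (f : bop H -> bop K) a : cstar_subalgebra A -> A 1 -> star_hom A f ->
  f 1 = 1 -> A a -> opnorm (f a) <= opnorm a.
Proof.
move=> hA A1 hf f1 Aa.
apply: (@star_hom_contractive_ker _ H H K A hA A1 id f) => // {Aa}b _ ->.
exact: star_hom0 hf.
Qed.

(** * Characters of a commutative C*-algebra *)

Section Modulus.
Variable (R : realType).
Implicit Types a b c : R[i].

Lemma cmodM a b : cmod (a * b) = cmod a * cmod b.
Proof.
have := congr1 (@complex.Re R) (normrM a b); rewrite !normc_cmod ReZ /=; exact.
Qed.

Lemma cmod_eq0 a : (cmod a == 0) = (a == 0).
Proof. by rewrite -[RHS]normr_eq0 normc_cmod -(inj_eq (@complexI R)). Qed.

Lemma cmodV a : cmod a^-1 = (cmod a)^-1.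
Proof.
have [->|a0] := eqVneq a 0; first by rewrite invr0 cmodr normr0 invr0.
have c0 : cmod a != 0 by rewrite cmod_eq0.
apply: (mulfI c0); rewrite -cmodM !divff //.
by rewrite cmodr normr1.
Qed.

Lemma normr_Re_le c : `|complex.Re c| <= cmod c.
Proof.
rewrite -(@ler_pXn2r _ 2) ?nnegrE ?cmod_ge0 // real_normK ?num_real //.
by rewrite cmod_sqr lerDl sqr_ge0.
Qed.

Lemma ltc_real c (r : R) : (`|c| < r%:C) = (cmod c < r).
Proof. by rewrite normc_cmod ltcR. Qed.

Lemma real_complexE c : complex.Im c = 0 -> c = (complex.Re c)%:C.
Proof. by case: c => a b /= ->. Qed.

End Modulus.

Section Characters.
Variables (R : realType) (H : hilbertType R) (Z : set (bop H)).
Hypothesis hZ : cstar_subalgebra Z.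
Hypothesis hZ1 : Z 1.
Variable m : bop H -> R[i].
Hypothesis hm : character_space Z m.

Lemma characterP (c : R[i]) a b : Z a -> Z b -> m (c *: a + b) = c * m a + m b.
Proof. exact: hm.1.1. Qed.
Lemma character_out a : ~ Z a -> m a = 0.
Proof. exact: hm.1.2. Qed.
Lemma characterM a b : Z a -> Z b -> m (a * b) = m a * m b.
Proof. exact: hm.2.1. Qed.
Lemma character1 : m 1 = 1.
Proof.
have [a Za a0] := hm.2.2; apply: (mulfI a0).
by rewrite -characterM // !mulr1.
Qed.
Lemma character0 : m 0 = 0.
Proof.
have := characterP (-1) (cstar0 hZ) (cstar0 hZ).
by rewrite scaleN1r oppr0 addr0 mulN1r addNr.
Qed.
Lemma characterD a b : Z a -> Z b -> m (a + b) = m a + m b.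
Proof. by move=> Za Zb; have := characterP 1 Za Zb; rewrite scale1r mul1r. Qed.
Lemma characterZ (c : R[i]) a : Z a -> m (c *: a) = c * m a.
Proof.
by move=> Za; have := characterP c Za (cstar0 hZ); rewrite character0 !addr0.
Qed.
Lemma characterB a b : Z a -> Z b -> m (a - b) = m a - m b.
Proof.
move=> Za Zb; rewrite characterD //; last exact: cstarN.
by rewrite -scaleN1r characterZ // mulN1r.
Qed.
Lemma character_sum (I : eqType) (s : seq I) (F : I -> bop H) :
  (forall i, i \in s -> Z (F i)) ->
  m (\sum_(i <- s) F i) = \sum_(i <- s) m (F i).
Proof.
elim: s => [|i s IH] h; first by rewrite !big_nil character0.
have Zi : Z (F i) by apply: h; rewrite mem_head.
have Zs j : j \in s -> Z (F j) by move=> js; apply: h; rewrite in_cons js orbT.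
by rewrite !big_cons characterD ?IH //; exact: cstar_sum.
Qed.

(** Otherwise [1 - a / m a] would be invertible by a Neumann series, although [m]
    maps it to [0]. *)
Lemma character_le a : Z a -> cmod (m a) <= opnorm a.
Proof.
move=> Za; rewrite leNgt; apply/negP => lt.
have ma0 : 0 < cmod (m a) by apply: le_lt_trans lt; exact: opnorm_ge0.
pose c : bop H := (m a)^-1 *: a; pose r := opnorm c.
have Zc : Z c by exact: cstarZ.
have mc : m c = 1.
  by rewrite characterZ // mulVf // -cmod_eq0 gt_eqF.
have r0 : 0 <= r := opnorm_ge0 _.
have r1 : r < 1.
  apply: le_lt_trans (opnormZ _ _) _.
  by rewrite cmodV mulrC ltr_pdivrMr // mul1r.
pose u := fix u n := if n is n'.+1 then 1 + c * u n' else 0.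
pose b := fix b n : R := if n is n'.+1 then 1 + r * b n' else 0.
have step n : opnorm (u n.+1 - u n) <= b n.+1 - b n.
  elim: n => [|n IH]; first by rewrite /= !mulr0 !addr0 !subr0; exact: opnorm1.
  rewrite -[u n.+2]/(1 + c * u n.+1) -[X in _ - X]/(1 + c * u n).
  rewrite -[b n.+2]/(1 + r * b n.+1) -[X in _ <= _ - X]/(1 + r * b n).
  rewrite [in X in X <= _]opprD addrACA subrr add0r -mulrBr.
  rewrite [in X in _ <= X]opprD addrACA subrr add0r -mulrBr.
  by apply: le_trans (opnormM _ _) _; rewrite ler_wpM2l.
have bM n : b n <= (1 - r)^-1.
  elim: n => [|n IH] /=; first by rewrite invr_ge0 subr_ge0 ltW.
  apply: le_trans (lerD (lexx 1) (ler_wpM2l r0 IH)) _.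
  rewrite -[X in X + _](@divff _ (1 - r)) ?subr_eq0 ?gt_eqF //.
  by rewrite -mulrDl subrK mul1r.
have [T uT] := opcvg_majorized step bM.
have Zu n : Z (u n).
  by elim: n => [|n IH] /=; [exact: cstar0|apply: cstarD => //; exact: cstarM].
have ZT : Z T := opcvg_closed (cstar_closed hZ) Zu uT.
have fixT : 1 + c * T = T.
  apply: (@opcvg_unique _ _ (fun n => u n.+1)); last exact: opcvg_shift.
  by apply: opcvgD; [exact: opcvg_cst|apply: opcvgM => //; exact: opcvg_cst].
have := congr1 m fixT; rewrite characterD ?characterM ?mc ?mul1r ?character1 //.
  by move/eqP; rewrite -subr_eq0 addrK oner_eq0.
exact: cstarM.
Qed.

(** [|m (a + i t)|^2 <= |a|^2 + t^2] for every real [t]: an imaginary part [q] of [m a]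
    would contribute the unbounded term [2 t q] on the left. *)
Lemma character_selfadjoint a : Z a -> adj a = a -> complex.Im (m a) = 0.
Proof.
move=> Za sa; set p := complex.Re (m a); set q := complex.Im (m a).
have key t : q ^+ 2 + p ^+ 2 + t * q *+ 2 <= opnorm a ^+ 2.
  pose T : bop H := a + (0 +i* t)%C *: (1 : bop H).
  have ZT : Z T by apply: cstarD => //; exact: cstarZ.
  have s0 : 0 <= opnorm a ^+ 2 + t ^+ 2 by rewrite addr_ge0 ?sqr_ge0.
  have T2 : opnorm T <= Num.sqrt (opnorm a ^+ 2 + t ^+ 2).
    apply: opnorm_le => [|x]; first exact: sqrtr_ge0.
    rewrite -(@ler_pXn2r _ 2) ?nnegrE ?mulr_ge0 ?hnorm_ge0 ?sqrtr_ge0 //.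
    rewrite exprMn (sqr_sqrtr s0) bopDE bopZE bop1E hnormD_sqr.
    rewrite hnorm_scale exprMn cmod_sqr /= expr0n add0r mulrDl -addrA.
    have : hnorm (a x) ^+ 2 <= opnorm a ^+ 2 * hnorm x ^+ 2.
      by rewrite -exprMn ler_pXn2r ?nnegrE ?mulr_ge0 ?opnorm_ge0 ?hnorm_ge0 ?opnormP.
    have im0 : complex.Im (inner (a x) x) = 0.
      have xa : inner x (a x) = inner (a x) x by rewrite -{1}sa inner_adjr.
      by have := innerC (a x) x; rewrite xa; case: (inner _ _) => d e [] /=; lra.
    rewrite innerZr; move: im0; case: (inner (a x) x) => d e /= ->.
    by rewrite mul0r mulr0 subrr mul0rn addr0; lra.
  have := le_trans (character_le ZT) T2.
  rewrite characterD ?characterZ ?character1 ?mulr1 //; last exact: cstarZ.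
  rewrite -(@ler_pXn2r _ 2) ?nnegrE ?cmod_ge0 ?sqrtr_ge0 //.
  rewrite (sqr_sqrtr s0) cmod_sqr.
  rewrite /p /q; case: (m a) => d e /=; rewrite addr0 sqrrD; lra.
apply/eqP/negPn/negP => q0.
have := key ((opnorm a ^+ 2 + 1) / (q * 2)).
have -> : (opnorm a ^+ 2 + 1) / (q * 2) * q *+ 2 = opnorm a ^+ 2 + 1.
  by rewrite -mulrnAr -[q *+ 2]mulr_natr divfK // mulf_neq0 ?pnatr_eq0.
have := sqr_ge0 p; have := sqr_ge0 q; lra.
Qed.

Lemma character_adj a : Z a -> m (adj a) = Num.conj (m a).
Proof.
move=> Za; have Za' := cstar_adj hZ Za.
pose u : bop H := a + adj a; pose v : bop H := (0 +i* -1)%C *: (a - adj a).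
have Zu : Z u by exact: cstarD.
have Zv : Z v by apply: cstarZ => //; exact: cstarB.
have u0 : complex.Im (m u) = 0.
  by apply: character_selfadjoint => //; rewrite adjD adjK addrC.
have v0 : complex.Im (m v) = 0.
  apply: character_selfadjoint => //; rewrite adj_scale adjB adjK -opprB scalerN.
  rewrite -scaleNr; congr (_ *: _).
  by apply/eqP; rewrite eq_complex /= oppr0 opprK !eqxx.
move: u0 v0; rewrite characterD // characterZ // ?characterB //; last exact: cstarB.
case: (m a) (m (adj a)) => [p q] [p' q'] /= h1 h2.
by apply/eqP; rewrite eq_complex /=; apply/andP; split; apply/eqP; lra.
Qed.

End Characters.

(** * Bump functions on the character space *)

Section WeakTopology.
Variables (R : realType) (H : hilbertType R).
Implicit Types (m : bop H -> R[i]).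

Lemma complex_gt0E (e : R[i]) : 0 < e -> exists2 r : R, 0 < r & e = r%:C.
Proof. by case: e => a b; rewrite ltcE /= => /andP[/eqP -> a0]; exists a. Qed.

(** The sets described by finitely many points and a radius form a filter; it converges
    to [m0] at every point, hence in the topology of pointwise convergence, and so
    contains [O]. *)
Lemma ptws_open_basic (O : set {ptws bop H -> R[i]^o}) m0 : open O -> O m0 ->
  exists (s : seq (bop H)) (e : R), 0 < e /\
    forall m, (forall z, z \in s -> cmod (m z - m0 z) < e) -> O m.
Proof.
move=> oO Om0.
pose F : set_system (bop H -> R[i]^o) := [set B |
  exists (s : seq (bop H)) (e : R), 0 < e /\
    forall m, (forall z, z \in s -> cmod (m z - m0 z) < e) -> B m].
have FF : Filter F.
  split.
  - by exists [::], 1; split.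
  - move=> P Q [s [e [e0 hP]]] [t [d [d0 hQ]]].
    exists (s ++ t), (Num.min e d); rewrite lt_min e0 d0; split => // m hm.
    split; [apply: hP => z zs|apply: hQ => z zs].
      by have := hm z; rewrite mem_cat zs lt_min => /(_ isT)/andP[].
    by have := hm z; rewrite mem_cat zs orbT lt_min => /(_ isT)/andP[].
  - move=> P Q PQ [s [e [e0 hP]]]; exists s, e; split => // m /hP; exact: PQ.
have : {ptws, F --> (m0 : bop H -> R[i]^o)}.
  apply/cvg_sup => z; apply/cvg_image.
    by rewrite eqEsubset; split=> // v _; exists (cst v).
  move=> W /= /nbhs_ballP[_ /complex_gt0E[e e0 ->] eW].
  exists ((fun g => g z) @^-1` W).
    exists [:: z], e; split => // m hm; apply: eW.
    by rewrite /ball /= distrC ltc_real hm // mem_head.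
  by rewrite eqEsubset; split => [j [? + <-//]|j Wj]; exists (cst j).
move=> /(_ O); apply; exact: open_nbhs_nbhs.
Qed.

Lemma ptws_eval_nbhs (S : choiceType) (T : topologicalType) (x : S)
  (f : {ptws S -> T}) (B : set T) :
  nbhs (f x) B -> nbhs f ((fun g : {ptws S -> T} => g x) @^-1` B).
Proof. exact: (@proj_continuous S (fun=> T)). Qed.

Lemma weak_closure_Re_le (X W : set (bop H -> R[i])) (y : bop H) (M : R) :
  (forall m, W m -> complex.Re (m y) <= M) ->
  forall m, weak_closure X W m -> complex.Re (m y) <= M.
Proof.
move=> hW m [_ cm]; rewrite leNgt; apply/negP => lt.
have e0 : 0 < (complex.Re (m y) - M)%:C :> R[i] by rewrite ltcR subr_gt0.
pose B : set (R[i]^o) := ball (m y : R[i]^o) (complex.Re (m y) - M)%:C.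
have hB : nbhs (m y : R[i]^o) B by exact: nbhsx_ballx.
have h : nbhs (m : {ptws bop H -> R[i]^o})
    ((fun g : {ptws bop H -> R[i]^o} => g y) @^-1` B).
  exact: (@ptws_eval_nbhs (bop H) R[i]^o y m B hB).
have [g [Wg gm]] := cm _ h.
have {}gm : cmod (m y - g y) < complex.Re (m y) - M by rewrite -ltc_real.
have := le_lt_trans (normr_Re_le _) gm; have := hW _ Wg.
by rewrite ReB => h1 /(le_lt_trans (ler_norm _)); lra.
Qed.

End WeakTopology.

Section Bump.
Variables (R : realType) (H : hilbertType R) (Z : set (bop H)).
Hypothesis hZ : cstar_subalgebra Z.
Hypothesis hZ1 : Z 1.

(** Let [V] contain the characters that are [e]-close to [m0] at the points of [s].
    The points outside [Z] impose no condition, as characters vanish there.  For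
    [y] the sum of the [(z - m0 z)^* (z - m0 z)] over the points of [s] in [Z],
    [m y < e^2] implies that [m] is in [V].  With [w] a multiple of [e^2 / 2 - y],
    the bump is [|w| + w] divided by its norm: it is nonzero at [m0], and vanishes
    where [m y >= e^2 / 2].  Dividing by the norm also yields [m z <= 1], since
    characters are contractive. *)
Lemma bump_exists (V : set (bop H -> R[i])) :
  weak_open (character_space Z) V -> V !=set0 -> exists z, bump_in Z V z.
Proof.
move=> [O oO ->] [m0 [Xm0 Om0]].
have [s [e [e0 hO]]] := ptws_open_basic oO Om0.
pose d z : bop H := z - m0 z *: (1 : bop H).
pose t := [seq z <- s | `[< Z z >]].
have Zt z : z \in t -> Z z by rewrite mem_filter => /andP[/asboolP].
have Zd z : z \in t -> Z (d z).
  by move=> zt; apply: (cstarB hZ); [exact: Zt|exact: cstarZ].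
pose y := \sum_(z <- t) adj (d z) * d z.
have Zdd z : z \in t -> Z (adj (d z) * d z).
  by move=> zt; apply: (cstarM hZ); [apply: (cstar_adj hZ)|]; exact: Zd.
have Zy : Z y by apply: (cstar_sum hZ).
have sy : adj y = y.
  by rewrite adj_sum; apply: eq_bigr => z _; rewrite adjM adjK.
have my m : character_space Z m ->
    m y = (\sum_(z <- t) cmod (m z - m0 z) ^+ 2)%:C.
  move=> hm; rewrite (character_sum hZ hm) // rmorph_sum /=.
  rewrite [LHS]big_seq [RHS]big_seq; apply: eq_bigr => z zt.
  have Zz := Zt z zt.
  rewrite (characterM hm); [|exact: (cstar_adj hZ (Zd z zt))|exact: Zd].
  rewrite (character_adj hZ hZ1 hm (Zd z zt)) mulrC -sqr_normc normc_cmod.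
  rewrite (characterB hZ hm) //; last exact: cstarZ.
  by rewrite (characterZ hZ hm) // (character1 hZ1 hm) // mulr1 rmorphXn.
have inV m : character_space Z m -> complex.Re (m y) < e ^+ 2 -> O m.
  move=> hm; rewrite my //= => lt; apply: hO => z zs.
  have [Zz|nZz] := pselect (Z z); last first.
    by rewrite (character_out hm nZz) (character_out Xm0 nZz) subrr cmodr normr0.
  have zt : z \in t by rewrite mem_filter zs andbT; apply/asboolP.
  rewrite -(@ltr_pXn2r _ 2) ?nnegrE ?cmod_ge0 ?(ltW e0) //.
  apply: le_lt_trans lt; rewrite (big_rem z zt) /= lerDl.
  by apply: sumr_ge0 => i _; exact: sqr_ge0.
have m0y : m0 y = 0 by rewrite my // big1 // => z _; rewrite subrr cmodr normr0 expr0n.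
pose k := e ^+ 2 / 2; have k0 : 0 < k by rewrite divr_gt0 // exprn_gt0.
pose w0 : bop H := k%:C *: (1 : bop H) - y.
pose l := (opnorm w0 + 1)^-1.
have l0 : 0 < l by rewrite invr_gt0 ltr_wpDl ?opnorm_ge0.
pose w : bop H := l%:C *: w0.
have Zw0 : Z w0 by apply: (cstarB hZ) => //; exact: cstarZ.
have Zw : Z w by exact: cstarZ.
have sw : adj w = w by rewrite adj_scale adjB sy adj_scale adj_one !conj_realC.
have w1 : opnorm w <= 1.
  apply: le_trans (opnormZ _ _) _; rewrite cmodr gtr0_norm // mulrC.
  by rewrite ler_pdivrMr ?mul1r ?lerDl ?ltr_wpDl ?opnorm_ge0.
have mw m : character_space Z m -> m w = (l * (k - complex.Re (m y)))%:C.
  move=> hm; rewrite (characterZ hZ hm) // (characterB hZ hm) //; last exact: cstarZ.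
  rewrite (characterZ hZ hm) // (character1 hZ1 hm) // mulr1 my //.
  by rewrite -rmorphB -rmorphM.
have Zww : Z (1 - w * w) by apply: (cstarB hZ) => //; exact: cstarM.
have [b [Zb nb sq _ sb]] := cstar_sqrt hZ Zww (opnorm_1_sub_sqr sw w1).
have {}sb : adj b = b by apply: sb; rewrite adjB adjM adj_one sw.
pose u : bop H := 1 - b.
have Zu : Z u by exact: cstarB.
have mu m : character_space Z m -> m u = `|complex.Re (m w)|%:C.
  move=> hm.
  have mb0 : complex.Im (m b) = 0 by exact: (character_selfadjoint hZ hZ1 hm).
  have mb1 := le_trans (character_le hZ hZ1 hm Zb) nb.
  have E : m u * m u = m w * m w.
    by rewrite -!(characterM hm) // /u sq opprB addrC subrK.
  have mub : m u = (1 - complex.Re (m b))%:C.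
    rewrite (characterB hZ hm) // (character1 hZ1 hm) // {1}(real_complexE mb0).
    by rewrite -rmorphB.
  have b1 : 0 <= 1 - complex.Re (m b).
    by have := le_trans (normr_Re_le _) mb1; rewrite ler_norml => /andP[_]; lra.
  rewrite mub; congr _%:C.
  move: E; rewrite mub mw // -!rmorphM => /complexI /= E.
  apply/eqP; rewrite -(@eqrXn2 _ 2) // ?normr_ge0 //.
  by rewrite real_normK ?num_real // !expr2 E.
pose z0 : bop H := u + w.
have Zz0 : Z z0 by exact: cstarD.
have mz0 m : character_space Z m ->
    m z0 = (`|complex.Re (m w)| + complex.Re (m w))%:C.
  move=> hm; rewrite (characterD hm) // mu // rmorphD; congr (_ + _).
  by rewrite mw.
have m0z0 : m0 z0 != 0.
  rewrite mz0 // mw //= m0y subr0 gtr0_norm ?mulr_gt0 //.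
  by rewrite -cmod_eq0 cmodr normr_eq0 gt_eqF // addr_gt0 // mulr_gt0.
have z00 : 0 < opnorm z0.
  rewrite lt_def opnorm_ge0 andbT; apply: contraNneq m0z0 => /opnorm_eq0 ->.
  by rewrite (character0 hZ Xm0).
have mz m : character_space Z m -> m ((opnorm z0)^-1%:C *: z0) = 
   ((opnorm z0)^-1 * (`|complex.Re (m w)| + complex.Re (m w)))%:C.
  by move=> hm; rewrite (characterZ hZ hm) // mz0 // -rmorphM.
exists ((opnorm z0)^-1%:C *: z0); split; first exact: cstarZ.
split=> [m hm|].
  have := character_le hZ hZ1 hm (cstarZ hZ (opnorm z0)^-1%:C Zz0).
  rewrite opnormZ_pos ?invr_gt0 // mulVf ?gt_eqF //.
  rewrite mz // cmodr => /(le_trans (ler_norm _)) le1.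
  rewrite !lecR le1 andbT mulr_ge0 ?invr_ge0 ?(ltW z00) //.
  by have := ler_norm (- complex.Re (m w)); rewrite normrN; lra.
split; first by rewrite opnormZ_pos ?invr_gt0 // mulVf ?gt_eqF.
move=> m cm; split; first exact: cm.1.
apply: (inV _ cm.1); apply: (@le_lt_trans _ _ k).
  apply: weak_closure_Re_le cm => {m}m /= [hm].
  apply: contraNle => lt; rewrite mz // mw //=.
  have neg : l * (k - complex.Re (m y)) < 0 by rewrite pmulr_rlt0 // subr_lt0.
  by rewrite ltr0_norm // addNr mulr0.
by rewrite ltr_pdivrMr // ltr_pMr ?exprn_gt0 // ltr1n.
Qed.

End Bump.

(** * Operators on direct sums *)

Section DirectSumOperators.
Variables (R : realType) (I : choiceType) (E : I -> hilbertType R).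
Implicit Types (x y : dsum E).

Lemma dsumDE x y i : (x + y) i = x i + y i. Proof. by []. Qed.
Lemma dsumZE (c : R[i]) x i : (c *: x) i = c *: x i. Proof. by []. Qed.
Lemma dsum_sumE (J : Type) (s : seq J) (P : pred J) (F : J -> dsum E) i :
  (\sum_(j <- s | P j) F j) i = \sum_(j <- s | P j) F j i.
Proof. by elim/big_rec2: _ => [|j a b _ <-]. Qed.

Lemma dsum_hnorm_sqr x : hnorm x ^+ 2 = nsum (fun i => hnorm (x i) ^+ 2).
Proof. exact: dsum_norm_sqr. Qed.

Lemma dsum_hnorm_fset x (s : {fset I}) :
  \sum_(i <- s) hnorm (x i) ^+ 2 <= hnorm x ^+ 2.
Proof.
by rewrite dsum_hnorm_sqr; apply: nsum_ge => [i|]; [exact: sqr_ge0|exact: dsumP].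
Qed.

Lemma dsum_hnorm_coord x i : hnorm (x i) <= hnorm x.
Proof. exact: dsum_coord_norm. Qed.

Lemma dsum_hnorm_le x (M : R) :
  (forall s : {fset I}, \sum_(i <- s) hnorm (x i) ^+ 2 <= M) -> hnorm x ^+ 2 <= M.
Proof.
move=> h; rewrite dsum_hnorm_sqr.
by have [] := asummable_bound (fun i => sqr_ge0 (hnorm (x i))) h.
Qed.

Lemma dsum_make (F : forall i, E i) (M : R) :
  (forall s : {fset I}, \sum_(i <- s) hnorm (F i) ^+ 2 <= M) ->
  exists2 x : dsum E, forall i, x i = F i & hnorm x ^+ 2 <= M.
Proof.
move=> h; have [sF _] := asummable_bound (fun i => sqr_ge0 (hnorm (F i))) h.
by exists (DSum sF) => //; exact: dsum_hnorm_le.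
Qed.

Lemma dsum_op_exists (F : (forall i, E i) -> forall i, E i) (M : R) :
  0 <= M ->
  (forall (c : R[i]) x y i, F (c *: x + y) i = c *: F x i + F y i) ->
  (forall x (s : {fset I}),
     \sum_(i <- s) hnorm (F x i) ^+ 2 <= M ^+ 2 * hnorm x ^+ 2) ->
  exists T : bop (dsum E), (forall x i, T x i = F x i) /\ opnorm T <= M.
Proof.
move=> M0 Flin Fbd.
have ex x : exists y : dsum E, (forall i, y i = F x i) /\ hnorm y <= M * hnorm x.
  have [y hy ny] := dsum_make (Fbd x); exists y; split => //.
  by rewrite -(@ler_pXn2r _ 2) ?nnegrE ?mulr_ge0 ?hnorm_ge0 // exprMn.
have [T hT] := choice ex.
have T_lin (c : R[i]) x y : T (c *: x + y) = c *: T x + T y.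
  by apply: dsum_eqP => i; rewrite (hT _).1 Flin dsumDE dsumZE !(hT _).1.
have T_bd x : hnorm (T x) <= M * hnorm x by exact: (hT x).2.
exists (BOp (conj T_lin (ex_intro _ M T_bd))); split => [x i|]; first exact: (hT x).1.
exact: opnorm_le.
Qed.

Lemma family_opP (F : (forall i, E i) -> forall i, E i) (T : bop (dsum E)) :
  (forall x i, T x i = F x i) -> family_op F = T.
Proof.
move=> hT; have := xgetI 0 (hT : [set T : bop (dsum E) | forall x i, T x i = F x i] T).
move=> h; apply: bop_eqP => x; apply: dsum_eqP => i.
by rewrite hT; exact: h.
Qed.

Lemma diag_op_exists (D : forall i, bop (E i)) (M : R) : 0 <= M ->
  (forall i, opnorm (D i) <= M) ->
  exists T : bop (dsum E), (forall x i, T x i = D i (x i)) /\ opnorm T <= M.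
Proof.
move=> M0 hD.
have [||T hT] := @dsum_op_exists (fun (f : forall i, E i) i => D i (f i)) M M0;
  last by exists T.
  by move=> c x y i; rewrite dsumDE dsumZE (bopP (D i)).1.
move=> x s; apply: le_trans (ler_wpM2l _ (dsum_hnorm_fset x s)); rewrite ?sqr_ge0 //.
rewrite mulr_sumr; apply: ler_sum => i _.
rewrite -exprMn ler_pXn2r ?nnegrE ?mulr_ge0 ?hnorm_ge0 //.
exact: opnorm_bound.
Qed.

Lemma dsum_delta_exists i (y : E i) : exists x : dsum E,
  [/\ x i = y, forall j, j != i -> x j = 0 & hnorm x <= hnorm y].
Proof.
have h (s : {fset I}) :
    \sum_(j <- s) hnorm (dfwith (fun j => 0 : E j) i y j) ^+ 2 <= hnorm y ^+ 2.
  have [si|si] := boolP (i \in s); last first.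
    rewrite big_seq big1 ?sqr_ge0 // => j js; rewrite dfwithout ?hnorm_zero ?expr0n //.
    by apply: contraNneq si => ->.
  rewrite (big_rem i si) /= dfwithin big_seq big1 ?addr0 // => j.
  rewrite mem_rem_uniq ?fset_uniq // inE => /andP[ji _].
  by rewrite dfwithout ?hnorm_zero ?expr0n // eq_sym.
have [x hx nx] := dsum_make h; exists x; split.
- by rewrite hx dfwithin.
- by move=> j ji; rewrite hx dfwithout // eq_sym.
- by rewrite -(@ler_pXn2r _ 2) ?nnegrE ?hnorm_ge0.
Qed.

End DirectSumOperators.

(** * The representation along one orbit *)

(** The substitution [s = g q^-1]; the two hypotheses say that the terms that only one
    side contains are zero. *)
Lemma reindex_quotient (V : nmodType) (G : groupType) (F r : {fset G}) (g : G)
    (Q : G -> V) :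
  (forall s, s \notin r -> Q s = 0) ->
  (forall s, (s^-1 * g)%g \notin F -> Q s = 0) ->
  \sum_(q <- F) Q (g * q^-1)%g = \sum_(s <- r) Q s.
Proof.
move=> Qr QF; pose X := [fset (g * q^-1)%g | q in F]%fset.
transitivity (\sum_(s <- X) Q s).
  by rewrite big_imfset //= => a b _ _ /mulgI /invg_inj.
have QX s : s \notin X -> Q s = 0.
  move=> sX; apply: QF; apply: contraNN sX => sF.
  by apply/imfsetP; exists (s^-1 * g)%g => //=; rewrite invgM invgK mulgA mulgV mul1g.
transitivity (\sum_(s <- (X `|` r)%fset) Q s).
  by apply: big_fset_incl => [|s _ /QX]; [exact: fsubsetUl|].
by apply/esym/big_fset_incl => [|s _ /Qr]; [exact: fsubsetUr|].
Qed.

Section FiniteSupport.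
Variables (R : realType) (H : hilbertType R) (G : groupType).

Definition fsupp (c : G -> bop H) : {fset G} := fset_set [set g | c g != 0].

Lemma fsuppP (A : set (bop H)) c g : fin_supp A c -> g \notin fsupp c -> c g = 0.
Proof.
move=> [_ fc]; rewrite in_fset_set // => /negP h.
by apply/eqP/negPn/negP => cg; apply: h; rewrite inE.
Qed.

Lemma fin_supp_fset (A : set (bop H)) (r : {fset G}) (c : G -> bop H) :
  (forall g, A (c g)) -> (forall g, g \notin r -> c g = 0) -> fin_supp A c.
Proof.
move=> Ac cr; split => //; apply: (@sub_finite_set _ _ [set` r]).
  by move=> g /= cg; apply: contraNT cg => /cr ->.
exact: finite_fset.
Qed.

Lemma B0_sumE (U : G -> bop H) (c : G -> bop H) (r : {fset G}) :
  (forall g, g \notin r -> c g = 0) -> B0_sum U c = \sum_(g <- r) c g * U g.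
Proof. by move=> h; apply: fsbigTE => g /h ->; rewrite mul0r. Qed.

End FiniteSupport.

Section Trajectory.
Variables (R : realType) (H : hilbertType R) (A : set (bop H)).
Variables (G : groupType) (U : G -> bop H).
Hypothesis hA : cstar_subalgebra A.
Hypothesis hA1 : A 1.
Hypothesis hU : unitary_rep U.
Hypothesis hconj : forall g a, A a -> A (conj_action U g a).

Lemma unitary_rep1 (L : hilbertType R) (W : G -> bop L) : unitary_rep W -> W 1%g = 1.
Proof.
move=> [WM Wu]; have [h _] := Wu 1%g.
by rewrite -[LHS]mul1r -h -mulrA -WM mulg1 h.
Qed.

Lemma unitary_repV (L : hilbertType R) (W : G -> bop L) g : unitary_rep W ->
  W g^-1%g = adj (W g).
Proof.
move=> hW; have [WM Wu] := hW; have [h _] := Wu g.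
by rewrite -[LHS]mul1r -h -mulrA -WM mulgV unitary_rep1 // mulr1.
Qed.

Lemma unitary_hnorm (L : hilbertType R) (W : G -> bop L) g x : unitary_rep W ->
  hnorm (W g x) = hnorm x.
Proof.
move=> hW; apply/eqP; rewrite -(@eqrXn2 _ 2) ?hnorm_ge0 // hnorm_sqr_adj.
by rewrite (hW.2 g).1 bop1E -hnorm_sqr.
Qed.

Lemma opnorm_unitary (L : hilbertType R) (W : G -> bop L) g : unitary_rep W ->
  opnorm (W g) <= 1.
Proof. by move=> hW; apply: opnorm_le => // x; rewrite unitary_hnorm // mul1r. Qed.

Lemma conj_actionM g h a :
  conj_action U (g * h)%g a = conj_action U g (conj_action U h a).
Proof. by rewrite /conj_action hU.1 adjM !mulrA. Qed.

Lemma conj_action_mul g a b :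
  conj_action U g (a * b) = conj_action U g a * conj_action U g b.
Proof.
rewrite /conj_action !mulrA; congr (_ * _ * _).
by rewrite -[in RHS]mulrA (hU.2 g).1 mulr1.
Qed.

Lemma conj_action_adj g a : conj_action U g (adj a) = adj (conj_action U g a).
Proof. by rewrite /conj_action !adjM adjK mulrA. Qed.

Lemma conj_action0 g : conj_action U g 0 = 0.
Proof. by rewrite /conj_action mulr0 mul0r. Qed.

Lemma conj_action_norm g a : opnorm (conj_action U g a) <= opnorm a.
Proof.
apply: le_trans (opnormM _ _) _; rewrite opnorm_adj.
have U1 := opnorm_unitary g hU.
apply: le_trans (ler_wpM2l (opnorm_ge0 _) U1) _; rewrite mulr1.
apply: le_trans (opnormM _ _) _.
by apply: le_trans (ler_wpM2r (opnorm_ge0 _) U1) _; rewrite mul1r.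
Qed.

Section OneOrbit.
Variables (K : hilbertType R) (pi' : bop H -> bop K).
Hypothesis hpi : star_hom A pi'.
Hypothesis hpi1 : pi' 1 = 1.

Lemma traj_algP a : A a ->
  (forall xi t, traj_alg U pi' a xi t = pi' (conj_action U t^-1%g a) (xi t)) /\
  opnorm (traj_alg U pi' a) <= opnorm a.
Proof.
move=> Aa.
have [t|T [hT nT]] := @diag_op_exists R G (fun=> K)
   (fun t => pi' (conj_action U t^-1%g a)) _ (opnorm_ge0 a).
  apply: le_trans (star_hom_contractive hA hA1 hpi hpi1 _) (conj_action_norm _ _).
  exact: hconj.
suff -> : traj_alg U pi' a = T by [].
exact: family_opP.
Qed.

Lemma traj_shiftP (g : G) :
  (forall xi t, traj_shift K g xi t = xi (g^-1 * t)%g) /\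
  opnorm (traj_shift K g) <= 1.
Proof.
have [||T [hT nT]] := @dsum_op_exists R G (fun=> K)
    (fun xi t => xi (g^-1 * t)%g) 1 ler01.
- by move=> c x y t.
- move=> x s; rewrite expr1n mul1r.
  apply: le_trans (dsum_hnorm_fset x [fset (g^-1 * t)%g | t in s]%fset).
  by rewrite big_imfset //= => t t' _ _ /mulgI.
suff -> : traj_shift K g = T by [].
exact: family_opP.
Qed.

Lemma traj_alg0 : traj_alg U pi' 0 = 0.
Proof.
apply: bop_eqP => xi; apply: dsum_eqP => t.
by rewrite (traj_algP (cstar0 hA)).1 conj_action0 (star_hom0 hA hpi).
Qed.

Lemma traj_sumP c (r : {fset G}) : fin_supp A c -> (forall g, g \notin r -> c g = 0) ->
  (forall xi t, traj_sum U pi' c xi t =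
     \sum_(g <- r) pi' (conj_action U t^-1%g (c g)) (xi (g^-1 * t)%g)) /\
  opnorm (traj_sum U pi' c) <= \sum_(g <- r) opnorm (c g).
Proof.
move=> fc cr; have Ac := fc.1.
have E : traj_sum U pi' c = \sum_(g <- r) traj_alg U pi' (c g) * traj_shift K g.
  by apply: fsbigTE => g /cr ->; rewrite traj_alg0 mul0r.
rewrite E; split => [xi t|].
  rewrite bop_sumE dsum_sumE; apply: eq_bigr => g _.
  by rewrite bopME (traj_algP (Ac g)).1 (traj_shiftP g).1.
apply: le_trans (opnorm_sum _ _ _) _; apply: ler_sum => g _.
apply: le_trans (opnormM _ _) _; rewrite -[leRHS]mulr1.
apply: ler_pM; [exact: opnorm_ge0|exact: opnorm_ge0|exact: (traj_algP (Ac g)).2|].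
exact: (traj_shiftP g).2.
Qed.

Hypothesis hwd : traj_well_defined A U pi'.

(** Well-definedness: the coefficients that the choice operator picks are irrelevant. *)
Lemma traj_repE c : fin_supp A c -> traj_rep A U pi' (B0_sum U c) = traj_sum U pi' c.
Proof.
move=> fc; rewrite /traj_rep.
have : [set T | exists2 c', fin_supp A c' &
    B0_sum U c = B0_sum U c' /\ T = traj_sum U pi' c']
   (traj_sum U pi' c) by exists c.
by move=> /(xgetI 0)[d fd [Bcd ->]]; exact: hwd.
Qed.

End OneOrbit.

End Trajectory.

(** * The local trajectories representation *)

Section NsumFinite.
Variables (R : realType) (I : choiceType).

Lemma nsum_le (f g : I -> R) : (forall i, 0 <= f i) -> (forall i, f i <= g i) ->
  asummable g -> nsum f <= nsum g.
Proof.
move=> f0 fg sg; have g0 i : 0 <= g i := le_trans (f0 i) (fg i).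
apply: (asummable_bound f0 _).2 => s.
by apply: le_trans (nsum_ge s g0 sg); apply: ler_sum => i _.
Qed.

Lemma asummable0 : asummable (fun _ : I => 0 : R).
Proof. by apply: (@asummable_bound _ _ _ 0 _ _).1 => // s; rewrite big1. Qed.

Lemma nsum0 : nsum (fun _ : I => 0 : R) = 0.
Proof.
apply/eqP; rewrite eq_le nsum_ge0 // andbT.
by apply: (@asummable_bound _ _ _ 0 _ _).2 => // s; rewrite big1.
Qed.

Lemma nsum_sum (J : Type) (s : seq J) (f : J -> I -> R) :
  (forall j i, 0 <= f j i) -> (forall j, asummable (f j)) ->
  asummable (fun i => \sum_(j <- s) f j i) /\
  nsum (fun i => \sum_(j <- s) f j i) = \sum_(j <- s) nsum (f j).
Proof.
move=> f0 sf; elim: s => [|j s [IHs IHn]].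
  rewrite big_nil; under eq_fun do rewrite big_nil.
  by split; [exact: asummable0|exact: nsum0].
rewrite big_cons; under eq_fun do rewrite big_cons.
split; first exact: asummableD.
by rewrite nsumD ?IHn // => i; apply: sumr_ge0.
Qed.

Lemma fset_sum_le (X Y : {fset I}) (f : I -> R) : (X `<=` Y)%fset ->
  (forall i, 0 <= f i) -> \sum_(i <- X) f i <= \sum_(i <- Y) f i.
Proof.
move=> XY f0.
have -> : \sum_(i <- X) f i = \sum_(i <- Y) (if i \in X then f i else 0).
  rewrite -(big_fset_incl _ XY) => [|i _ /negbTE -> //].
  by rewrite big_seq [RHS]big_seq; apply: eq_bigr => i ->.
by apply: ler_sum => i _; case: ifP.
Qed.

Lemma dsum_sum_le (E E' : I -> hilbertType R) (J : Type) (s : seq J)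
  (x : J -> dsum E) (y : J -> dsum E') (M : R) : 0 <= M ->
  (forall i, \sum_(j <- s) hnorm (x j i) ^+ 2 <=
             M * \sum_(j <- s) hnorm (y j i) ^+ 2) ->
  \sum_(j <- s) hnorm (x j) ^+ 2 <= M * \sum_(j <- s) hnorm (y j) ^+ 2.
Proof.
move=> M0 h.
have E1 : \sum_(j <- s) hnorm (x j) ^+ 2 =
    nsum (fun i => \sum_(j <- s) hnorm (x j i) ^+ 2).
  rewrite (nsum_sum s (fun j i => sqr_ge0 (hnorm (x j i))) (fun j => dsumP (x j))).2.
  by apply: eq_bigr => j _; exact: dsum_hnorm_sqr.
have [sy E2] := nsum_sum s (fun j i => sqr_ge0 (hnorm (y j i))) (fun j => dsumP (y j)).
have -> : \sum_(j <- s) hnorm (y j) ^+ 2 =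
    nsum (fun i => \sum_(j <- s) hnorm (y j i) ^+ 2).
  by rewrite E2; apply: eq_bigr => j _; exact: dsum_hnorm_sqr.
rewrite E1 -nsumZ //; last by move=> i; apply: sumr_ge0 => j _; exact: sqr_ge0.
apply: nsum_le => //; last exact: asummableZ.
by move=> i; apply: sumr_ge0 => j _; exact: sqr_ge0.
Qed.

Lemma dsum_hnorm_le_coord (E E' : I -> hilbertType R) (x : dsum E) (y : dsum E')
  (M : R) : 0 <= M -> (forall i, hnorm (x i) <= M * hnorm (y i)) ->
  hnorm x <= M * hnorm y.
Proof.
move=> M0 h; rewrite -(@ler_pXn2r _ 2) ?nnegrE ?mulr_ge0 ?hnorm_ge0 // exprMn.
have := @dsum_sum_le E E' unit [:: tt] (fun=> x) (fun=> y) (M ^+ 2) (sqr_ge0 M).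
rewrite !big_seq1; apply => i; rewrite !big_seq1 -exprMn.
by rewrite ler_pXn2r ?nnegrE ?mulr_ge0 ?hnorm_ge0.
Qed.

Lemma dsum_inner_eq (E : I -> hilbertType R) (x y x' y' : dsum E) :
  (forall i, inner (x i) (y i) = inner (x' i) (y' i)) -> inner x y = inner x' y'.
Proof.
move=> h; rewrite -[LHS]/(dsum_inner x y) -[RHS]/(dsum_inner x' y') /dsum_inner.
by congr (_ +i* _); congr rsum; apply/funext => i; rewrite h.
Qed.

End NsumFinite.

Section Isometry.
Variables (R : realType) (H : hilbertType R).
(** Polarisation at [x + T x]. *)
Lemma selfadjoint_form_eq0 (T : bop H) : adj T = T ->
  (forall x, complex.Re (inner (T x) x) = 0) -> T = 0.
Proof.
move=> sT h; apply: bop_eqP => x; apply: hnorm_eq0; apply/eqP; rewrite -sqrf_eq0.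
rewrite hnorm_sqr; have := h (x + T x).
rewrite bop_appD innerDl !innerDr !ReD !h.
have -> : inner (T (T x)) x = inner (T x) (T x) by rewrite -{1}sT inner_adjl.
by rewrite add0r addr0 => /eqP; rewrite -mulr2n mulrn_eq0.
Qed.

(** Two mutually inverse contractions are isometric. *)
Lemma contraction_inverse_unitary (V V' : bop H) : opnorm V <= 1 -> opnorm V' <= 1 ->
  V * V' = 1 -> V' * V = 1 -> adj V * V = 1 /\ V * adj V = 1.
Proof.
move=> nV nV' VV' V'V.
have iso x : hnorm (V x) = hnorm x.
  apply/eqP; rewrite eq_le; apply/andP; split.
    by have := opnorm_bound x nV; rewrite mul1r.
  by have := opnorm_bound (V x) nV'; rewrite -bopME V'V mul1r.
have E : adj V * V = 1.
  apply/eqP; rewrite -subr_eq0; apply/eqP/selfadjoint_form_eq0.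
    by rewrite adjB adjM adjK adj_one.
  by move=> x; rewrite bopBE innerBl ReB -hnorm_sqr_adj -hnorm_sqr iso subrr.
split=> //.
by rewrite -[adj V]mulr1 -VV' [adj V * _]mulrA E mul1r.
Qed.
End Isometry.

Section TotalRep.
Variables (R : realType) (H : hilbertType R) (A : set (bop H)).
Variables (G : groupType) (U : G -> bop H).
Hypothesis hA : cstar_subalgebra A.
Hypothesis hA1 : A 1.
Hypothesis hU : unitary_rep U.
Hypothesis hconj : forall g a, A a -> A (conj_action U g a).
Variables (W : choiceType) (K : W -> hilbertType R) (p : forall w, bop H -> bop (K w)).
Hypothesis hp : forall w, star_hom A (p w).
Hypothesis hp1 : forall w, p w 1 = 1.
Hypothesis hwd : forall w, traj_well_defined A U (p w).

Definition total_rep (b : bop H) : bop (dsum (fun w => ell2 G (K w))) :=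
  dsum_op (fun w => traj_rep A U (p w) b).

Lemma total_repP c (r : {fset G}) : fin_supp A c -> (forall g, g \notin r -> c g = 0) ->
  (forall x w t, total_rep (B0_sum U c) x w t =
     \sum_(g <- r) p w (conj_action U t^-1%g (c g)) (x w (g^-1 * t)%g)) /\
  opnorm (total_rep (B0_sum U c)) <= \sum_(g <- r) opnorm (c g).
Proof.
move=> fc cr; set M := \sum_(g <- r) _.
have M0 : 0 <= M by apply: sumr_ge0 => g _; exact: opnorm_ge0.
have sumP w := traj_sumP hA hA1 hU hconj (hp w) (hp1 w) fc cr.
have [w|T [hT nT]] := @diag_op_exists R W (fun w => ell2 G (K w))
   (fun w => traj_rep A U (p w) (B0_sum U c)) M M0.
  by rewrite (traj_repE (hwd w) fc); exact: (sumP w).2.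
have -> : total_rep (B0_sum U c) = T by exact: family_opP.
split=> // x w t.
by rewrite hT (traj_repE (hwd w) fc) (sumP w).1.
Qed.

Definition single g (a : bop H) : G -> bop H := fun h => if h == g then a else 0.

Lemma single_supp g a : A a -> fin_supp A (single g a) /\
  (forall h, h \notin [fset g]%fset -> single g a h = 0).
Proof.
move=> Aa; have h0 h : h \notin [fset g]%fset -> single g a h = 0.
  by rewrite in_fset1 /single; case: eqP.
split=> //; apply: fin_supp_fset h0 => h; rewrite /single.
by case: eqP => // _; exact: cstar0.
Qed.

Lemma B0_single g a : A a -> B0_sum U (single g a) = a * U g.
Proof.
move=> Aa; rewrite (B0_sumE _ (single_supp g Aa).2) big_seq_fset1.
by rewrite /single eqxx.
Qed.

(** The algebra and the unitaries are both covered: take [g = 1] or [a = 1]. *)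
Lemma total_rep_single g a : A a ->
  (forall x w t, total_rep (a * U g) x w t =
     p w (conj_action U t^-1%g a) (x w (g^-1 * t)%g)) /\
  opnorm (total_rep (a * U g)) <= opnorm a.
Proof.
move=> Aa; have [fs s0] := single_supp g Aa.
have [h1 h2] := total_repP fs s0; rewrite B0_single // in h1 h2.
split=> [x w t|]; first by rewrite h1 big_seq_fset1 /single eqxx.
by apply: le_trans h2 _; rewrite big_seq_fset1 /single eqxx.
Qed.

Lemma total_rep_alg a : A a -> forall x w t,
  total_rep a x w t = p w (conj_action U t^-1%g a) (x w t).
Proof.
move=> Aa x w t; have := (total_rep_single 1%g Aa).1 x w t.
by rewrite (unitary_rep1 hU) mulr1 invg1 mul1g.
Qed.

Lemma total_rep_shift g x w t : total_rep (U g) x w t = x w (g^-1 * t)%g.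
Proof.
have := (total_rep_single g hA1).1 x w t; rewrite mul1r => ->.
by rewrite /conj_action mulr1 (hU.2 _).2 hp1.
Qed.

Lemma total_rep_eqP (S T : bop (dsum (fun w => ell2 G (K w)))) :
  (forall x w t, S x w t = T x w t) -> S = T.
Proof.
by move=> h; apply: bop_eqP => x; apply: dsum_eqP => w; apply: dsum_eqP => t.
Qed.

Lemma total_rep_star_hom : star_hom A total_rep.
Proof.
have cD g (c : R[i]) a b : conj_action U g (c *: a + b) =
    c *: conj_action U g a + conj_action U g b.
  by rewrite /conj_action mulrDr mulrDl bopZr bopZl.
split=> [c a b Aa Ab|].
  apply: total_rep_eqP => x w t; rewrite total_rep_alg ?cD; last first.
    by apply: (cstarD hA) => //; exact: cstarZ.
  rewrite (star_homP (hp w)) //; try exact: hconj.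
  by rewrite bopDE bopZE -!total_rep_alg.
split=> [a b Aa Ab|a Aa].
  apply: total_rep_eqP => x w t.
  rewrite total_rep_alg ?conj_action_mul //; last exact: cstarM.
  rewrite (star_homM (hp w)) //; try exact: hconj.
  by rewrite bopME -!total_rep_alg.
apply/esym/adj_unique => x y; apply: dsum_inner_eq => w; apply: dsum_inner_eq => t.
rewrite !total_rep_alg //; last exact: cstar_adj.
by rewrite conj_action_adj (star_hom_adj (hp w)) ?inner_adjr //; exact: hconj.
Qed.

Lemma total_rep1 : total_rep 1 = 1.
Proof.
apply: total_rep_eqP => x w t; rewrite total_rep_alg //.
by rewrite /conj_action mulr1 (hU.2 _).2 hp1.
Qed.

Lemma total_rep_unitary : unitary_rep (fun g => total_rep (U g)).
Proof.
have UM g h : total_rep (U (g * h)%g) = total_rep (U g) * total_rep (U h).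
  by apply: total_rep_eqP => x w t; rewrite bopME !total_rep_shift invgM mulgA.
split=> // g.
have n1 h : opnorm (total_rep (U h)) <= 1.
  have := (total_rep_single h hA1).2; rewrite mul1r => /le_trans; apply.
  exact: opnorm1.
apply: (contraction_inverse_unitary (n1 g) (n1 g^-1%g)).
  by rewrite -UM mulgV (unitary_rep1 hU) total_rep1.
by rewrite -UM mulVg (unitary_rep1 hU) total_rep1.
Qed.

Lemma total_rep_covariant g a : A a ->
  total_rep (conj_action U g a) =
  conj_action (fun g => total_rep (U g)) g (total_rep a).
Proof.
move=> Aa; have [_ UV] := total_rep_unitary.2 g.
suff E : total_rep (conj_action U g a) * total_rep (U g) =
    total_rep (U g) * total_rep a.
  by rewrite [RHS]/conj_action -E -mulrA UV mulr1.
apply: total_rep_eqP => x w t; rewrite !bopME total_rep_shift.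
rewrite (total_rep_alg (hconj g Aa)) (total_rep_alg Aa) total_rep_shift.
by rewrite -(conj_actionM hU) invgM invgK.
Qed.

Lemma total_rep_sum c (r : {fset G}) : fin_supp A c ->
  (forall g, g \notin r -> c g = 0) ->
  total_rep (B0_sum U c) = \sum_(g <- r) total_rep (c g) * total_rep (U g).
Proof.
move=> fc cr; apply: total_rep_eqP => x w t; rewrite (total_repP fc cr).1.
rewrite bop_sumE !dsum_sumE; apply: eq_bigr => g _.
by rewrite bopME (total_rep_alg (fc.1 g)) total_rep_shift.
Qed.

(** On a vector supported at the coordinate [(w, t)], the right-hand operator returns at
    [(w, t)] the contribution of [c 1] alone, since the other terms read different
    coordinates. *)
Lemma total_rep_diagonal z c : A z -> fin_supp A c ->
  opnorm (total_rep z * total_rep (c 1%g)) <=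
  opnorm (total_rep z * total_rep (B0_sum U c)).
Proof.
move=> Az fc; have Ac := fc.1; set T := (X in _ <= opnorm X).
apply: opnorm_le => [|x]; first exact: opnorm_ge0.
apply: dsum_hnorm_le_coord => [|w]; first exact: opnorm_ge0.
apply: dsum_hnorm_le_coord => [|t]; first exact: opnorm_ge0.
have [u [ut u0 nu]] := @dsum_delta_exists R G (fun=> K w) t (x w t).
have [v [vw v0 nv]] := @dsum_delta_exists R W (fun w => ell2 G (K w)) w u.
have E : (total_rep z * total_rep (c 1%g)) x w t = T v w t.
  rewrite /T !bopME !(total_rep_alg Az) (total_rep_alg (Ac _)); congr (p w _ _).
  pose r : {fset G} := (1%g |` fsupp c)%fset.
  have cr g : g \notin r -> c g = 0.
    by rewrite in_fset1U negb_or => /andP[_]; exact: (fsuppP fc).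
  rewrite (total_repP fc cr).1 (big_rem 1%g) ?fset1U1 //= invg1 mul1g vw ut.
  rewrite big_seq big1 ?addr0 // => g.
  rewrite mem_rem_uniq ?fset_uniq // inE => /andP[g1 _].
  rewrite u0 ?bop_app0 //; apply: contraNneq g1 => gt.
  by apply/eqP/invg_inj; rewrite invg1 -[LHS](mulgK t) gt mulgV.
rewrite E; apply: le_trans (dsum_hnorm_coord _ _) _.
apply: le_trans (dsum_hnorm_coord _ _) _; apply: le_trans (opnormP _ _) _.
by rewrite ler_wpM2l ?opnorm_ge0 // (le_trans nv).
Qed.

(** At a coordinate [(w, r)] the matrix with entries [alpha_s^-1 (c (s q^-1))] is the
    compression of the image of [B0_sum U c] to the coordinates [(w, s r)] with [s]
    in [F]. *)
Lemma total_rep_matrix c (F : {fset G}) (h : G -> dsum (fun w => ell2 G (K w))) :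
  fin_supp A c ->
  \sum_(s <- F) hnorm
    (\sum_(q <- F) total_rep (conj_action U s^-1%g (c (s * q^-1)%g)) (h q)) ^+ 2
  <= opnorm (total_rep (B0_sum U c)) ^+ 2 * \sum_(s <- F) hnorm (h s) ^+ 2.
Proof.
move=> fc; set T := total_rep (B0_sum U c).
apply: dsum_sum_le => [|w]; first exact: sqr_ge0.
apply: dsum_sum_le => [|r]; first exact: sqr_ge0.
(* The entries [h s w r], placed at the distinct points [s r] of one vector. *)
pose f t := if (t * r^-1)%g \in F then h (t * r^-1)%g w r else 0.
have fr s : s \in F -> f (s * r)%g = h s w r by rewrite /f mulgK => ->.
have f0 t : (t * r^-1)%g \notin F -> f t = 0 by rewrite /f => /negbTE ->.
have hf (s : {fset G}) :
    \sum_(t <- s) hnorm (f t) ^+ 2 <= \sum_(q <- F) hnorm (h q w r) ^+ 2.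
  pose X := [fset (q * r)%g | q in F]%fset.
  have -> : \sum_(q <- F) hnorm (h q w r) ^+ 2 = \sum_(t <- X) hnorm (f t) ^+ 2.
    rewrite big_imfset /=; last by move=> a b _ _ /mulIg.
    by rewrite big_seq [RHS]big_seq; apply: eq_bigr => q qF; rewrite fr.
  have -> : \sum_(t <- X) hnorm (f t) ^+ 2 =
      \sum_(t <- (s `|` X)%fset) hnorm (f t) ^+ 2.
    apply: big_fset_incl; first exact: fsubsetUr.
    move=> t _ tX; rewrite f0 ?hnorm_zero ?expr0n //.
    apply: contraNN tX => tF; apply/imfsetP; exists (t * r^-1)%g => //.
    by rewrite mulgVK.
  by apply: fset_sum_le => [|t]; [exact: fsubsetUl|exact: sqr_ge0].
have [u hu nu] := dsum_make hf.
have [v [vw v0 nv]] := @dsum_delta_exists R W (fun w => ell2 G (K w)) w u.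
have key s : s \in F ->
    (\sum_(q <- F) total_rep (conj_action U s^-1%g (c (s * q^-1)%g)) (h q)) w r =
    T v w (s * r)%g.
  move=> sF; rewrite !dsum_sumE.
  under eq_bigr => q _ do
    rewrite (total_rep_alg (hconj _ (fc.1 _))) -(conj_actionM hU) -invgM.
  rewrite /T (total_repP fc (fun g => fsuppP fc (g := g))).1 vw.
  under [RHS]eq_bigr do rewrite hu.
  pose Q g := p w (conj_action U (s * r)^-1%g (c g)) (f (g^-1 * (s * r))%g).
  rewrite -[RHS]/(\sum_(g <- fsupp c) Q g) -(@reindex_quotient _ _ F (fsupp c) s Q).
  - rewrite big_seq [RHS]big_seq; apply: eq_bigr => q qF; rewrite /Q.
    have -> : ((s * q^-1)^-1 * (s * r) = q * r)%g.
      by rewrite invgM invgK mulgA mulgVK.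
    by rewrite fr.
  - by move=> g /(fsuppP fc) cg; rewrite /Q cg conj_action0 (star_hom0 hA (hp w)).
  - move=> g gF; rewrite /Q f0 ?bop_app0 //.
    by rewrite mulgA mulgK.
rewrite big_seq (eq_bigr (fun s => hnorm (T v w (s * r)%g) ^+ 2)); last first.
  by move=> s sF; rewrite key.
rewrite -big_seq.
have -> : \sum_(s <- F) hnorm (T v w (s * r)%g) ^+ 2 =
    \sum_(t <- [fset (s * r)%g | s in F]%fset) hnorm (T v w t) ^+ 2.
  by rewrite big_imfset //= => a b _ _ /mulIg.
apply: le_trans (dsum_hnorm_fset _ _) _.
apply: (@le_trans _ _ (hnorm (T v) ^+ 2)).
  by rewrite ler_pXn2r ?nnegrE ?hnorm_ge0 //; exact: dsum_hnorm_coord.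
apply: (@le_trans _ _ ((opnorm T * hnorm v) ^+ 2)).
  by rewrite ler_pXn2r ?nnegrE ?mulr_ge0 ?hnorm_ge0 ?opnorm_ge0 // opnormP.
rewrite exprMn ler_wpM2l ?sqr_ge0 //; apply: le_trans nu.
by rewrite ler_pXn2r ?nnegrE ?hnorm_ge0.
Qed.

End TotalRep.

(** * Matrices over a C*-algebra *)

Section FiniteDirectSum.
Variables (R : realType) (I : finType).

Lemma nsum_fin (f : I -> R) : (forall i, 0 <= f i) ->
  asummable f /\ nsum f = \sum_i f i.
Proof.
move=> f0.
have tot : \sum_i f i = \sum_(i <- [fset i | i : I]%fset) f i.
  by rewrite big_imfset //= big_enum.
have le (s : {fset I}) : \sum_(i <- s) f i <= \sum_i f i.
  rewrite tot; apply: fset_sum_le => //; apply/fsubsetP => i _.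
  by apply/imfsetP; exists i.
have [sf nf] := asummable_bound f0 le; split=> //; apply/eqP; rewrite eq_le nf /=.
by rewrite tot; exact: nsum_ge.
Qed.

Lemma rsum_fin (f : I -> R) : rsum f = \sum_i f i.
Proof.
rewrite /rsum; have [_ ->] := @nsum_fin f^\+ (funrpos_ge0 f).
have [_ ->] := @nsum_fin f^\- (funrneg_ge0 f).
by rewrite -sumrB; apply: eq_bigr => i _; rewrite -posnegE.
Qed.

Variable (H : hilbertType R).
Local Notation HI := (dsum (fun _ : I => H)).

Lemma fin_sq_summable (x : I -> H) : @sq_summable R I (fun=> H) x.
Proof. exact: (nsum_fin (fun i => sqr_ge0 (hnorm (x i)))).1. Qed.

Definition fvec (x : I -> H) : HI := DSum (fin_sq_summable x).
Definition delta (q : I) (y : H) : HI := fvec (fun i => if i == q then y else 0).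

Lemma deltaE q y i : delta q y i = if i == q then y else 0. Proof. by []. Qed.

Lemma fin_inner (x y : HI) : inner x y = \sum_i inner (x i) (y i).
Proof.
rewrite -[LHS]/(dsum_inner x y) /dsum_inner !rsum_fin.
apply/eqP; rewrite eq_complex /= !raddf_sum /=.
by rewrite !eqxx.
Qed.

Lemma fin_hnorm_sqr (x : HI) : hnorm x ^+ 2 = \sum_i hnorm (x i) ^+ 2.
Proof.
by rewrite dsum_hnorm_sqr (nsum_fin (fun i => sqr_ge0 (hnorm (x i)))).2.
Qed.

Lemma inner_delta (x : HI) q y : inner x (delta q y) = inner (x q) y.
Proof.
rewrite fin_inner (bigD1 q) //= eqxx big1 ?addr0 // => i /negbTE iq.
by rewrite /= iq inner0r.
Qed.

Lemma hnorm_delta q y : hnorm (delta q y) = hnorm y.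
Proof.
apply/eqP; rewrite -(@eqrXn2 _ 2) ?hnorm_ge0 // fin_hnorm_sqr (bigD1 q) //=.
rewrite big1 ?addr0 ?eqxx // => i /negbTE ->.
by rewrite hnorm_zero expr0n.
Qed.

Lemma deltaP q (c : R[i]) y z : delta q (c *: y + z) = c *: delta q y + delta q z.
Proof.
apply: dsum_eqP => i; rewrite dsumDE dsumZE !deltaE.
by case: eqP => // _; rewrite scaler0 addr0.
Qed.

Lemma delta_sum (x : HI) : x = \sum_q delta q (x q).
Proof.
apply: dsum_eqP => i; rewrite dsum_sumE (bigD1 i) //= eqxx big1 ?addr0 //.
by move=> j /negbTE; rewrite eq_sym => ->.
Qed.

Fact entry_subproof (T : bop HI) p q : bounded_linear (fun y => T (delta q y) p).
Proof.
split=> [c x y|]; first by rewrite deltaP (bopP T).1 dsumDE dsumZE.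
exists (opnorm T) => y; apply: le_trans (dsum_hnorm_coord _ _) _.
by rewrite -(hnorm_delta q); exact: opnormP.
Qed.
Definition entry (T : bop HI) p q : bop H := BOp (entry_subproof T p q).

Fact emb_subproof p q (a : bop H) : bounded_linear (fun x : HI => delta p (a (x q))).
Proof.
split=> [c x y|]; first by rewrite dsumDE dsumZE (bopP a).1 deltaP.
exists (opnorm a) => x; rewrite hnorm_delta; apply: le_trans (opnormP _ _) _.
by rewrite ler_wpM2l ?opnorm_ge0 ?dsum_hnorm_coord.
Qed.
Definition emb p q (a : bop H) : bop HI := BOp (emb_subproof p q a).
Definition mxop (N : I -> I -> bop H) : bop HI := \sum_p \sum_q emb p q (N p q).

Lemma mxopE N x p : mxop N x p = \sum_q N p q (x q).
Proof.
rewrite /mxop bop_sumE dsum_sumE (bigD1 p) //= bop_sumE dsum_sumE.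
rewrite [X in _ + X]big1 ?addr0 => [|i ip].
  by apply: eq_bigr => q _ /=; rewrite eqxx.
rewrite bop_sumE dsum_sumE big1 // => q _ /=.
by rewrite eq_sym (negbTE ip).
Qed.

Lemma entryE (T : bop HI) p q y : entry T p q y = T (delta q y) p. Proof. by []. Qed.

Lemma entry_mxop N p q : entry (mxop N) p q = N p q.
Proof.
apply: bop_eqP => y; rewrite entryE mxopE (bigD1 q) //= eqxx big1 ?addr0 //.
by move=> i /negbTE ->; rewrite bop_app0.
Qed.

Lemma bop_entryE (T : bop HI) x p : T x p = \sum_q entry T p q (x q).
Proof. by rewrite {1}(delta_sum x) bop_app_sum dsum_sumE. Qed.

Lemma entry_inj (S T : bop HI) : (forall p q, entry S p q = entry T p q) -> S = T.
Proof.
move=> h; apply: bop_eqP => x; apply: dsum_eqP => p.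
by rewrite !bop_entryE; apply: eq_bigr => q _; rewrite h.
Qed.

Lemma entry_lin (c : R[i]) (S T : bop HI) p q :
  entry (c *: S + T) p q = c *: entry S p q + entry T p q.
Proof. by apply: bop_eqP. Qed.

Lemma entryD (S T : bop HI) p q : entry (S + T) p q = entry S p q + entry T p q.
Proof. by apply: bop_eqP. Qed.
Lemma entryZ (c : R[i]) (T : bop HI) p q : entry (c *: T) p q = c *: entry T p q.
Proof. by apply: bop_eqP. Qed.
Lemma entry0 p q : entry 0 p q = 0.
Proof. by apply: bop_eqP. Qed.
Lemma entryB (S T : bop HI) p q : entry (S - T) p q = entry S p q - entry T p q.
Proof. by rewrite -scaleN1r entryD entryZ scaleN1r. Qed.

Lemma entry1 p q : entry 1 p q = if p == q then 1 else 0.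
Proof. by apply: bop_eqP => y; rewrite entryE bop1E deltaE; case: eqP. Qed.

Lemma entryM (S T : bop HI) p q : entry (S * T) p q = \sum_r entry S p r * entry T r q.
Proof.
apply: bop_eqP => y; rewrite entryE bopME bop_entryE bop_sumE.
by apply: eq_bigr.
Qed.

Lemma entry_adj (T : bop HI) p q : entry (adj T) p q = adj (entry T q p).
Proof.
apply/esym/adj_unique => x y.
by rewrite !entryE -(inner_delta _ q) -inner_adjr innerC inner_delta -innerC.
Qed.

Lemma opnorm_entry (T : bop HI) p q : opnorm (entry T p q) <= opnorm T.
Proof.
apply: opnorm_le => [|y]; first exact: opnorm_ge0.
rewrite entryE; apply: le_trans (dsum_hnorm_coord _ _) _.
by rewrite -(hnorm_delta q); exact: opnormP.
Qed.

Definition matrix_algebra (A : set (bop H)) : set (bop HI) :=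
  [set T | forall p q, A (entry T p q)].

(** Entries are dominated by the operator norm, so that norm limits may be taken entry
    by entry. *)
Lemma matrix_algebra_cstar A :
  cstar_subalgebra A -> cstar_subalgebra (matrix_algebra A).
Proof.
move=> hA; split=> [p q|]; first by rewrite entry0; exact: cstar0.
split=> [S T AS AT p q|]; first by rewrite entryD; apply: (cstarD hA).
split=> [c T AT p q|]; first by rewrite entryZ; apply: (cstarZ hA).
split=> [S T AS AT p q|].
  by rewrite entryM; apply: (cstar_sum hA) => r _; apply: (cstarM hA).
split=> [T AT p q|]; first by rewrite entry_adj; apply: (cstar_adj hA).
move=> T hT p q; apply: (cstar_closed hA) => e /hT[S AS lt].
exists (entry S p q) => //; rewrite -entryB.
exact: le_lt_trans (opnorm_entry _ _ _) lt.
Qed.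

End FiniteDirectSum.

Section Amplification.
Variables (R : realType) (I : finType) (H K : hilbertType R) (A : set (bop H)).
Hypothesis hA : cstar_subalgebra A.
Variable f : bop H -> bop K.
Hypothesis hf : star_hom A f.

Definition amplification (T : bop (dsum (fun _ : I => H))) :=
  mxop (fun p q => f (entry T p q)).

Lemma amplification_star_hom : star_hom (matrix_algebra A) amplification.
Proof.
split=> [c S T AS AT|].
  apply: entry_inj => p q; rewrite entry_lin !entry_mxop entry_lin.
  by rewrite (star_homP hf).
split=> [S T AS AT|T AT].
  apply: entry_inj => p q; rewrite entryM entry_mxop entryM (star_hom_sum hA hf).
    by apply: eq_bigr => r _; rewrite !entry_mxop (star_homM hf).
  by move=> r _; apply: (cstarM hA).
apply: entry_inj => p q; rewrite entry_adj !entry_mxop entry_adj.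
by rewrite (star_hom_adj hf).
Qed.

Lemma amplification1 : f 1 = 1 -> amplification 1 = 1.
Proof.
move=> f1; apply: entry_inj => p q; rewrite entry_mxop !entry1.
by case: eqP => // _; exact: (star_hom0 hA hf).
Qed.

End Amplification.

(** [star_hom_contractive_ker] for the amplifications to the matrix algebra. *)
Lemma matrix_contractive_ker (R : realType) (I : finType) (H K L : hilbertType R)
  (A : set (bop H)) (f : bop H -> bop K) (g : bop H -> bop L) (N : I -> I -> bop H) :
  cstar_subalgebra A -> A 1 -> star_hom A f -> star_hom A g -> f 1 = 1 -> g 1 = 1 ->
  (forall a, A a -> f a = 0 -> g a = 0) -> (forall p q, A (N p q)) ->
  opnorm (mxop (fun p q => g (N p q))) <= opnorm (mxop (fun p q => f (N p q))).
Proof.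
move=> hA A1 hf hg f1 g1 ker AN.
have AM : matrix_algebra A (mxop N) by move=> p q; rewrite entry_mxop.
have ampE (M : hilbertType R) (h : bop H -> bop M) :
    mxop (fun p q => h (N p q)) = amplification h (mxop N).
  by apply: entry_inj => p q; rewrite !entry_mxop.
rewrite !ampE.
apply: (@star_hom_contractive_ker R _ _ _ _ (matrix_algebra_cstar I hA) _
  (amplification f) (amplification g)) => //.
- by move=> p q; rewrite entry1; case: eqP => // _; exact: cstar0.
- exact: amplification_star_hom.
- exact: amplification_star_hom.
- exact: (amplification1 I hA hf).
- exact: (amplification1 I hA hg).
move=> T AT T0; apply: entry_inj => p q; rewrite entry_mxop entry0.
apply: ker => //; rewrite -(entry_mxop (fun p q => f (entry T p q))).
by rewrite -/(amplification f T) T0 entry0.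
Qed.

(** * Amenability and covariant representations *)

Section RowContraction.
Variables (R : realType) (L : hilbertType R) (J : Type).

Lemma sum_hnorm_sqr (s : seq J) (X : J -> bop L) y :
  \sum_(j <- s) hnorm (X j y) ^+ 2 =
  complex.Re (inner ((\sum_(j <- s) adj (X j) * X j) y) y).
Proof.
rewrite bop_sumE inner_suml raddf_sum /=; apply: eq_bigr => j _.
by rewrite hnorm_sqr_adj.
Qed.

(** For [y] the sum on the left, [|y|^2 = sum_j Re <k_j, X_j y>] is at most
    [(sum_j |k_j|^2 + sum_j |X_j y|^2) / 2], and [sum_j |X_j y|^2 = |y|^2]. *)
Lemma row_contraction (s : seq J) (X : J -> bop L) (k : J -> L) :
  (forall j, adj (X j) = X j) -> \sum_(j <- s) X j * X j = 1 ->
  hnorm (\sum_(j <- s) X j (k j)) ^+ 2 <= \sum_(j <- s) hnorm (k j) ^+ 2.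
Proof.
move=> sX X1; set y := \sum_(j <- s) X j (k j).
have E : \sum_(j <- s) hnorm (X j y) ^+ 2 = hnorm y ^+ 2.
  by rewrite sum_hnorm_sqr; under eq_bigr do rewrite sX; rewrite X1 bop1E -hnorm_sqr.
suff : hnorm y ^+ 2 *+ 2 <=
    \sum_(j <- s) hnorm (k j) ^+ 2 + \sum_(j <- s) hnorm (X j y) ^+ 2.
  by rewrite E mulr2n lerD2r.
rewrite {1}hnorm_sqr {1}/y inner_suml raddf_sum /= -sumrMnl -big_split /=.
apply: ler_sum => j _; rewrite -{1}(sX j) inner_adjl.
have := Re_inner_CS (k j) (X j y); have := sqr_ge0 (hnorm (k j) - hnorm (X j y)).
rewrite sqrrB; lra.
Qed.

End RowContraction.

Section Amenable.
Variables (R : realType) (H : hilbertType R) (A : set (bop H)).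
Variables (G : groupType) (U : G -> bop H).
Hypothesis hA : cstar_subalgebra A.
Hypothesis hA1 : A 1.
Hypothesis hU : unitary_rep U.
Hypothesis hconj : forall g a, A a -> A (conj_action U g a).
Variables (I : choiceType) (K : I -> hilbertType R) (p : forall i, bop H -> bop (K i)).
Hypothesis hp : forall w, star_hom A (p w).
Hypothesis hp1 : forall w, p w 1 = 1.
Hypothesis hwd : forall w, traj_well_defined A U (p w).
Let pi := total_rep A U p.

Variables (L : hilbertType R) (rho : bop H -> bop L) (W : G -> bop L).
Hypothesis hrho : star_hom A rho.
Hypothesis hrho1 : rho 1 = 1.
Hypothesis hW : unitary_rep W.
Hypothesis hcov : forall g a, A a -> rho (conj_action U g a) = W g * rho a * adj (W g).
Hypothesis hker : forall a, A a -> pi a = 0 -> rho a = 0.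

Lemma covariantl g a : A a -> W g * rho (conj_action U g^-1%g a) = rho a * W g.
Proof.
move=> Aa; rewrite hcov // (unitary_repV g hW) adjK !mulrA.
by rewrite (hW.2 g).2 mul1r.
Qed.

Lemma covariantr g a : A a -> rho (conj_action U g a) * W g = W g * rho a.
Proof. by move=> Aa; rewrite hcov // -mulrA (hW.2 g).1 mulr1. Qed.

(** [rho] factors through the image of [A] under [pi], so the matrix over [rho] is
    dominated by the matrix over [pi], which [total_rep_matrix] controls. *)
Lemma covariant_matrix_norm (c : G -> bop H) (F : {fset G}) : fin_supp A c ->
  opnorm (mxop (fun s q : F =>
    rho (conj_action U (val s)^-1%g (c (val s * (val q)^-1)%g))))
  <= opnorm (pi (B0_sum U c)).
Proof.
move=> fc.
pose N (s q : F) := conj_action U (val s)^-1%g (c (val s * (val q)^-1)%g).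
have AN s q : A (N s q) by apply: hconj; exact: fc.1.
have hpi : star_hom A pi by exact: (total_rep_star_hom hA hA1 hU hconj hp hp1 hwd).
have pi1 : pi 1 = 1 by exact: (total_rep1 hA hA1 hU hconj hp hp1 hwd).
apply: le_trans (matrix_contractive_ker hA hA1 hpi hrho pi1 hrho1 hker AN) _.
apply: opnorm_le => [|x]; first exact: opnorm_ge0.
rewrite -(@ler_pXn2r _ 2) ?nnegrE ?mulr_ge0 ?hnorm_ge0 ?opnorm_ge0 // exprMn.
pose h q := if insub q is Some u then x u else 0 : dsum (fun w => ell2 G (K w)).
have hE (u : F) : h (val u) = x u by rewrite /h valK.
have le := total_rep_matrix hA hA1 hU hconj hp hp1 hwd F h fc.
have subst_le (a b c' d k : R) : a = b -> c' = d -> b <= k * d -> a <= k * c'.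
  by move=> -> ->.
apply: subst_le le.
- etransitivity; first exact: fin_hnorm_sqr.
  etransitivity; last by apply/esym; exact: big_seq_fsetE.
  apply: eq_bigr => s _; congr (hnorm _ ^+ 2).
  etransitivity; first exact: mxopE.
  etransitivity; last by apply/esym; exact: big_seq_fsetE.
  by apply: eq_bigr => q _; rewrite hE.
- etransitivity; first exact: fin_hnorm_sqr.
  etransitivity; last by apply/esym; exact: big_seq_fsetE.
  by apply: eq_bigr => s _; rewrite hE.
Qed.

Section OneApproximation.
Variable x : G -> bop H.
Hypothesis fx : fin_supp (Defs.center A) x.
Hypothesis x0 : forall g, op_ge0 (x g).
Hypothesis x1 : \sum_(g \in [set: G]) x g ^+ 2 = 1.
Let F := fsupp x.
Let Ax g : A (x g) := (fx.1 g).1.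
Let xC g a : A a -> x g * a = a * x g := (fx.1 g).2 a.
Let sx g : adj (x g) = x g := op_ge0_selfadjoint (x0 g).
Let xF g : g \notin F -> x g = 0 := fsuppP fx (g := g).

(** Close to [1] when [x] is almost invariant under [s]. *)
Definition overlap s := \sum_(g <- F) x g * conj_action U s (x (s^-1 * g)%g).

Let A_overlap s : A (overlap s).
Proof. by apply: (cstar_sum hA) => g _; apply: (cstarM hA) => //; exact: hconj. Qed.

Let sum_x : \sum_(g <- F) x g * x g = 1.
Proof.
rewrite -x1; apply/esym/fsbigTE => g /xF ->.
by rewrite expr2 mul0r.
Qed.

(** [1 - overlap s] is, up to sign, the row of the [x g] applied to the column of the
    differences, and the row is contractive. *)
Lemma overlap_norm s :
  opnorm (1 - overlap s) <=
  norm2 (fun g => conj_action U s (x (s^-1 * g)%g) - x g).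
Proof.
pose d g := conj_action U s (x (s^-1 * g)%g) - x g.
pose F' := (F `|` [fset (s * g)%g | g in F])%fset.
have dF' g : g \notin F' -> d g = 0.
  rewrite in_fsetU negb_or => /andP[gF gsF]; rewrite /d (xF gF).
  rewrite (xF (g := (s^-1 * g)%g)) ?conj_action0 ?subr0 //.
  apply: contraNN gsF => h; apply/imfsetP; exists (s^-1 * g)%g => //=.
  by rewrite mulVKg.
have sd g : adj (d g) = d g by rewrite adjB -conj_action_adj !sx.
have -> : norm2 d = Num.sqrt (opnorm (\sum_(g <- F') d g * d g)).
  congr (Num.sqrt (opnorm _)); rewrite (fsbigTE F') => [|g /dF' ->].
    by apply: eq_bigr => g _; rewrite sd.
  by rewrite mul0r.
have -> : 1 - overlap s = - \sum_(g <- F) x g * d g.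
  rewrite -{1}sum_x /overlap -sumrB -sumrN; apply: eq_bigr => g _.
  by rewrite mulrBr opprB.
rewrite opnormN; apply: opnorm_le => [|y]; first exact: sqrtr_ge0.
rewrite -(@ler_pXn2r _ 2) ?nnegrE ?mulr_ge0 ?hnorm_ge0 ?sqrtr_ge0 // exprMn.
rewrite (sqr_sqrtr (opnorm_ge0 _)) bop_sumE.
apply: le_trans (row_contraction _ sx sum_x) _.
apply: (@le_trans _ _ (\sum_(g <- F') hnorm (d g y) ^+ 2)).
  by apply: fset_sum_le; [exact: fsubsetUl|move=> g; exact: sqr_ge0].
rewrite sum_hnorm_sqr; under eq_bigr do rewrite sd.
apply: le_trans (Re_inner_CS _ _) _; rewrite expr2 mulrA.
by rewrite ler_wpM2r ?hnorm_ge0 ?opnormP.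
Qed.

(** The left-hand vector is the contractive row of the [rho (x g) W_g] applied to the
    matrix of [covariant_matrix_norm] at the vector [eta], whose entries
    [W_q^* rho (x q) xi] satisfy [|eta| = |xi|]. *)
Lemma overlap_sum_le c (r : {fset G}) xi : fin_supp A c ->
  (forall g, g \notin r -> c g = 0) ->
  hnorm (\sum_(s <- r) rho (c s) (rho (overlap s) (W s xi))) <=
  opnorm (pi (B0_sum U c)) * hnorm xi.
Proof.
move=> fc cr; have Ac := fc.1; set T := pi _.
rewrite -(@ler_pXn2r _ 2) ?nnegrE ?mulr_ge0 ?hnorm_ge0 ?opnorm_ge0 // exprMn.
pose k g := \sum_(s <- r) rho (c s) (W s (rho (x (s^-1 * g)%g) xi)).
have Acx s g : A (conj_action U s (x g)) by exact: hconj.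
have rx0 : rho 0 = 0 := star_hom0 hA hrho.
have -> : \sum_(s <- r) rho (c s) (rho (overlap s) (W s xi)) =
    \sum_(g <- F) rho (x g) (k g).
  under eq_bigr => s _.
    rewrite /overlap (star_hom_sum hA hrho) ?bop_sumE ?bop_app_sum; last first.
      by move=> g _; exact: (cstarM hA).
    over.
  rewrite exchange_big /=; apply: eq_bigr => g _.
  rewrite /k bop_app_sum; apply: eq_bigr => s _.
  suff E : rho (c s) * rho (x g * conj_action U s (x (s^-1 * g)%g)) * W s =
      rho (x g) * (rho (c s) * (W s * rho (x (s^-1 * g)%g))).
    exact: (congr1 (fun T : bop L => T xi) E).
  rewrite -covariantr // (star_homM hrho) // !mulrA; congr (_ * _ * _).
  by rewrite -!(star_homM hrho) // xC.
have srx g : adj (rho (x g)) = rho (x g) by rewrite -(star_hom_adj hrho) // sx.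
have srx1 : \sum_(g <- F) rho (x g) * rho (x g) = 1.
  under eq_bigr do rewrite -(star_homM hrho) //.
  by rewrite -(star_hom_sum hA hrho) ?sum_x // => g _; exact: (cstarM hA).
apply: le_trans (row_contraction _ srx srx1) _.
pose eta := fvec (fun q : F => adj (W (val q)) (rho (x (val q)) xi)).
pose N (s q : F) := rho (conj_action U (val s)^-1%g (c (val s * (val q)^-1)%g)).
have keta (g : F) : k (val g) = W (val g) (mxop N eta g).
  rewrite mxopE bop_app_sum /k.
  pose Q s := rho (c s) (W s (rho (x (s^-1 * val g)%g) xi)).
  rewrite -[LHS]/(\sum_(s <- r) Q s) -(@reindex_quotient _ _ F r (val g) Q).
  - rewrite big_seq_fsetE /=; apply: eq_bigr => q _.
    rewrite /Q /N [in x _]invgM invgK mulgVK.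
    set g' := val g; set q' := val q.
    suff E : rho (c (g' * q'^-1)%g) * W (g' * q'^-1)%g =
        W g' * rho (conj_action U g'^-1%g (c (g' * q'^-1)%g)) * adj (W q').
      exact: (congr1 (fun T : bop L => T (rho (x q') xi)) E).
    by rewrite covariantl // -(unitary_repV _ hW) -mulrA -hW.1.
  - by move=> s /cr cs; rewrite /Q cs rx0.
  - by move=> s /xF xs; rewrite /Q xs rx0 bop0E !bop_app0.
rewrite big_seq_fsetE /=.
under eq_bigr do rewrite keta (unitary_hnorm _ _ hW).
rewrite -(fin_hnorm_sqr (mxop N eta)).
have neta : hnorm eta ^+ 2 = hnorm xi ^+ 2.
  rewrite fin_hnorm_sqr /=.
  rewrite -(big_seq_fsetE _ F xpredT (fun q => hnorm (adj (W q) (rho (x q) xi)) ^+ 2)).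
  under eq_bigr do rewrite -(unitary_repV _ hW) (unitary_hnorm _ _ hW).
  by rewrite sum_hnorm_sqr; under eq_bigr do rewrite srx; rewrite srx1 bop1E -hnorm_sqr.
rewrite -neta -exprMn ler_pXn2r ?nnegrE ?mulr_ge0 ?hnorm_ge0 ?opnorm_ge0 //.
by apply: opnorm_bound; exact: covariant_matrix_norm.
Qed.

Lemma covariant_norm_approx c (r : {fset G}) (e : R) : fin_supp A c ->
  (forall g, g \notin r -> c g = 0) ->
  (forall s, s \in r -> norm2 (fun g => conj_action U s (x (s^-1 * g)%g) - x g) <= e) ->
  opnorm (\sum_(s <- r) rho (c s) * W s) <=
  opnorm (pi (B0_sum U c)) + (\sum_(s <- r) opnorm (c s)) * e.
Proof.
move=> fc cr hx; have Ac := fc.1.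
have e0 : 0 <= (\sum_(s <- r) opnorm (c s)) * e.
  have [->|[s sr]] := fset_0Vmem r; first by rewrite big_seq_fset0 mul0r.
  rewrite mulr_ge0 ?(le_trans _ (hx _ sr)) ?sqrtr_ge0 //.
  by apply: sumr_ge0 => g _; exact: opnorm_ge0.
apply: opnorm_le => [|xi]; first by rewrite addr_ge0 ?opnorm_ge0.
rewrite bop_sumE mulrDl.
have -> : \sum_(s <- r) (rho (c s) * W s) xi =
    \sum_(s <- r) rho (c s) (rho (overlap s) (W s xi)) +
    \sum_(s <- r) rho (c s) (rho (1 - overlap s) (W s xi)).
  rewrite -big_split /=; apply: eq_bigr => s _.
  by rewrite (star_homB hA hrho) // hrho1 bopBE bop1E -bop_appD addrC subrK.
apply: le_trans (hnorm_leD _ _) _; rewrite lerD ?overlap_sum_le //.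
apply: le_trans (hnorm_sum _ _ _) _; rewrite -mulrA mulr_suml.
rewrite big_seq [X in _ <= X]big_seq; apply: ler_sum => s sr.
have n1 a : A a -> opnorm (rho a) <= opnorm a.
  by exact: (star_hom_contractive hA hA1 hrho hrho1).
apply: le_trans (opnorm_bound _ (n1 _ (Ac s))) _.
rewrite ler_wpM2l ?opnorm_ge0 // -(unitary_hnorm s xi hW).
apply: opnorm_bound; apply: le_trans (n1 _ _) _; first exact: (cstarB hA).
exact: le_trans (overlap_norm s) (hx s sr).
Qed.

End OneApproximation.

Hypothesis hamen : amenable_action A (conj_action U).

(** Along the functions given by amenability the error term of [covariant_norm_approx]
    tends to [0]. *)
Lemma amenable_covariant_norm c (r : {fset G}) : fin_supp A c ->
  (forall g, g \notin r -> c g = 0) ->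
  opnorm (\sum_(s <- r) rho (c s) * W s) <= opnorm (pi (B0_sum U c)).
Proof.
move=> fc cr; have [x [fx [x0 [x1 xcvg]]]] := hamen.
apply/ler_addgt0Pl => e e0; rewrite addrC.
pose C := \sum_(s <- r) opnorm (c s).
have C0 : 0 <= C by apply: sumr_ge0 => g _; exact: opnorm_ge0.
have C1 : 0 < C + 1 by rewrite ltr_wpDl.
pose d := e / (C + 1); have d0 : 0 < d by rewrite divr_gt0.
have ex s : exists N : nat, forall i, (N <= i)%N ->
    norm2 (fun g => conj_action U s (x i (s^-1 * g)%g) - x i g) <= d.
  have /cvgrPdist_lt/(_ _ d0)[N _ hN] := xcvg s.
  exists N => i Ni; have /= := hN i Ni.
  by rewrite sub0r normrN => /ltW; apply: le_trans; exact: ler_norm.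
have [n hn] := choice ex.
pose i := \max_(s <- r) n s.
apply: le_trans (covariant_norm_approx (fx i) (x0 i) (x1 i) (e := d) fc cr _) _.
  by move=> s sr; apply: hn; exact: leq_bigmax_seq.
by rewrite lerD2l -/C /d mulrA ler_pdivrMr // mulrC ler_wpM2l ?(ltW e0) // lerDl.
Qed.

End Amenable.

(** * Isometric extension to closures *)

Section IsometricExtension.
Variables (R : realType) (L M : hilbertType R) (S : Type) (D : set S).
Variables (lin : R[i] -> S -> S -> S) (mul : S -> S -> S) (star : S -> S).

Definition star_map (N : hilbertType R) (i : S -> bop N) :=
  [/\ forall c f h, D f -> D h -> i (lin c f h) = c *: i f + i h,
      forall f h, D f -> D h -> i (mul f h) = i f * i h &
      forall f, D f -> i (star f) = adj (i f)].

Definition closed_range (N : hilbertType R) (i : S -> bop N) : set (bop N) :=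
  [set T | forall e : R, 0 < e -> exists2 f, D f & opnorm (T - i f) < e].

Hypothesis D0 : D !=set0.
Hypothesis Dlin : forall c f h, D f -> D h -> D (lin c f h).
Hypothesis Dmul : forall f h, D f -> D h -> D (mul f h).
Hypothesis Dstar : forall f, D f -> D (star f).

Lemma closed_range_seq (N : hilbertType R) (i : S -> bop N) T :
  closed_range i T ->
  exists u : nat -> S, (forall n, D (u n)) /\ opcvg (fun n => i (u n)) T.
Proof.
move=> hT; have ex (n : nat) : exists f, D f /\ opnorm (T - i f) < n.+1%:R^-1.
  have [f Df lt] := hT n.+1%:R^-1 (ltac:(by rewrite invr_gt0 ltr0Sn)).
  by exists f.
have [u hu] := choice ex; exists u; split => [n|e e0]; first exact: (hu n).1.
have [n0 hn] := exists_inv_succ_lt e0; exists n0 => n /hn; apply: lt_trans.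
by rewrite opnormBC; exact: (hu n).2.
Qed.

(** The closure of the set of the pairs [(i f, j f)].  When [i f] and [j f] have the
    same norm it is the graph of the extension, and its symmetry in [i] and [j] gives
    the inverse. *)
Definition graph (N P : hilbertType R) (i : S -> bop N) (j : S -> bop P) T T' :=
  exists u : nat -> S, [/\ forall n, D (u n), opcvg (fun n => i (u n)) T &
    opcvg (fun n => j (u n)) T'].

Section Graph.
Variables (N P : hilbertType R) (i : S -> bop N) (j : S -> bop P).
Hypothesis hi : star_map i.
Hypothesis hj : star_map j.
Hypothesis hij : forall f, D f -> opnorm (i f) = opnorm (j f).

Lemma graph_sym T T' : graph i j T T' -> graph j i T' T.
Proof. by move=> [u [Du uT uT']]; exists u. Qed.

Lemma graph_diag f : D f -> graph i j (i f) (j f).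
Proof. by move=> Df; exists (fun=> f); split => //; exact: opcvg_cst. Qed.

Lemma graph_lin (c : R[i]) T T' V V' : graph i j T T' -> graph i j V V' ->
  graph i j (c *: T + V) (c *: T' + V').
Proof.
have [iL _ _] := hi; have [jL _ _] := hj.
move=> [u [Du uT uT']] [v [Dv vT vT']]; exists (fun n => lin c (u n) (v n)); split.
- by move=> n; exact: Dlin.
- under eq_fun do rewrite iL //.
  by apply: opcvgD => //; exact: opcvgZ.
- under eq_fun do rewrite jL //.
  by apply: opcvgD => //; exact: opcvgZ.
Qed.

Lemma graph_mul T T' V V' : graph i j T T' -> graph i j V V' ->
  graph i j (T * V) (T' * V').
Proof.
have [_ iM _] := hi; have [_ jM _] := hj.
move=> [u [Du uT uT']] [v [Dv vT vT']]; exists (fun n => mul (u n) (v n)); split.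
- by move=> n; exact: Dmul.
- by under eq_fun do rewrite iM //; exact: opcvgM.
- by under eq_fun do rewrite jM //; exact: opcvgM.
Qed.

Lemma graph_adj T T' : graph i j T T' -> graph i j (adj T) (adj T').
Proof.
have [_ _ iS] := hi; have [_ _ jS] := hj.
move=> [u [Du uT uT']]; exists (fun n => star (u n)); split.
- by move=> n; exact: Dstar.
- by under eq_fun do rewrite iS //; exact: opcvg_adj.
- by under eq_fun do rewrite jS //; exact: opcvg_adj.
Qed.

Lemma graph_norm T T' : graph i j T T' -> opnorm T <= opnorm T'.
Proof.
move=> [u [Du uT uT']]; apply/ler_addgt0Pl => e e0.
have e2 : 0 < e / 2 by rewrite divr_gt0.
have [n1 h1] := uT _ e2; have [n2 h2] := uT' _ e2.
pose n := maxn n1 n2.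
have {}h1 := h1 n (leq_maxl _ _); have {}h2 := h2 n (leq_maxr _ _).
have := opnorm_le_add T (i (u n)); have := opnorm_le_add (j (u n)) T'.
by rewrite -hij // opnormBC in h1 *; move: h1 h2; lra.
Qed.

Lemma graph_total T : closed_range i T -> exists T', graph i j T T'.
Proof.
move=> /closed_range_seq[u [Du uT]].
have [|T' uT'] := @bop_complete R P (fun n => j (u n)); last by exists T', u.
move=> e e0; have e2 : 0 < e / 2 by rewrite divr_gt0.
have [n0 hn] := uT _ e2; exists n0 => m n nm nn.
have jB : j (u m) - j (u n) = j (lin (-1) (u n) (u m)).
  by have [-> // _ _] := hj; rewrite scaleN1r addrC.
have iB : i (u m) - i (u n) = i (lin (-1) (u n) (u m)).
  by have [-> // _ _] := hi; rewrite scaleN1r addrC.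
rewrite jB -hij; last exact: Dlin.
rewrite -iB; apply: le_lt_trans (opnorm_triangle T _ _) _.
by rewrite [ltRHS]splitr ltrD ?hn // opnormBC hn.
Qed.

Lemma graph_range T T' : graph i j T T' -> closed_range i T.
Proof.
by move=> [u [Du uT _]] e /uT[n hn]; exists (u n) => //; rewrite opnormBC hn.
Qed.

Lemma graph0 : graph i j 0 0.
Proof.
have [f Df] := D0; have := graph_lin (-1) (graph_diag Df) (graph_diag Df).
by rewrite !scaleN1r !addNr.
Qed.

End Graph.

Lemma closed_range_cstar (N : hilbertType R) (i : S -> bop N) : star_map i ->
  cstar_subalgebra (closed_range i).
Proof.
move=> hi; have eqn f : D f -> opnorm (i f) = opnorm (i f) by [].
have tot T : closed_range i T -> graph i i T T.
  by move=> /closed_range_seq[u [Du uT]]; exists u.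
split; first exact: graph_range (graph0 hi hi).
split=> [T V /tot hT /tot hV|].
  by have /graph_range := graph_lin hi hi 1 hT hV; rewrite scale1r.
split=> [c T /tot hT|].
  by have /graph_range := graph_lin hi hi c hT (graph0 hi hi); rewrite addr0.
split=> [T V /tot hT /tot hV|]; first exact: graph_range (graph_mul hi hi hT hV).
split=> [T /tot hT|]; first exact: graph_range (graph_adj hi hi hT).
move=> T hT e e0; have e2 : 0 < e / 2 by rewrite divr_gt0.
have [V hV lt] := hT _ e2; have [f Df lt'] := hV _ e2; exists f => //.
apply: le_lt_trans (opnorm_triangle V _ _) _.
by rewrite [ltRHS]splitr ltrD.
Qed.

Lemma isometric_extension (i : S -> bop L) (j : S -> bop M) (C : set (bop L)) :
  star_map i -> star_map j -> (forall f, D f -> opnorm (i f) = opnorm (j f)) ->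
  norm_closed C -> (forall f, D f -> C (i f)) -> C `<=` closed_range i ->
  exists Phi : bop L -> bop M, (forall f, D f -> Phi (i f) = j f) /\
    star_iso C (closed_range j) Phi.
Proof.
move=> hi hj hij cC iC dC.
have hji f (Df : D f) : opnorm (j f) = opnorm (i f) by rewrite hij.
have uniq T T' T'' : graph i j T T' -> graph i j T T'' -> T' = T''.
  move=> h h'; have g := graph_lin hi hj (-1) h h'; rewrite !scaleN1r addNr in g.
  have := graph_norm hji (graph_sym g); rewrite opnorm0 => n0.
  apply/esym/eqP; rewrite -subr_eq0 addrC; apply/eqP/opnorm_eq0.
  by apply/eqP; rewrite eq_le opnorm_ge0 n0.
have uniq' T T' V : graph i j T V -> graph i j T' V -> T = T'.
  move=> h h'; have g := graph_lin hi hj (-1) h h'; rewrite !scaleN1r addNr in g.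
  have := graph_norm hij g; rewrite opnorm0 => n0.
  apply/esym/eqP; rewrite -subr_eq0 addrC; apply/eqP/opnorm_eq0.
  by apply/eqP; rewrite eq_le opnorm_ge0 n0.
pose Phi T := xget 0 [set T' | graph i j T T'].
have PhiP T T' : graph i j T T' -> Phi T = T'.
  move=> h; have := xgetI 0 (h : [set T' | graph i j T T'] T') => h'.
  exact: uniq h' h.
have CP T : C T -> graph i j T (Phi T).
  move=> /dC/(graph_total hi hj hij)[T' h]; by rewrite (PhiP _ _ h).
have C_of T T' : graph i j T T' -> C T.
  move=> [u [Du uT _]]; apply: (opcvg_closed cC _ uT) => n; exact: iC.
exists Phi; split; first by move=> f Df; apply: PhiP; exact: graph_diag.
split.
  split=> [c a b Ca Cb|]; first by apply: PhiP; apply: (graph_lin hi hj); exact: CP.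
  split=> [a b Ca Cb|a Ca]; apply: PhiP; first by apply: (graph_mul hi hj); exact: CP.
  by apply: (graph_adj hi hj); exact: CP.
split.
- by move=> T CT; exact: graph_range (graph_sym (CP _ CT)).
- move=> T T'; rewrite !inE => CT CT' E; have h := CP _ CT; rewrite E in h.
  exact: uniq' h (CP _ CT').
- move=> T' /(graph_total hj hi hji)[T /graph_sym h]; exists T; first exact: C_of h.
  exact: PhiP.
Qed.

End IsometricExtension.

(** * Convolution and the integrated form *)

Section CrossedProduct.
Variables (R : realType) (H : hilbertType R) (P : set (bop H)).
Variables (G : groupType) (V : G -> bop H).
Hypothesis hV : unitary_rep V.
Hypothesis P0 : P 0.
Hypothesis P1 : P 1.
Hypothesis PP : forall (c : R[i]) a b, P a -> P b -> P (c *: a + b).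
Hypothesis PM : forall a b, P a -> P b -> P (a * b).
Hypothesis Padj : forall a, P a -> P (adj a).
Hypothesis Pconj : forall g a, P a -> P (conj_action V g a).

Implicit Types (f h : G -> bop H) (g s t : G).

Let PD a b : P a -> P b -> P (a + b).
Proof. by move=> Pa Pb; have := PP 1 Pa Pb; rewrite scale1r. Qed.

Let Psum (I : Type) (s : seq I) (F : I -> bop H) :
  (forall i, P (F i)) -> P (\sum_(i <- s) F i).
Proof. by move=> h; elim/big_rec: _ => // i x _ Px; exact: PD. Qed.

Let alpha := conj_action V.
Let j := integrated_form id V.

Lemma integrated_formE f (r : {fset G}) : (forall g, g \notin r -> f g = 0) ->
  j f = \sum_(g <- r) f g * V g.
Proof. by move=> h; apply: fsbigTE => g /h ->; rewrite mul0r. Qed.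

Lemma fin_supp_lin (c : R[i]) f h : fin_supp P f -> fin_supp P h ->
  fin_supp P (fun g => c *: f g + h g).
Proof.
move=> ff fh; apply: (@fin_supp_fset _ _ _ _ (fsupp f `|` fsupp h)%fset) => g.
  by apply: PP; [exact: ff.1|exact: fh.1].
rewrite in_fsetU negb_or => /andP[/(fsuppP ff) -> /(fsuppP fh) ->].
by rewrite scaler0 addr0.
Qed.

Lemma integrated_form_lin (c : R[i]) f h : fin_supp P f -> fin_supp P h ->
  j (fun g => c *: f g + h g) = c *: j f + j h.
Proof.
move=> ff fh; pose r := (fsupp f `|` fsupp h)%fset.
have f0 g : g \notin r -> f g = 0 by rewrite in_fsetU negb_or => /andP[/(fsuppP ff)].
have h0 g : g \notin r -> h g = 0 by rewrite in_fsetU negb_or => /andP[_ /(fsuppP fh)].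
rewrite !(integrated_formE (r := r)) // => [|g gr]; last first.
  by rewrite f0 // h0 // scaler0 addr0.
rewrite scaler_sumr -big_split /=; apply: eq_bigr => g _.
by rewrite mulrDl bopZl.
Qed.

Definition conv_supp (f h : G -> bop H) : {fset G} :=
  [fset (s * t)%g | s in fsupp f, t in fsupp h]%fset.

Lemma convolutionE f h g : fin_supp P f ->
  convolution alpha f h g = \sum_(s <- fsupp f) f s * alpha s (h (s^-1 * g)%g).
Proof. by move=> ff; apply: fsbigTE => s /(fsuppP ff) ->; rewrite mul0r. Qed.

Lemma conv_supp0 f h s g : fin_supp P h -> s \in fsupp f -> g \notin conv_supp f h ->
  h (s^-1 * g)%g = 0.
Proof.
move=> fh sf gr; apply: (fsuppP fh); apply: contraNN gr => hs.
by apply/imfset2P; exists s => //; exists (s^-1 * g)%g => //; rewrite mulVKg.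
Qed.

Lemma convolution0 f h g : fin_supp P f -> fin_supp P h -> g \notin conv_supp f h ->
  convolution alpha f h g = 0.
Proof.
move=> ff fh gr; rewrite convolutionE // big_seq big1 // => s sf.
by rewrite (conv_supp0 fh sf gr) /alpha conj_action0 mulr0.
Qed.

Lemma fin_supp_convolution f h : fin_supp P f -> fin_supp P h ->
  fin_supp P (convolution alpha f h).
Proof.
move=> ff fh; apply: (@fin_supp_fset _ _ _ _ (conv_supp f h)) => g.
  rewrite convolutionE //; apply: Psum => s; apply: PM; first exact: ff.1.
  by apply: Pconj; exact: fh.1.
exact: convolution0.
Qed.

Lemma integrated_form_convolution f h : fin_supp P f -> fin_supp P h ->
  j (convolution alpha f h) = j f * j h.
Proof.
move=> ff fh; rewrite (integrated_formE (r := conv_supp f h)); last first.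
  by move=> g; exact: convolution0.
rewrite (integrated_formE (r := fsupp f)); last by move=> g; exact: (fsuppP ff).
under eq_bigr do rewrite convolutionE // mulr_suml.
rewrite exchange_big /= mulr_suml big_seq [RHS]big_seq; apply: eq_bigr => s sf.
have -> : j h = \sum_(g <- conv_supp f h) h (s^-1 * g)%g * V (s^-1 * g)%g.
  rewrite /j /integrated_form (@reindex_fsbigT _ _ _ _ _ (fun g => s^-1 * g)%g) /=.
    by apply: fsbigTE => g gr; rewrite (conv_supp0 fh sf gr) mul0r.
  by exists (fun g => s * g)%g => g; rewrite ?mulVKg ?mulKg.
rewrite mulr_sumr; apply: eq_bigr => g _.
rewrite /alpha /conj_action hV.1 (unitary_repV _ hV) !mulrA.
by [].
Qed.

Lemma fin_supp_star f : fin_supp P f -> fin_supp P (convolution_star alpha f).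
Proof.
move=> ff; apply: (@fin_supp_fset _ _ _ _ [fset g^-1%g | g in fsupp f]%fset) => g.
  by apply: Pconj; apply: Padj; exact: ff.1.
move=> gr; rewrite /convolution_star (fsuppP ff) ?adj0 ?/alpha ?conj_action0 //.
by apply: contraNN gr => h; apply/imfsetP; exists g^-1%g => //=; rewrite invgK.
Qed.

Lemma integrated_form_star f : fin_supp P f ->
  j (convolution_star alpha f) = adj (j f).
Proof.
move=> ff; rewrite [X in adj X](integrated_formE (r := fsupp f)); last first.
  by move=> g; exact: (fsuppP ff).
rewrite adj_sum /j /integrated_form.
rewrite (@reindex_fsbigT _ _ _ _ _ (@monoid.inv G)) /=; last first.
  by exists (@monoid.inv G) => g; rewrite invgK.
rewrite (fsbigTE (fsupp f)) => [|g /(fsuppP ff) fg]; last first.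
  by rewrite /convolution_star invgK fg adj0 /alpha conj_action0 mul0r.
apply: eq_bigr => g _; rewrite /convolution_star invgK adjM.
by rewrite /alpha /conj_action (unitary_repV _ hV) adjK -mulrA (hV.2 g).2 mulr1.
Qed.

Lemma integrated_form_single g a : P a -> fin_supp P (single g a) /\
  j (single g a) = a * V g.
Proof.
move=> Pa; have h0 s : s \notin [fset g]%fset -> single g a s = 0.
  by rewrite in_fset1 /single; case: eqP.
split; last by rewrite (integrated_formE h0) big_seq_fset1 /single eqxx.
by apply: fin_supp_fset h0 => s; rewrite /single; case: eqP.
Qed.

Lemma cstar_generated_cstar (X : set (bop H)) : cstar_subalgebra (cstar_generated X).
Proof.
split; first by move=> A [hA _]; exact: cstar0.
split; first by move=> S T hS hT A hA; apply: (cstarD hA.1); [exact: hS|exact: hT].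
split; first by move=> c T hT A hA; apply: (cstarZ hA.1); exact: hT.
split; first by move=> S T hS hT A hA; apply: (cstarM hA.1); [exact: hS|exact: hT].
split; first by move=> T hT A hA; apply: (cstar_adj hA.1); exact: hT.
move=> T hT A hA; apply: (cstar_closed hA.1) => e /hT[S hS lt].
by exists S => //; exact: hS.
Qed.

(** The range of the integrated form is a star algebra that contains the generators, so
    its closure is the C*-algebra that they generate. *)
Lemma integrated_form_range :
  closed_range (fin_supp P) j = cstar_generated (P `|` [set V g | g in [set: G]]).
Proof.
have D0 : (fin_supp P : set (G -> bop H)) !=set0.
  by exists (single (1%g : G) (0 : bop H)); exact: (integrated_form_single 1%g P0).1.
have jmap : star_map (fin_supp P) (fun c f h g => c *: f g + h g)
    (convolution alpha) (convolution_star alpha) j.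
  split; [exact: integrated_form_lin|exact: integrated_form_convolution|].
  exact: integrated_form_star.
apply/seteqP; split=> [T hT|].
  apply: (cstar_closed (cstar_generated_cstar _)) => e /hT[f ff lt]; exists (j f) => //.
  rewrite (integrated_formE (r := fsupp f)); last by move=> g; exact: (fsuppP ff).
  apply: (cstar_sum (cstar_generated_cstar _)) => g _.
  apply: (cstarM (cstar_generated_cstar _)); apply: sub_gen_smallest.
    by left; exact: ff.1.
  by right; exists g.
apply: smallest_sub.
  apply: (closed_range_cstar D0 _ _ _ jmap);
    [exact: fin_supp_lin|exact: fin_supp_convolution|exact: fin_supp_star].
have sub a g : P a -> closed_range (fin_supp P) j (a * V g).
  move=> Pa e e0; have [fs <-] := integrated_form_single g Pa.
  by exists (single g a) => //; rewrite subrr opnorm0.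
move=> T [PT|[g _ <-]]; last by rewrite -[V g]mul1r; exact: sub.
by rewrite -[T]mulr1 -(unitary_rep1 hV); exact: sub.
Qed.

Lemma crossed_product_iso (L : hilbertType R) (C : set (bop L))
    (iota : (G -> bop H) -> bop L) :
  (forall f, fin_supp P f -> universal_norm P alpha f = opnorm (j f)) ->
  full_crossed_product P alpha C iota ->
  exists Phi : bop L -> bop H, (forall f, fin_supp P f -> Phi (iota f) = j f) /\
    star_iso C (cstar_generated (P `|` [set V g | g in [set: G]])) Phi.
Proof.
move=> hn [hC [iC [ilin [imul [istar [inorm idense]]]]]].
rewrite -integrated_form_range.
apply: (@isometric_extension R L H _ (fin_supp P) (fun c f h g => c *: f g + h g)
    (convolution alpha) (convolution_star alpha)).
- exact: fin_supp_lin.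
- exact: fin_supp_convolution.
- exact: fin_supp_star.
- by split.
- split; [exact: integrated_form_lin|exact: integrated_form_convolution|].
  exact: integrated_form_star.
- by move=> f ff; rewrite inorm // hn.
- exact: cstar_closed hC.
- exact: iC.
- by move=> T CT e e0; exact: idense.
Qed.

End CrossedProduct.

(** * The universal norm of the crossed product *)

Section UniversalNorm.
Variables (R : realType) (H : hilbertType R) (A : set (bop H)).
Variables (G : groupType) (U : G -> bop H).
Hypothesis hA : cstar_subalgebra A.
Hypothesis hA1 : A 1.
Hypothesis hU : unitary_rep U.
Hypothesis hconj : forall g a, A a -> A (conj_action U g a).
Hypothesis hamen : amenable_action A (conj_action U).
Variables (I : choiceType) (K : I -> hilbertType R) (p : forall i, bop H -> bop (K i)).
Hypothesis hp : forall w, star_hom A (p w).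
Hypothesis hp1 : forall w, p w 1 = 1.
Hypothesis hwd : forall w, traj_well_defined A U (p w).
Let pi := total_rep A U p.
Let V g := pi (U g).
Let piA : set (bop (dsum (fun w => ell2 G (K w)))) := [set pi a | a in A].

Let hpi : star_hom A pi := total_rep_star_hom hA hA1 hU hconj hp hp1 hwd.
Let pi1 : pi 1 = 1 := total_rep1 hA hA1 hU hconj hp hp1 hwd.
Let hV : unitary_rep V := total_rep_unitary hA hA1 hU hconj hp hp1 hwd.
Let cov g a : A a -> pi (conj_action U g a) = conj_action V g (pi a) :=
  total_rep_covariant hA hA1 hU hconj hp hp1 hwd g (a := a).

Lemma lift_fin_supp f : fin_supp piA f -> exists c : G -> bop H,
  [/\ fin_supp A c, forall g, g \notin fsupp f -> c g = 0 & forall g, pi (c g) = f g].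
Proof.
move=> ff.
have ex g : exists a, [/\ A a, pi a = f g & g \notin fsupp f -> a = 0].
  have [gf|gf] := boolP (g \in fsupp f).
    by have [a Aa af] := ff.1 g; exists a.
  by exists 0; split; [exact: cstar0|rewrite (star_hom0 hA hpi) (fsuppP ff gf)|].
have [c hc] := choice ex; exists c.
have c0 g : g \notin fsupp f -> c g = 0 by have [_ _] := hc g.
by split=> // [|g]; [apply: fin_supp_fset c0 => g|]; have [] := hc g.
Qed.

(** The supremum is attained at the representation [id], [V] on the trajectories
    space: [amenable_covariant_norm] makes it an upper bound. *)
Lemma universal_normE f : fin_supp piA f ->
  universal_norm piA (conj_action V) f = opnorm (integrated_form id V f).
Proof.
move=> ff; have [c [fc c0 cf]] := lift_fin_supp ff.
have jE : integrated_form id V f = pi (B0_sum U c).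
  rewrite (integrated_formE _ (r := fsupp f)); last by move=> g /(fsuppP ff).
  rewrite /pi (total_rep_sum hA hA1 hU hconj hp hp1 hwd fc c0).
  by apply: eq_bigr => g _; rewrite -cf.
rewrite /universal_norm; set S := [set r | _].
have inS : S (opnorm (integrated_form id V f)).
  by exists (dsum (fun w => ell2 G (K w))), id, V.
have ubS : ubound S (opnorm (integrated_form id V f)).
  move=> _ [L [rho [W [[hrho [rho1 [hW hcov]]] ->]]]].
  have piAE a : A a -> piA (pi a) by move=> Aa; exists a.
  have rho0 : rho 0 = 0.
    have P0 : piA 0 by rewrite -(star_hom0 hA hpi); apply: piAE; exact: cstar0.
    have := hrho.1 (-1) 0 0 P0 P0.
    by rewrite !scaleN1r oppr0 addr0 addNr.
  rewrite jE (_ : integrated_form rho W f = \sum_(g <- fsupp f) rho (pi (c g)) * W g).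
    apply: (amenable_covariant_norm hA hA1 hU hconj hp hp1 hwd
      (rho := fun a => rho (pi a))) => //.
    - split=> [d a b Aa Ab|].
        by rewrite (star_homP hpi) // hrho.1 //; exact: piAE.
      split=> [a b Aa Ab|a Aa].
        by rewrite (star_homM hpi) // hrho.2.1 //; exact: piAE.
      by rewrite (star_hom_adj hpi) // hrho.2.2 //; exact: piAE.
    - by rewrite pi1.
    - by move=> g a Aa; rewrite cov // hcov //; exact: piAE.
    - by move=> a Aa; rewrite -/pi => ->.
  rewrite /integrated_form (fsbigTE (fsupp f)) => [|g /(fsuppP ff) ->].
    by apply: eq_bigr => g _; rewrite cf.
  by rewrite rho0 mul0r.
apply/eqP; rewrite eq_le; apply/andP; split.
  by apply: ge_sup => //; exists (opnorm (integrated_form id V f)).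
by apply: ub_le_sup => //; exists (opnorm (integrated_form id V f)).
Qed.

Lemma total_rep_crossed_product (L : hilbertType R) (C : set (bop L))
    (iota : (G -> bop (dsum (fun w => ell2 G (K w)))) -> bop L) :
  full_crossed_product piA (conj_action V) C iota ->
  exists Phi : bop L -> bop (dsum (fun w => ell2 G (K w))),
    (forall f, fin_supp piA f -> Phi (iota f) = integrated_form id V f) /\
    star_iso C (cstar_generated (piA `|` [set V g | g in [set: G]])) Phi.
Proof.
apply: crossed_product_iso => //.
- by rewrite -(star_hom0 hA hpi); exists 0 => //; exact: cstar0.
- by rewrite -pi1; exists 1.
- move=> c _ _ [a Aa <-] [b Ab <-]; rewrite -(star_homP hpi) //.
  by exists (c *: a + b) => //; apply: (cstarD hA) => //; exact: cstarZ.
- move=> _ _ [a Aa <-] [b Ab <-]; rewrite -(star_homM hpi) //.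
  by exists (a * b) => //; exact: cstarM.
- move=> _ [a Aa <-]; rewrite -(star_hom_adj hpi) //.
  by exists (adj a) => //; exact: cstar_adj.
- move=> g _ [a Aa <-]; rewrite -cov //.
  by exists (conj_action U g a) => //; exact: hconj.
exact: universal_normE.
Qed.

End UniversalNorm.

Theorem proposition10 (R : realType) (H : hilbertType R)
    (A Z : set (bop H)) (G : groupType) (U : G -> bop H)
    (hA : cstar_subalgebra A) (hA1 : A 1)
    (hU : unitary_rep U)
    (hZ : cstar_subalgebra Z) (hZ1 : Z 1) (hZA : Z `<=` center A)
    (halphaA : forall g : G, star_iso A A (conj_action U g))
    (halphaZ : forall g : G, star_iso Z Z (conj_action U g))
    (hamenable : amenable_action A (conj_action U))
    (m_ : beta_orbits Z U -> bop H -> R[i])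
    (hm : forall w : beta_orbits Z U, set_val w (m_ w))
    (K : beta_orbits Z U -> hilbertType R)
    (phi : forall w : beta_orbits Z U, set (bop H) -> bop (K w))
    (hphi : forall w : beta_orbits Z U,
       faithful_quotient_rep A (ideal_at A Z (m_ w)) (phi w))
    (hwd : forall w : beta_orbits Z U, traj_well_defined A U (pi_prime A m_ phi w)) :
  let pi := local_traj_rep A m_ phi in
  let piA := [set pi a | a in A] in
  let piB := cstar_generated (piA `|` [set pi (U g) | g in [set: G]]) in
  let coef_e (G0 : {fset G}) (a : G -> bop H) : bop H :=
    if 1%g \in G0 then a 1%g else 0 in
  (forall (V : set (bop H -> R[i])) (G0 : {fset G}) (a : G -> bop H),
     weak_open (character_space Z) V -> V !=set0 ->
     (forall s, s \in G0 -> A (a s)) ->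
     forall zV, bump_in Z V zV ->
       opnorm (pi zV *
         pi (coef_e G0 a + \sum_(s <- G0 | s != 1%g) a s * U s))
       >= opnorm (pi zV * pi (coef_e G0 a))) /\
  (forall (V : set (bop H -> R[i])) (G0 : {fset G}) (a : G -> bop H),
     weak_open (character_space Z) V -> V !=set0 ->
     (forall s, s \in G0 -> A (a s)) ->
     exists2 zV, bump_in Z V zV &
       opnorm (pi zV * pi (coef_e G0 a))
       <= opnorm (pi zV * \sum_(s <- G0) pi (a s) * pi (U s))) /\
  (localizable A Z ->
   forall (L : hilbertType R) (C : set (bop L))
     (iota : (G -> bop (local_traj_space K)) -> bop L),
     full_crossed_product piA (conj_action (fun g => pi (U g))) C iota ->
     exists Phi : bop L -> bop (local_traj_space K),
       (forall f, fin_supp piA f ->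
          Phi (iota f) = integrated_form id (fun g => pi (U g)) f) /\
       star_iso C piB Phi).
Proof.
have hconj g a : A a -> A (conj_action U g a).
  by have [_ [h _ _]] := halphaA g; exact: h.
have hp w : star_hom A (pi_prime A m_ phi w) := (hphi w).1.
have hp1 w : pi_prime A m_ phi w 1 = 1 := (hphi w).2.1.
move=> pi piA piB coef_e.
have piE : pi = total_rep A U (pi_prime A m_ phi) by [].
pose c (G0 : {fset G}) (a : G -> bop H) g : bop H :=
  if g == 1%g then coef_e G0 a else if g \in G0 then a g else 0.
have cE (G0 : {fset G}) a : (forall s, s \in G0 -> A (a s)) ->
    fin_supp A (c G0 a) /\ B0_sum U (c G0 a) =
      coef_e G0 a + \sum_(s <- G0 | s != 1%g) a s * U s.
  move=> Aa; pose r := (1%g |` G0)%fset.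
  have c0 g : g \notin r -> c G0 a g = 0.
    by rewrite in_fset1U negb_or /c => /andP[/negbTE -> /negbTE ->].
  split.
    apply: fin_supp_fset c0 => g; rewrite /c /coef_e.
    case: eqP => _; case: ifPn => h; [exact: Aa|exact: cstar0|exact: Aa|exact: cstar0].
  rewrite (B0_sumE U c0) (bigID (fun g => g == 1%g)) /=; congr (_ + _).
    rewrite big_mkcond -(big_fset_incl _ (A := [fset 1%g]%fset)) /=; first last.
    - by move=> g _; rewrite in_fset1 => /negbTE ->.
    - by rewrite fsub1set fset1U1.
    by rewrite big_seq_fset1 eqxx /c eqxx (unitary_rep1 hU) mulr1.
  rewrite big_mkcond -(big_fset_incl _ (A := G0)) /=; first last.
  - by move=> g _ gG; rewrite /c (negbTE gG); case: eqP => // _; rewrite mul0r.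
  - exact: fsubsetUr.
  rewrite [RHS]big_mkcond big_seq [RHS]big_seq; apply: eq_bigr => g gG.
  by rewrite /c gG; case: eqP.
have part1 (G0 : {fset G}) (a : G -> bop H) z : A z ->
   (forall s, s \in G0 -> A (a s)) ->
   opnorm (pi z * pi (coef_e G0 a)) <=
   opnorm (pi z * pi (coef_e G0 a + \sum_(s <- G0 | s != 1%g) a s * U s)).
  move=> Az Aa; have [fc <-] := cE G0 a Aa.
  have := total_rep_diagonal hA hA1 hU hconj hp hp1 hwd Az fc.
  by rewrite {1}/c eqxx.
have ZA z : Z z -> A z by move=> /hZA[].
split; first by move=> V G0 a _ _ Aa z [Zz _]; apply: part1 => //; exact: ZA.
split.
  move=> V G0 a oV V0 Aa; have [z bz] := bump_exists hZ hZ1 oV V0.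
  have [fc Bc] := cE G0 a Aa; exists z; first exact: bz.
  suff -> : \sum_(s <- G0) pi (a s) * pi (U s) =
      pi (coef_e G0 a + \sum_(s <- G0 | s != 1%g) a s * U s).
    exact: part1 (ZA _ bz.1) Aa.
  pose c' g := if g \in G0 then a g else 0.
  have c'0 g : g \notin G0 -> c' g = 0 by rewrite /c' => /negbTE ->.
  have fc' : fin_supp A c'.
    apply: fin_supp_fset c'0 => g; rewrite /c'.
    by case: ifPn => h; [exact: Aa|exact: cstar0].
  have -> : coef_e G0 a + \sum_(s <- G0 | s != 1%g) a s * U s = B0_sum U c'.
    rewrite -Bc; congr (B0_sum U _); apply/funext => g.
    by rewrite /c /c' /coef_e; case: eqP => [->|].
  rewrite piE (total_rep_sum hA hA1 hU hconj hp hp1 hwd fc' c'0).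
  by rewrite big_seq [RHS]big_seq; apply: eq_bigr => g gG; rewrite /c' gG.
move=> _ L C iota.
exact: (total_rep_crossed_product hA hA1 hU hconj hamenable hp hp1 hwd).
Qed.
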